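(* Let $d\ge1$, let $\Omega\subset\mathbb{R}^d$ be a bounded Lipschitz domain, $\alpha,\beta>0$, $\omega\in\mathbb{R}^d$ and $\mathbf{c}=\omega\otimes\omega$. The functional $\mathrm{TGV}^{\mathrm{osci}}_{\alpha,\beta,\mathbf{c}}:L^1(\Omega)\to[0,\infty]$ is proper, lower semi-continuous on $L^1(\Omega)$, one-homogeneous (i.e., its value at $\lambda u$ is $|\lambda|$ times its value at $u$ for all $\lambda\in\mathbb{R}$, $u\in L^1(\Omega)$, with $0\cdot\infty=0$), and satisfies the triangle inequality. Further, for $u\in L^1(\Omega)$: - if $\omega\ne0$, then $\mathrm{TGV}^{\mathrm{osci}}_{\alpha,\beta,\mathbf{c}}(u)=0$ if and only if there are $C_1,C_2\in\mathbb{R}$ with $u(x)=C_1\cos(\omega\cdot x)+C_2\sin(\omega\cdot x)$ for (almost every) $x\in\Omega$; - if $\omega=0$, then $\mathrm{TGV}^{\mathrm{osci}}_{\alpha,\beta,\mathbf{c}}(u)=0$ if and only if $u$ is (almost everywhere equal to) an affine function.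
   Context: A domain is a nonempty connected open set. $S^{d\times d}$ is the space of symmetric real $d\times d$ matrices with Frobenius inner product and norm. For $X\in\{\mathbb{R},\mathbb{R}^d,S^{d\times d}\}$ and an $X$-valued distribution $\mu$ on $\Omega$, $\|\mu\|_{\mathcal M}=\sup\{\langle\mu,\phi\rangle:\phi\in C_c^\infty(\Omega,X),\ \|\phi\|_\infty\le 1\}\in[0,\infty]$, where $\|\phi\|_\infty=\sup_x|\phi(x)|$. $L^1$ functions are identified with distributions. $\nabla u$ is the weak derivative; for an $\mathbb{R}^d$-valued distribution $w$, the weak symmetrized derivative $\mathcal{E}w$ is the $S^{d\times d}$-valued distribution $\langle\mathcal{E}w,\phi\rangle=\langle w,-\mathrm{div}\,\phi\rangle$, with $(\mathrm{div}\,\phi)_i=\sum_j\partial_j\phi_{ij}$. $\mathrm{BV}(\Omega)=\{u\in L^1(\Omega):\|\nabla u\|_{\mathcal M}<\infty\}$; $\mathrm{BD}(\Omega)=\{w\in L^1(\Omega,\mathbb{R}^d):\|\mathcal{E}w\|_{\mathcal M}<\infty\}$. $\omega\otimes\omega$ is the matrix with entries $\omega_i\omega_j$, and $\mathbf{c}u$ is the matrix field with entries $c_{ij}u$. The oscillation TGV functional on $L^1(\Omega)$ is $\mathrm{TGV}^{\mathrm{osci}}_{\alpha,\beta,\mathbf{c}}(u)=\inf_{w\in\mathrm{BD}(\Omega)}\alpha\|\nabla u-w\|_{\mathcal M}+\beta\|\mathcal{E}w+\mathbf{c}u\|_{\mathcal M}$ (the infimum is attained) if $u\in\mathrm{BV}(\Omega)$,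 and $=\infty$ if $u\in L^1(\Omega)\setminus\mathrm{BV}(\Omega)$. *)

(* Defs.v *)
From HB Require Import structures.
From mathcomp Require Import all_boot all_order all_algebra.
From mathcomp Require Import all_classical all_reals all_analysis.

Set Implicit Arguments.
Unset Strict Implicit.
Unset Printing Implicit Defensive.

Import Order.TTheory GRing.Theory Num.Theory.
Import numFieldTopology.Exports numFieldNormedType.Exports.

Local Open Scope classical_set_scope.
Local Open Scope ring_scope.

(* Points of R^d are row vectors 'rV[R]_d.  Their library norm is the max norm,
   used only for topology and boundedness; |.| on R^d is [fnorm] below. *)

Definition rV_display : measure_display.
Proof. exact: default_measure_display. Qed.

Section measurable_rV.
Context {R : realType} {n : nat}.

Let coor (i : 'I_n) (x : 'rV[R]_n) : measurableTypeR R := x ord0 i.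

Let rV_set0 : g_sigma_preimage coor set0.
Proof. exact: sigma_algebra0. Qed.

Let rV_setC A : g_sigma_preimage coor A -> g_sigma_preimage coor (~` A).
Proof. exact: sigma_algebraC. Qed.

Let rV_bigcup (F : (set 'rV[R]_n)^nat) : (forall i, g_sigma_preimage coor (F i)) ->
  g_sigma_preimage coor (\bigcup_i (F i)).
Proof. exact: sigma_algebra_bigcup. Qed.

(* The product sigma-algebra of the Borel sigma-algebras of the coordinates. *)
HB.instance Definition _ := @isMeasurable.Build rV_display
  'rV[R]_n (g_sigma_preimage coor) rV_set0 rV_setC rV_bigcup.

Lemma measurable_coor (i : 'I_n) : measurable_fun setT (coor i).
Proof.
move=> _ Y mY; rewrite setTI; apply: sub_sigma_algebra => /=.
rewrite -bigcup_seq/=; exists i => /=; first by rewrite mem_index_enum.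
by exists Y => //; rewrite setTI.
Qed.

Lemma measurable_fun_rV d (T : measurableType d) (f : T -> 'rV[R]_n) :
  (forall i, measurable_fun setT (fun t => f t ord0 i : measurableTypeR R)) ->
  measurable_fun setT f.
Proof.
move=> mf; apply: (@measurability _ _ _ _ setT f
  (\big[setU/set0]_(i < n) preimage_set_system setT (coor i) measurable)) => //.
move=> _ [B + <-]; rewrite -bigcup_seq => -[i /= _ [C mC <-]].
by have := mf i measurableT C mC; rewrite !setTI.
Qed.

End measurable_rV.

Section lebesgue_rV.
Context {R : realType}.

Definition cons_rV n (p : measurableTypeR R * 'rV[R]_n) : 'rV[R]_n.+1 :=
  \row_i if unlift ord0 i is Some j then p.2 ord0 j else p.1.

Let measurable_cons_rV n : measurable_fun setT (@cons_rV n).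
Proof.
apply: measurable_fun_rV => i; under eq_fun do rewrite mxE.
case: (unliftP ord0 i) => [j _|_]; last exact: measurable_fst.
rewrite (_ : (fun t => _) =
  (fun x : 'rV[R]_n => x ord0 j : measurableTypeR R) \o snd) //.
by apply: measurableT_comp => //; exact: measurable_coor.
Qed.

Section step.
Variables (n : nat) (mu : {sigma_finite_measure set 'rV[R]_n -> \bar R}).

Definition lebesgue_rV_step : set 'rV[R]_n.+1 -> \bar R :=
  pushforward (@lebesgue_measure R \x mu)%E (@cons_rV n).

Let mu_step : {measure set 'rV[R]_n.+1 -> \bar R} :=
  measure_function_pushforward__canonical__measure_function_Measure
    (@lebesgue_measure R \x mu)%E (@measurable_cons_rV n).

HB.instance Definition _ := isMeasure.Build _ _ _ lebesgue_rV_step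
  (measure0 mu_step) (measure_ge0 mu_step)
  (@measure_semi_sigma_additive _ _ _ mu_step).

Let sigma_finite_step : sigma_finite setT lebesgue_rV_step.
Proof.
have /sigma_finiteP[F [TF ndF Foo]] := sigma_finiteT (@lebesgue_measure R).
have /sigma_finiteP[G [TG ndG Goo]] := sigma_finiteT mu.
pose uncons (x : 'rV[R]_n.+1) : measurableTypeR R * 'rV[R]_n :=
  (x ord0 ord0, \row_i x ord0 (lift ord0 i)).
have unconsK (p : measurableTypeR R * 'rV[R]_n) : uncons (cons_rV p) = p.
  case: p => a x; rewrite /uncons mxE unlift_none; congr pair.
  by apply/rowP => i; rewrite !mxE liftK.
have muncons : measurable_fun setT uncons.
  apply/measurable_fun_pairP; split; first exact: measurable_coor.
  apply: measurable_fun_rV => i /=.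
  by under eq_fun do rewrite mxE; exact: measurable_coor.
exists (fun k => uncons @^-1` (F k `*` G k)).
  apply/esym; rewrite -subTset => x _.
  have [k _ Fk] : (\bigcup_k F k) (uncons x).1 by rewrite -TF.
  have [l _ Gl] : (\bigcup_k G k) (uncons x).2 by rewrite -TG.
  exists (maxn k l) => //; split.
    by move: (uncons x).1 Fk; exact/subsetPset/ndF/leq_maxl.
  by move: (uncons x).2 Gl; exact/subsetPset/ndG/leq_maxr.
move=> k; have [mF Fk] := Foo k; have [mG Gk] := Goo k; split.
  by rewrite -[X in measurable X]setTI; apply: muncons => //; exact: measurableX.
rewrite /lebesgue_rV_step /pushforward (_ : _ @^-1` _ = F k `*` G k).
  by rewrite product_measure1E// lte_mul_pinfty// ge0_fin_numE.
by apply/funext => p; rewrite /preimage /mkset unconsK.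
Qed.

HB.instance Definition _ :=
  @Measure_isSigmaFinite.Build _ _ _ lebesgue_rV_step sigma_finite_step.

End step.

(* lebesgue_rV n is the n-fold product of the one-dimensional Lebesgue measure,
   transported along (x_0, (x_1, ..., x_(n-1))) |-> (x_0, ..., x_(n-1)). *)
Fixpoint lebesgue_rV n : {sigma_finite_measure set 'rV[R]_n -> \bar R} :=
  match n with
  | 0 => \d_(0 : 'rV[R]_0)
  | n'.+1 => lebesgue_rV_step (lebesgue_rV n')
  end.

End lebesgue_rV.

Section lebesgue_rV_box.
Local Open Scope ereal_scope.
Context {R : realType}.

Lemma measurable_box n (A : 'I_n -> set (measurableTypeR R)) :
  (forall i, measurable (A i)) ->
  measurable [set x : 'rV[R]_n | forall i, A i (x ord0 i)].
Proof.
move=> mA; rewrite (_ : mkset _ =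
    \bigcap_(i in [set: 'I_n]) ((fun x : 'rV[R]_n => x ord0 i) @^-1` A i)).
  apply: fin_bigcap_measurable => // i _.
  by rewrite -[X in measurable X]setTI; exact: measurable_coor.
by apply/seteqP; split => [x Ax i _|x Ax i]; [exact: Ax|exact: (Ax i)].
Qed.

(* This determines lebesgue_rV among sigma-finite Borel measures on R^n. *)
Lemma lebesgue_rV_box n (A : 'I_n -> set (measurableTypeR R)) :
  (forall i, measurable (A i)) ->
  lebesgue_rV n [set x | forall i, A i (x ord0 i)] =
  \prod_(i < n) lebesgue_measure (A i).
Proof.
elim: n A => [|n IH] A mA.
  rewrite big_ord0 /= diracE mem_set //; by case.
rewrite big_ord_recl -IH // /= /lebesgue_rV_step /pushforward.
rewrite (_ : _ @^-1` _ = A ord0 `*`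
    [set x : 'rV[R]_n | forall i, A (lift ord0 i) (x ord0 i)]).
  by rewrite product_measure1E //; exact: (@measurable_box n (fun i => A (lift ord0 i))).
apply/seteqP; split => -[a x] /=.
  move=> Ax; split => [|i] /=.
    by have := Ax ord0; rewrite mxE unlift_none.
  by have := Ax (lift ord0 i); rewrite mxE liftK.
move=> [/= Aa Ax] i; rewrite mxE.
by case: (unliftP ord0 i) => [j ->|->].
Qed.

End lebesgue_rV_box.

Section fields.
Context {R : realType} {d : nat}.
Local Notation Rd := 'rV[R]_d.
Implicit Types (Omega : set Rd).

Definition partial (i : 'I_d) (f : Rd -> R) (x : Rd) : R :=
  'D_(delta_mx 0 i) f x.

Fixpoint Ck (k : nat) (f : Rd -> R) : Prop :=
  continuous f /\
  match k with
  | 0 => True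
  | k'.+1 => forall i : 'I_d,
      (forall x, derivable f x (delta_mx 0 i)) /\ Ck k' (partial i f)
  end.

Definition smooth (f : Rd -> R) : Prop := forall k, Ck k f.

Definition inner m n (A B : 'M[R]_(m, n)) : R := \sum_i \sum_j A i j * B i j.

(* Euclidean norm of a row vector, Frobenius norm of a matrix. *)
Definition fnorm m n (A : 'M[R]_(m, n)) : R := Num.sqrt (inner A A).

(* C_c^oo(Omega, X) for a subspace X of 'M[R]_(m, n); functions on Omega with
   compact support are identified with their extension by zero to R^d. *)
Definition test_field m n (X : set 'M[R]_(m, n)) Omega
    (phi : Rd -> 'M[R]_(m, n)) : Prop :=
  [/\ forall x, X (phi x),
      forall i j, smooth (fun x => phi x i j),
      compact (closure [set x | phi x != 0]) &
      closure [set x | phi x != 0] `<=` Omega].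

Definition sup_norm m n Omega (phi : Rd -> 'M[R]_(m, n)) : \bar R :=
  ereal_sup [set (fnorm (phi x))%:E | x in Omega].

(* A distribution is represented by its action on test fields; its values on
   other fields never matter.  Linearity and continuity are not recorded, since
   only the distributions built below from L^1 functions are used. *)
Definition distrib m n : Type := (Rd -> 'M[R]_(m, n)) -> R.

Definition radon_norm m n (X : set 'M[R]_(m, n)) Omega
    (T : distrib m n) : \bar R :=
  ereal_sup [set (T phi)%:E |
    phi in [set phi | test_field X Omega phi /\ (sup_norm Omega phi <= 1)%E]].

(* L^1 functions are Borel representatives, equal when they agree almost
   everywhere on Omega; every class has such a representative. *)
Definition L1 Omega (u : Rd -> R) : Prop :=
  (lebesgue_rV d).-integrable Omega (EFin \o u).

Definition L1_field m n Omega (w : Rd -> 'M[R]_(m, n)) : Prop :=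
  forall i j, L1 Omega (fun x => w x i j).

Definition dist_of m n Omega (w : Rd -> 'M[R]_(m, n)) : distrib m n :=
  fun phi => (\int[lebesgue_rV d]_(x in Omega) inner (w x) (phi x))%R.

Definition vec_div (phi : Rd -> Rd) (x : Rd) : R :=
  \sum_i partial i (fun y => phi y 0 i) x.

Definition mat_div (phi : Rd -> 'M[R]_d) (x : Rd) : Rd :=
  \row_i \sum_j partial j (fun y => phi y i j) x.

Definition weak_grad Omega (u : Rd -> R) : distrib 1 d :=
  fun phi => (\int[lebesgue_rV d]_(x in Omega) (u x * - vec_div phi x))%R.

Definition sym_grad Omega (w : Rd -> Rd) : distrib d d :=
  fun phi => dist_of Omega w (fun x => - mat_div phi x).

Definition vec_space : set Rd := setT.

Definition sym_space : set 'M[R]_d := [set A | A^T = A].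

Definition BV Omega (u : Rd -> R) : Prop :=
  L1 Omega u /\ (radon_norm vec_space Omega (weak_grad Omega u) < +oo)%E.

Definition BD Omega (w : Rd -> Rd) : Prop :=
  L1_field Omega w /\ (radon_norm sym_space Omega (sym_grad Omega w) < +oo)%E.

Definition TGV_osci Omega (alpha beta : R) (c : 'M[R]_d) (u : Rd -> R) : \bar R :=
  if `[< BV Omega u >] then
    ereal_inf [set (alpha%:E *
        radon_norm vec_space Omega (weak_grad Omega u - dist_of Omega w)%R +
      beta%:E *
        radon_norm sym_space Omega
          (sym_grad Omega w + dist_of Omega (fun x => u x *: c))%R)%E
      | w in BD Omega]
  else +oo%E.

Definition tensor_sq (omega : Rd) : 'M[R]_d :=
  \matrix_(i, j) (omega 0 i * omega 0 j).

Definition L1_dist Omega (u v : Rd -> R) : \bar R :=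
  (\int[lebesgue_rV d]_(x in Omega) `|u x - v x|%:E)%E.

Definition L1_proper Omega (F : (Rd -> R) -> \bar R) : Prop :=
  (forall u, L1 Omega u -> (-oo < F u)%E) /\
  (exists u, L1 Omega u /\ (F u < +oo)%E).

(* Lower semi-continuity for the (pseudo)metric topology of L^1. *)
Definition L1_lsc Omega (F : (Rd -> R) -> \bar R) : Prop :=
  forall u (a : R), L1 Omega u -> (a%:E < F u)%E ->
  exists2 e : R, 0 < e &
    forall v, L1 Omega v -> (L1_dist Omega u v < e%:E)%E -> (a%:E < F v)%E.

Definition ae_eq_on Omega (u v : Rd -> R) : Prop :=
  {ae lebesgue_rV d, forall x, Omega x -> u x = v x}.

Definition domain Omega : Prop := [/\ Omega !=set0, open Omega & connected Omega].

End fields.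

Arguments vec_space {R d}.
Arguments sym_space {R d}.

(* Near each boundary point, in coordinates obtained by an orthogonal change of
   basis, Omega is the strict supergraph of a Lipschitz function of the first
   n coordinates (a constant when n = 0). *)
Definition lipschitz_boundary (R : realType) (n : nat) (Omega : set 'rV[R]_n.+1)
    : Prop :=
  forall x, (closure Omega `\` interior Omega) x ->
  exists (Q : 'M[R]_n.+1) (gamma : 'rV[R]_n -> R) (U : set 'rV[R]_n.+1),
    [/\ Q *m Q^T = 1%:M,
        exists L : R, forall y z, `|gamma y - gamma z| <= L * fnorm (y - z),
        nbhs x U &
        forall y, U y ->
          (Omega y <-> gamma (col' ord_max (y *m Q)) < (y *m Q) 0 ord_max)].

(* Main.v *)
(* Lower semi-continuity.  Let u_k -> u in L^1 with near-minimizers w_k of bounded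
   energy.  On a domain whose points y satisfy y + s eta in Omega for 0 <= s <= 1 and
   eta in a fixed box, averaging test functions psi along the segments y - s eta,
   0 <= s <= t, with a kernel k such that the integral of k(eta) eta_a is delta_(a i)
   produces a symmetric field Phi of size O(t) with div Phi = psi e_i - P, where P and
   div P are bounded by C_t |psi|_1.  Testing E w_k + c u_k with Phi and grad u_k - w_k
   with P gives |int w_k psi| <= e + C_e |psi|_1 for |psi| <= 1, uniformly in k: by the
   local cone property of Lipschitz domains the w_k are equi-integrable.  Their integrals
   converge along an ultrafilter to a charge which is absolutely continuous, and its
   Radon-Nikodym density w is a weak limit, for which the energy passes to the limit.

   Kernel.  TGV u = 0 forces d_i d_j u = - omega_i omega_j u weakly.  For test functions
   psi and theta the function F(h) = int u(y) psi(y + h) dy then solves an oscillator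
   equation on lines, so that F(h) + F(-h) = 2 F(0) cos(omega . h); integrating this
   against an even bump theta shows that u is, up to a positive factor, locally equal to
   its mollification, which is an oscillation.  Unique continuation on the connected
   set Omega glues the local representations. *)

From HB Require Import structures.
Require Import Defs.
From mathcomp Require Import finmap.
From mathcomp Require Import all_boot all_order all_algebra.
From mathcomp Require Import all_classical all_reals all_analysis.
From mathcomp Require Import measurable_realfun ring lra.

Set Implicit Arguments.
Unset Strict Implicit.
Unset Printing Implicit Defensive.

Import Order.TTheory GRing.Theory Num.Theory.
Import numFieldTopology.Exports numFieldNormedType.Exports.

Local Open Scope classical_set_scope.
Local Open Scope ring_scope.

(** The energy bounds [grad u - w] and [E w + c u] but gives no direct norm bound on w, and the
    obstacle is to extract a limit of near-minimizers. Neither a Korn or Poincare inequality nor a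
    compact embedding is invoked: the energy is a supremum of pairings with test fields, so a weak
    L^1 limit suffices, and equi-integrability is what such a limit requires. E w sees w only
    through divergences of symmetric fields, so psi e_i must be such a divergence up to an error P
    that the gradient part can absorb. Segments of length t make the divergence term cost O(t),
    hence at most e; the error term costs a negative power of t, but multiplied by the L^1 norm of
    psi, which becomes the measure of a set once psi approximates an indicator. Second moments eta_a
    eta_b k(eta) as weights make Phi symmetric. For the kernel, test functions are translated within
    Omega, so the weak equation of u becomes a classical one for F; the positive factor is the
    integral of theta(h) cos(omega . h), with theta supported where |omega . h| < 1. *)

(** * Change of variables x -> c + t x for Lebesgue measure on R^n *)

Section lebesgue_affine.
Context {R : realType}.
Local Open Scope ereal_scope.

Lemma measurable_affine (c t : R) :
  measurable_fun setT ((fun x => c + t * x)%R : measurableTypeR R -> measurableTypeR R).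
Proof. by apply: measurable_funD => //; exact: measurable_funM. Qed.

(** Lebesgue measure is determined by its values on half-open intervals, so it suffices to compare
    it there with the pushforward scaled by |t|. *)
Lemma lebesgue_measure_affine (c t : R) (A : set (measurableTypeR R)) : t != 0%R ->
  measurable A ->
  lebesgue_measure A = `|t|%:E *
    lebesgue_measure ((fun x => c + t * x)%R @^-1` A).
Proof.
move=> t0 mA.
pose nu := mscale (NngNum (normr_ge0 t))
  (measure_function_pushforward__canonical__measure_function_Measure
    (@lebesgue_measure R) (measurable_affine c t)).
apply: (@lebesgue_measure_unique R nu) => // _ [[a b] _ <-] /=.
rewrite /nu /mscale /= /pushforward lebesgue_measure_itv /=.
have [tgt|tlt|/eqP] := ltgtP 0%R t; last by rewrite eq_sym (negbTE t0).
  rewrite (_ : _ @^-1` _ = `] (t^-1 * (a - c))%R, (t^-1 * (b - c))%R]%classic); last first.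
    apply/seteqP; split => x /=; rewrite !in_itv /= ltr_pdivrMl// ler_pdivlMl//; lra.
  rewrite lebesgue_measure_itv /= !lte_fin ltr_pM2l ?invr_gt0// ltrD2r.
  case: ifP => _; last by rewrite mule0.
  rewrite -!EFinB -EFinM; congr EFin.
  by rewrite gtr0_norm // -mulrBr mulVKf//; lra.
(* For t < 0 the preimage is half-open on the other side; its length is the same. *)
rewrite (_ : _ @^-1` _ = `[ (t^-1 * (b - c))%R, (t^-1 * (a - c))%R[%classic); last first.
  apply/seteqP; split => x /=; rewrite !in_itv /= ltr_ndivlMl// ler_ndivrMl//; lra.
rewrite lebesgue_measure_itv /= !lte_fin ltr_nM2l ?invr_lt0// ltrD2r.
case: ifP => _; last by rewrite mule0.
rewrite -!EFinB -EFinM; congr EFin.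
by rewrite ltr0_norm // -mulrBr mulNr mulVKf//; lra.
Qed.

Lemma ge0_integral_affine (c t : R) (f : measurableTypeR R -> \bar R) : t != 0%R ->
  measurable_fun setT f -> (forall x, 0 <= f x) ->
  \int[lebesgue_measure]_x f x =
    `|t|%:E * \int[lebesgue_measure]_x f (c + t * x)%R.
Proof.
move=> t0 mf f0.
pose nu := mscale (NngNum (normr_ge0 t))
  (measure_function_pushforward__canonical__measure_function_Measure
    (@lebesgue_measure R) (measurable_affine c t)).
transitivity (\int[nu]_x f x).
  by apply: eq_measure_integral => A mA _; exact: lebesgue_measure_affine.
rewrite ge0_integral_mscale //= ; congr (_ * _).
by rewrite ge0_integral_pushforward //=; exact: measurable_affine.
Qed.

Lemma measurable_cons_rV n : measurable_fun setT (@cons_rV R n).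
Proof.
apply: measurable_fun_rV => i; under eq_fun do rewrite mxE.
case: (unliftP ord0 i) => [j _|_]; last exact: measurable_fst.
rewrite (_ : (fun t => _) =
  (fun x : 'rV[R]_n => x ord0 j : measurableTypeR R) \o snd) //.
by apply: measurableT_comp => //; exact: measurable_coor.
Qed.

Lemma ge0_integral_rVS n (f : 'rV[R]_n.+1 -> \bar R) :
  measurable_fun setT f -> (forall x, 0 <= f x) ->
  \int[lebesgue_rV n.+1]_x f x =
  \int[lebesgue_measure]_a \int[lebesgue_rV n]_x f (cons_rV (a, x)).
Proof.
move=> mf f0.
rewrite (@ge0_integral_pushforward _ _ _ _ _ (@cons_rV R n) (@measurable_cons_rV n)
  (@lebesgue_measure R \x lebesgue_rV n) setT f) //.
rewrite preimage_setT fubini_tonelli1 //=.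
by apply: measurableT_comp => //; exact: measurable_cons_rV.
Qed.

Lemma measurable_affine_rV n (c : 'rV[R]_n) (t : R) :
  measurable_fun setT (fun x : 'rV[R]_n => c + t *: x)%R.
Proof.
apply: measurable_fun_rV => i; under eq_fun do rewrite !mxE.
by apply: measurableT_comp (measurable_affine _ _) _; exact: measurable_coor.
Qed.

(** Induction on the dimension: Tonelli splits off the first coordinate, which contributes one
    factor |t|. Signed integrands are treated later through their positive and negative parts. *)
Lemma ge0_integral_affine_rV n (c : 'rV[R]_n) (t : R) (f : 'rV[R]_n -> \bar R) :
  t != 0%R -> measurable_fun setT f -> (forall x, 0 <= f x) ->
  \int[lebesgue_rV n]_x f x =
    (`|t| ^+ n)%:E * \int[lebesgue_rV n]_x f (c + t *: x)%R.
Proof.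
move=> t0; elim: n c f => [|n IH] c f mf f0.
  rewrite expr0 mul1e; apply: eq_integral => x _; congr f.
  by apply/rowP => -[].
rewrite !ge0_integral_rVS //; last first.
  by apply: measurableT_comp => //; exact: measurable_affine_rV.
have mF : measurable_fun setT (f \o @cons_rV R n).
  by apply: measurableT_comp => //; exact: measurable_cons_rV.
have mG := measurable_fun_fubini_tonelli_F (m2 := lebesgue_rV n) _ mF
  (fun _ => f0 _).
rewrite (@ge0_integral_affine (c ord0 ord0) t _ t0 mG); last first.
  by move=> x; apply: integral_ge0 => y _; exact: f0.
have mH : measurable_fun setT (f \o ((fun x => c + t *: x)%R \o @cons_rV R n)).
  apply: measurableT_comp => //; apply: measurableT_comp.
    exact: measurable_affine_rV.
  exact: measurable_cons_rV.
have {}mH := measurable_fun_fubini_tonelli_F (m2 := lebesgue_rV n) _ mH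
  (fun _ => f0 _).
rewrite exprS EFinM -muleA; congr (_ * _).
rewrite -(@ge0_integralZl _ _ _ _ setT measurableT _ mH); last 2 first.
- by move=> x _; apply: integral_ge0 => y _; exact: f0.
- by rewrite lee_fin exprn_ge0.
apply: eq_integral => a _.
rewrite /fubini_F (IH (\row_i c ord0 (lift ord0 i))%R
  (fun y => (f \o @cons_rV R n) (c ord0 ord0 + t * a, y)%R)); last 2 first.
- by apply: (measurableT_comp mF); exact: pair1_measurable.
- by move=> y; exact: f0.
congr (_ * _); apply: eq_integral => x _; congr f.
apply/rowP => i; rewrite !mxE.
by case: unliftP => [j ->|->]; rewrite ?liftK ?unlift_none ?mxE.
Qed.

End lebesgue_affine.

(** * Boxes in R^n: topology, Borel sets and finite measure *)

Section boxes.
Context {R : realType} {n : nat}.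
Implicit Types (c x y : 'rV[R]_n) (A K : set 'rV[R]_n).

(** Max-norm balls, written coordinatewise so that they are products of intervals: their
    measurability and measure then come from [measurable_box] and [lebesgue_rV_box]. *)
Definition obox c (r : R) : set 'rV[R]_n := [set x | forall i, `|x 0 i - c 0 i| < r].
Definition cbox c (r : R) : set 'rV[R]_n := [set x | forall i, `|x 0 i - c 0 i| <= r].

Lemma subset_obox_cbox c r : obox c r `<=` cbox c r.
Proof. by move=> x xr i; exact/ltW. Qed.

Lemma nbhs_cboxP x A : nbhs x A <-> exists2 e : R, 0 < e & cbox x e `<=` A.
Proof.
split.
- move=> /nbhs_ballP[e /= e0 eA]; exists (e / 2); first by rewrite divr_gt0.
  move=> y ye; apply: eA; split => // i j.
  rewrite /ball /= distrC; have := ye j; rewrite [i]ord1 => /le_lt_trans; apply.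
  by rewrite ltr_pdivrMr// ltr_pMr// ltr1n.
- move=> [e e0 eA]; apply/nbhs_ballP; exists e => //= y [_ xy]; apply: eA => i.
  by have := xy 0 i; rewrite /ball /= distrC => /ltW.
Qed.

Lemma nbhs_obox x e : 0 < e -> nbhs x (obox x e).
Proof.
move=> e0; apply/nbhs_cboxP; exists (e / 2); first by rewrite divr_gt0.
by move=> y ye i; rewrite (le_lt_trans (ye i))// ltr_pdivrMr// ltr_pMr// ltr1n.
Qed.

Lemma oboxE c r : obox c r = [set x | forall i, (`]c 0 i - r, c 0 i + r[%classic : set R) (x 0 i)].
Proof.
by apply/seteqP; split => x /= xr i; have := xr i; rewrite /= in_itv /= ltr_distl.
Qed.

Lemma cboxE c r : cbox c r = [set x | forall i, (`[c 0 i - r, c 0 i + r]%classic : set R) (x 0 i)].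
Proof.
by apply/seteqP; split => x /= xr i; have := xr i; rewrite /= in_itv /= ler_distl.
Qed.

Lemma obox_open c r : open (obox c r).
Proof.
rewrite openE => x xr; rewrite /interior; apply/nbhs_cboxP.
have [e e0 xe] : exists2 e : R, 0 < e & forall i, `|x 0 i - c 0 i| + e < r.
  pose f i := `|x 0 i - c 0 i|; have fr i : f i < r by exact: xr.
  exists (\big[Num.min/1]_i ((r - f i) / 2)).
    apply/bigmin_gtP; split => // i _.
    by rewrite divr_gt0// subr_gt0.
  move=> i; have : \big[Num.min/1]_j ((r - f j) / 2) <= (r - f i) / 2.
    exact: bigmin_le.
  by have := fr i; rewrite -/(f i); lra.
exists e => // y ye i.
rewrite -(subrKA (x 0 i)) (le_lt_trans (ler_normD _ _))//.
by rewrite (le_lt_trans _ (xe i))// addrC lerD2l.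
Qed.

Lemma cbox_compact c r : compact (cbox c r).
Proof.
rewrite cboxE; apply: (@rV_compact _ _ (fun i => `[c 0 i - r, c 0 i + r]%classic)).
by move=> i; exact: segment_compact.
Qed.

Lemma compact_rV_closed K : compact K -> closed K.
Proof. by apply: compact_closed; exact: norm_hausdorff. Qed.

Lemma cbox_closed c r : closed (cbox c r).
Proof. by apply: compact_rV_closed; exact: cbox_compact. Qed.

(** Boxes with rational centre and radius 1/(m+1). The closed boxes also lie in A, so that bumps on
    them have compact support in A. *)
Lemma open_bigcup_obox A : open A -> A !=set0 ->
  exists (c : nat -> 'rV[R]_n) (r : nat -> R),
    [/\ forall k, 0 < r k, forall k, cbox (c k) (r k) `<=` A &
        A = \bigcup_k obox (c k) (r k)].
Proof.
move=> oA [x0 Ax0].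
have [e0 e0_gt0 e0A] : exists2 e : R, 0 < e & cbox x0 e `<=` A.
  by apply/nbhs_cboxP; exact: open_nbhs_nbhs.
pose P (p : 'rV[rat]_n * nat) := cbox (map_mx ratr p.1) (p.2.+1%:R^-1) `<=` A.
(* Codes of no admissible box are sent to one fixed box inside A, whence the assumption that A has a
   point. *)
pose cr k : 'rV[R]_n * R := if unpickle k is Some p then
  if `[< P p >] then (map_mx ratr p.1, p.2.+1%:R^-1) else (x0, e0) else (x0, e0).
exists (fst \o cr), (snd \o cr); split => /=.
- by move=> k; rewrite /cr; case: unpickle => [p|//]; case: ifP => _ //=; rewrite invr_gt0.
- by move=> k; rewrite /cr; case: unpickle => [p|//]; case: ifP => // /asboolP.
apply/seteqP; split => [x Ax|x [k _] /= xk]; last first.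
  have := subset_obox_cbox xk.
  by rewrite /cr; case: unpickle; [move=> p; case: ifP; [move/asboolP; exact|]|];
    move=> *; exact: e0A.
have [e e_gt0 eA] : exists2 e : R, 0 < e & cbox x e `<=` A.
  by apply/nbhs_cboxP; exact: open_nbhs_nbhs.
(* With d = 1/(m+1) < e/2, a rational point within d of x has its closed d-box inside the e-box
   around x. *)
have [m me] : exists m : nat, m.+1%:R^-1 < e / 2 :> R.
  have /ltr_add_invr[m] : 0 < e / 2 by rewrite divr_gt0.
  by rewrite add0r => ?; exists m.
pose d : R := m.+1%:R^-1.
have d0 : 0 < d by rewrite invr_gt0.
have /choice[q xq] : forall i, exists q : rat, `|x 0 i - ratr q| < d.
  move=> i; have : x 0 i - d < x 0 i + d by rewrite ltrBlDr -addrA ltrDl addr_gt0.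
  move=> /rat_in_itvoo[q]; rewrite in_itv /= => /andP[h1 h2].
  by exists q; rewrite distrC ltr_distl h1 h2.
exists (pickle (\row_i q i, m)) => //=.
rewrite /cr pickleK; case: ifPn => [_|/asboolP[]] /=.
  by move=> i; rewrite !mxE xq.
move=> y ym; apply: eA => i; have := ym i; rewrite /= !mxE => yq.
rewrite -(subrKA (ratr (q i))) (le_trans (ler_normD _ _))//.
have := xq i; rewrite distrC => ?; rewrite /d in me d0 *.
by have := me; rewrite -/d in me yq *; lra.
Qed.

Local Notation mR := (measurableTypeR R).

Lemma obox_measurable c r : measurable (obox c r).
Proof.
by rewrite oboxE; apply: (measurable_box (A := fun i => `]c 0 i - r, c 0 i + r[%classic)) => i; exact: measurable_itv.
Qed.

(** The measurable sets are those of the product sigma-algebra, so an open set has to be exhibited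
    as a countable union of boxes. *)
Lemma open_measurable_rV A : open A -> measurable A.
Proof.
move=> oA; have [->|/set0P] := eqVneq A set0; first exact: measurable0.
move=> /(open_bigcup_obox oA)[c [r [_ _ ->]]].
by apply: bigcupT_measurable => k; exact: obox_measurable.
Qed.

Lemma closed_measurable_rV A : closed A -> measurable A.
Proof.
move=> cA; rewrite -[A]setCK; apply: measurableC; apply: open_measurable_rV.
exact: closed_openC.
Qed.

Lemma continuous_measurable_rV (f : 'rV[R]_n -> R) :
  continuous f -> measurable_fun setT (f : 'rV[R]_n -> mR).
Proof.
move=> cf; apply: (measurability _ (RGenOpens.measurableE R)).
move=> _ [_ [a [b ->] <-]]; rewrite setTI.
apply: open_measurable_rV; apply: open_comp => // x _; exact: cf.
Qed.

Lemma bounded_subset_cbox A : bounded_set A -> exists r, A `<=` cbox 0 r.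
Proof.
move=> [M [_ MA]]; exists (M + 1) => x Ax i.
have := MA (M + 1); rewrite ltrDl => /(_ ltr01 x Ax); apply: le_trans.
rewrite mxE subr0 [leRHS]/Num.norm /= mx_normrE.
exact: (le_bigmax _ (fun ij : 'I_1 * 'I_n => `|x ij.1 ij.2|) (0, i)).
Qed.

Lemma lebesgue_cbox_fin c r : (lebesgue_rV n (cbox c r) < +oo)%E.
Proof.
rewrite cboxE (lebesgue_rV_box (A := fun i => `[c 0 i - r, c 0 i + r]%classic)); last first.
  by move=> i; exact: measurable_itv.
rewrite ltey_eq; apply/orP; left.
elim/big_ind : _ => // [a b|i _]; first exact: fin_numM.
by rewrite lebesgue_measure_itv /=; case: ifP.
Qed.

Lemma lebesgue_bounded_fin A : bounded_set A -> measurable A ->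
  (lebesgue_rV n A < +oo)%E.
Proof.
move=> /bounded_subset_cbox[r Ar] mA; apply: le_lt_trans (lebesgue_cbox_fin 0 r).
apply: le_measure => //; apply/mem_set => //.
by apply: closed_measurable_rV; exact: cbox_closed.
Qed.

Lemma compact_rV_bounded K : compact K -> bounded_set K.
Proof. exact: compact_bounded. Qed.

End boxes.

(** * Mean value theorem and derivatives along lines *)

Section line_derivative.
Context {R : realType}.

(** Covers both orders of the end points; the intermediate point is located by its distance to [a],
    which later keeps it in a small box. *)
Lemma MVT_dist (g g' : R -> R) (a b : R) :
  (forall x, is_derive x (1 : R) g (g' x)) ->
  exists c, `|c - a| <= `|b - a| /\ g b - g a = g' c * (b - a).
Proof.
move=> dg.
have cg : continuous g by move=> x; apply: differentiable_continuous; apply/derivable1_diffP.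
have [ab|ba] := leP a b.
  have [c] := @MVT_segment R g g' a b ab (fun x _ => dg x) (continuous_subspaceT cg).
  rewrite in_itv /= => /andP[ac cb] ->; exists c; split => //.
  by rewrite !ger0_norm ?subr_ge0// lerD2r.
have [c] := @MVT_segment R g g' b a (ltW ba) (fun x _ => dg x) (continuous_subspaceT cg).
rewrite in_itv /= => /andP[ac cb] e; exists c; split.
  rewrite (ler0_norm (x := c - a)) ?subr_le0// (ler0_norm (x := b - a)) ?subr_le0 ?(ltW ba)//.
  by rewrite !opprB lerD2l lerN2.
by rewrite -opprB e; ring.
Qed.

(** The two difference quotients are the same function of the increment. *)
Lemma is_derive_lineP (V : normedModType R) (f : V -> R) (p v : V) (t : R) (l : R) :
  is_derive (p + t *: v) v f l <-> is_derive t (1 : R) (fun s => f (p + s *: v)) l.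
Proof.
have E : (fun h : R => h^-1 *: ((f \o shift (p + t *: v)) (h *: v) - f (p + t *: v)))
   = (fun h => h^-1 *: (((fun s => f (p + s *: v)) \o shift t) (h *: 1) - f (p + t *: v))).
  apply/funext => h /=; congr (_ *: (f _ - _)).
  by rewrite [_%:A]mulr1 scalerDl addrCA addrA.
split => -[d e]; split.
- by rewrite /derivable -E.
- by rewrite /derive -E.
- by rewrite /derivable E.
- by rewrite /derive E.
Qed.

End line_derivative.

(** * Calculus of C^k and smooth functions on R^d *)

Section Ck_theory.
Context {R : realType} {d : nat}.
Local Notation Rd := 'rV[R]_d.
Implicit Types (f g : Rd -> R).

Lemma Ck_continuous k f : Ck k f -> continuous f.
Proof. by case: k => [|k] []. Qed.

Lemma CkS k f : Ck k.+1 f -> Ck k f.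
Proof.
elim: k f => [|k IH] f; first by case.
move=> [cf df]; split => // i; have [df1 df2] := df i; split => //.
exact: IH.
Qed.

Lemma smooth_continuous f : smooth f -> continuous f.
Proof. by move=> /(_ 0)[]. Qed.

Lemma smooth_derivable f i x : smooth f -> derivable f x (delta_mx 0 i).
Proof. by move=> /(_ 1) [_ /(_ i)[]]. Qed.

Lemma smooth_partial i f : smooth f -> smooth (partial i f).
Proof. by move=> sf k; have [_ /(_ i)[]] := sf k.+1. Qed.

Lemma is_derive_partial f i x : Ck 1 f -> is_derive x (delta_mx 0 i) f (partial i f x).
Proof. by move=> [_ /(_ i)[df _]]; split. Qed.

Lemma partial_cst i (c : R) : partial i (cst c : Rd -> R) = cst 0.
Proof. by apply/funext => x; rewrite /partial derive_cst. Qed.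

Lemma smooth_cst (c : R) : smooth (cst c : Rd -> R).
Proof.
move=> k; elim: k c => [|k IH] c /=.
  by split => //; exact: cst_continuous.
split=> [|i]; first exact: cst_continuous.
by rewrite partial_cst; split => // x; exact: derivable_cst.
Qed.

Lemma partialD i f g : (forall x, derivable f x (delta_mx 0 i)) ->
  (forall x, derivable g x (delta_mx 0 i)) ->
  partial i (fun x => f x + g x) = (fun x => partial i f x + partial i g x).
Proof. by move=> df dg; apply/funext => x; rewrite /partial deriveD. Qed.

Lemma partialM i f g : (forall x, derivable f x (delta_mx 0 i)) ->
  (forall x, derivable g x (delta_mx 0 i)) ->
  partial i (fun x => f x * g x) =
  (fun x => f x * partial i g x + g x * partial i f x).
Proof. by move=> df dg; apply/funext => x; rewrite /partial deriveM. Qed.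

Lemma CkD k f g : Ck k f -> Ck k g -> Ck k (fun x => f x + g x).
Proof.
elim: k f g => [|k IH] f g [cf df] [cg dg]; split => //.
- by move=> x; exact: (cvgD (cf x) (cg x)).
- by move=> x; exact: (cvgD (cf x) (cg x)).
move=> i; have [df1 df2] := df i; have [dg1 dg2] := dg i; split.
  by move=> x; exact: derivableD.
by rewrite partialD//; exact: IH.
Qed.

Lemma CkM k f g : Ck k f -> Ck k g -> Ck k (fun x => f x * g x).
Proof.
elim: k f g => [|k IH] f g Cf Cg; have [cf df] := Cf; have [cg dg] := Cg; split => //.
- by move=> x; exact: (cvgM (cf x) (cg x)).
- by move=> x; exact: (cvgM (cf x) (cg x)).
move=> i; have [df1 df2] := df i; have [dg1 dg2] := dg i; split.
  by move=> x; exact: derivableM.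
by rewrite partialM//; apply: CkD; apply: IH => //; exact: CkS.
Qed.

Lemma smoothD f g : smooth f -> smooth g -> smooth (fun x => f x + g x).
Proof. by move=> sf sg k; exact: CkD. Qed.

Lemma smoothM f g : smooth f -> smooth g -> smooth (fun x => f x * g x).
Proof. by move=> sf sg k; exact: CkM. Qed.

Lemma smoothZ c f : smooth f -> smooth (fun x => c * f x).
Proof. by move=> sf; apply: smoothM => //; exact: smooth_cst. Qed.

Lemma smoothN f : smooth f -> smooth (fun x => - f x).
Proof.
move=> /(smoothZ (-1)); rewrite (_ : (fun x => - f x) = (fun x => -1 * f x))//.
by apply/funext => x; rewrite mulN1r.
Qed.

Lemma smoothB f g : smooth f -> smooth g -> smooth (fun x => f x - g x).
Proof. by move=> sf sg; apply: smoothD => //; exact: smoothN. Qed.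

Lemma smooth_prod I (s : seq I) (F : I -> Rd -> R) : (forall i, smooth (F i)) ->
  smooth (fun x => \prod_(i <- s) F i x).
Proof.
move=> sF; elim: s => [|a s IH].
  rewrite (_ : (fun x => _) = cst 1); first exact: smooth_cst.
  by apply/funext => x; rewrite big_nil.
rewrite (_ : (fun x => _) = (fun x => F a x * \prod_(i <- s) F i x)).
  exact: smoothM.
by apply/funext => x; rewrite big_cons.
Qed.

Lemma smooth_sum I (s : seq I) (F : I -> Rd -> R) : (forall i, smooth (F i)) ->
  smooth (fun x => \sum_(i <- s) F i x).
Proof.
move=> sF; elim: s => [|a s IH].
  rewrite (_ : (fun x => _) = cst 0); first exact: smooth_cst.
  by apply/funext => x; rewrite big_nil.
rewrite (_ : (fun x => _) = (fun x => F a x + \sum_(i <- s) F i x)).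
  exact: smoothD.
by apply/funext => x; rewrite big_cons.
Qed.

Lemma is_derive_shift_rV f x c v l : is_derive (x + c) v f l <->
  is_derive x v (fun y => f (y + c)) l.
Proof.
have E : (fun h : R => h^-1 *: ((f \o shift (x + c)) (h *: v) - f (x + c)))
   = (fun h => h^-1 *: (((fun y => f (y + c)) \o shift x) (h *: v) - f (x + c))).
  by apply/funext => h /=; rewrite addrA.
split => -[? ?]; split.
- by rewrite /derivable -E.
- by rewrite /derive -E.
- by rewrite /derivable E.
- by rewrite /derive E.
Qed.

Lemma partial_shift i f c : partial i (fun y => f (y + c)) = (fun y => partial i f (y + c)).
Proof.
apply/funext => x; rewrite /partial /derive.
rewrite (_ : (fun h : R => _) = (fun h : R => h^-1 *: ((f \o shift (x + c))
  (h *: delta_mx 0 i) - f (x + c))))//.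
by apply/funext => h /=; rewrite addrA.
Qed.

Lemma shiftr_continuous (c : Rd) : continuous (fun y : Rd => y + c).
Proof. by move=> x; exact: (cvgD (@cvg_id _ (nbhs x)) (cvg_cst c)). Qed.

Lemma smooth_shift f (c : Rd) : smooth f -> smooth (fun y => f (y + c)).
Proof.
move=> sf k; elim: k f sf => [|k IH] f sf.
  split => // x; apply: continuous_comp; last exact: smooth_continuous.
  exact: shiftr_continuous.
split=> [x|i].
  apply: continuous_comp; last exact: smooth_continuous.
  exact: shiftr_continuous.
rewrite partial_shift; split; last exact/IH/smooth_partial.
move=> x; have [] // : is_derive x (delta_mx 0 i) (fun y => f (y + c)) (partial i f (x + c)).
by apply/is_derive_shift_rV; split => //; exact: smooth_derivable.
Qed.

(** [Ck] only speaks of coordinate directions. The increment along v is telescoped one coordinate at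
    a time; each term is a mean value of one partial derivative near x, and continuity of that
    derivative gives its limit. *)
Lemma Ck1_derive_dir f x v : Ck 1 f ->
  is_derive x v f (\sum_i v 0 i * partial i f x).
Proof.
move=> [cf df].
pose vs (s : seq 'I_d) : Rd := \sum_(i <- s) v 0 i *: delta_mx 0 i.
suff H (s : seq 'I_d) : (fun h => h^-1 * (f (h *: vs s + x) - f x)) @ 0^' -->
    \sum_(i <- s) v 0 i * partial i f x.
  have vE : vs (index_enum 'I_d) = v by rewrite /vs -row_sum_delta.
  have Hv := H (index_enum 'I_d); rewrite vE in Hv.
  by split; [apply/cvg_ex; eexists; exact: Hv|apply: cvg_lim => //; exact: Hv].
elim: s => [|i s IH].
  rewrite big_nil /vs big_nil; under eq_fun do rewrite scaler0 add0r subrr mulr0.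
  exact: cvg_cst.
rewrite big_cons.
rewrite (_ : (fun h => _) = (fun h => h^-1 * (f (h *: vs (i :: s) + x) - f (h *: vs s + x)) +
   h^-1 * (f (h *: vs s + x) - f x))); last first.
  by apply/funext => h; rewrite -mulrDr subrKA.
apply: cvgD; last exact: IH.
have [df1 df2] := df i.
have cp : {for x, continuous (partial i f)} := df2.1 x.
apply/cvgrPdist_le => e e0.
have [r r0 xr] : exists2 r : R, 0 < r &
    cbox x r `<=` [set y | `|v 0 i| * `|partial i f x - partial i f y| <= e].
  apply/nbhs_cboxP.
  have : \forall y \near x, `|partial i f x - partial i f y| <= e / (`|v 0 i| + 1).
    by move/cvgrPdist_le : cp; apply; rewrite divr_gt0// ltr_wpDl.
  apply: filterS => y /=.
  rewrite ler_pdivlMr ?ltr_wpDl//= mulrC; apply: le_trans.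
  by rewrite ler_wpM2r// lerDl.
(* For |h| <= r / M the intermediate point of the mean value theorem stays in [cbox x r]; the
   summand 1 keeps M positive. *)
pose M : R := `|v 0 i| + \sum_j `|vs s 0 j| + 1.
have M0 : 0 < M by rewrite /M ltr_wpDl// addr_ge0// sumr_ge0.
near=> h.
have h0 : h != 0 by near: h; exact: nbhs_dnbhs_neq.
have hM : `|h| <= r / M.
  near: h; apply: dnbhs0_le; by rewrite divr_gt0.
pose p := h *: vs s + x.
have [t0|t [th gE]] := @MVT_dist R (fun t => f (p + t *: delta_mx 0 i))
    (fun t => partial i f (p + t *: delta_mx 0 i)) 0 (h * v 0 i).
  apply: (is_derive_lineP f p (delta_mx 0 i) t0 _).1.
  exact: (DeriveDef (df1 _) erefl).
have -> : h *: vs (i :: s) + x = p + (h * v 0 i) *: delta_mx 0 i.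
  by rewrite /p /vs big_cons scalerDr scalerA -addrA addrC.
rewrite scale0r addr0 subr0 in gE; rewrite -/p gE.
rewrite (_ : h^-1 * _ = v 0 i * partial i f (p + t *: delta_mx 0 i)); last first.
  by field.
rewrite -mulrBr normrM; apply: xr => j.
rewrite /p !mxE eqxx /= !subr0 in th *.
have -> : h * vs s 0 j + x 0 j + t * (j == i)%:R - x 0 j =
  h * vs s 0 j + t * (j == i)%:R by ring.
have tj : `|t * (j == i)%:R| <= `|h| * `|v 0 i|.
  by rewrite -[leRHS]normrM (le_trans _ th)//; case: eqP => _; rewrite ?mulr1 ?mulr0 ?normr0.
have vj : `|vs s 0 j| <= \sum_j `|vs s 0 j|.
  by rewrite (bigD1 j)//= lerDl sumr_ge0.
rewrite (le_trans (ler_normD _ _))// normrM.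
rewrite (le_trans (lerD (ler_wpM2l (normr_ge0 h) vj) tj))// -mulrDr.
move: hM; rewrite ler_pdivlMr//; apply: le_trans.
by rewrite ler_wpM2l// /M addrC lerDl.
Unshelve. all: by end_near. Qed.

End Ck_theory.

(** * Line integrals and symmetry of second derivatives *)

Section C1_lines.
Context {R : realType} {d : nat}.
Local Notation Rd := 'rV[R]_d.
Implicit Types (f g : Rd -> R).

Lemma is_derive_along f (x v : Rd) (t : R) : Ck 1 f ->
  is_derive t (1 : R) (fun s => f (x + s *: v)) (\sum_i v 0 i * partial i f (x + t *: v)).
Proof.
by move=> Cf; apply: (is_derive_lineP f x v t _).1; exact: Ck1_derive_dir.
Qed.

Lemma line_continuous (x v : Rd) : continuous (fun t : R => x + t *: v).
Proof.
move=> t; apply: cvgD; first exact: cvg_cst.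
by apply: cvgZr_tmp; exact: cvg_id.
Qed.

Lemma continuous_along f (x v : Rd) : continuous f -> continuous (fun t : R => f (x + t *: v)).
Proof.
by move=> cf t; apply: continuous_comp; [exact: line_continuous|exact: cf].
Qed.

Lemma FTC_along f (x v : Rd) (t : R) : 0 < t -> Ck 1 f ->
  (\int[lebesgue_measure]_(s in `[0%R, t])
    (\sum_i v 0 i * partial i f (x + s *: v))%:E = (f (x + t *: v) - f x)%:E)%E.
Proof.
move=> t0 Cf.
have dF s : is_derive s (1 : R) (fun s => f (x + s *: v))
  (\sum_i v 0 i * partial i f (x + s *: v)) by exact: is_derive_along.
have cf : continuous (fun s : R => f (x + s *: v)).
  by apply: continuous_along; case: Cf.
rewrite (continuous_FTC2 (F := fun s => f (x + s *: v)) t0) /= ?scale0r ?addr0 ?EFinB//.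
- apply: continuous_subspaceT; apply: continuous_big => [|i _ s].
    exact: add_continuous.
  have := @continuous_along (partial i f) x v.
  have [_ /(_ i)[_ [cp _]]] := Cf => /(_ cp s) /(cvgM (cvg_cst (v 0 i))); exact.
- split => //.
  + by apply: cvg_at_right_filter; exact: cf.
  + by apply: cvg_at_left_filter; exact: cf.
- by move=> s _; rewrite derive1E; have [_ ->] := dF s.
Qed.

(** Mean value theorem in direction i for the difference of two values of f, then in direction j for
    [partial i f]. The radius is 2 |h| because i = j makes both displacements fall on one
    coordinate. *)
Lemma partial_second_difference f i j (x : Rd) (h : R) : Ck 2 f ->
  exists y : Rd, cbox x (2 * `|h|) y /\
    f (x + h *: delta_mx 0 i + h *: delta_mx 0 j) - f (x + h *: delta_mx 0 i)
    - (f (x + h *: delta_mx 0 j) - f x) = h * h * partial j (partial i f) y.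
Proof.
move=> Cf; have C1f := CkS Cf; have [_ /(_ i)[_ C1pf]] := Cf.
have E g p k t : Ck 1 g -> is_derive t (1 : R) (fun s => g (p + s *: delta_mx 0 k : Rd))
    (partial k g (p + t *: delta_mx 0 k)).
  by move=> Cg; apply: (is_derive_lineP g p (delta_mx 0 k) t _).1; exact: is_derive_partial.
have [t|c [ch]] := @MVT_dist R (fun s => f (x + h *: delta_mx 0 j + s *: delta_mx 0 i) -
   f (x + s *: delta_mx 0 i)) (fun s => partial i f (x + h *: delta_mx 0 j + s *: delta_mx 0 i) -
   partial i f (x + s *: delta_mx 0 i)) 0 h.
  by apply: is_deriveB; exact: E.
rewrite !scale0r !addr0 subr0 => e.
have [t|c' [ch']] := @MVT_dist R (fun s => partial i f (x + c *: delta_mx 0 i + s *: delta_mx 0 j))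
   (fun s => partial j (partial i f) (x + c *: delta_mx 0 i + s *: delta_mx 0 j)) 0 h.
  exact: E.
rewrite !scale0r !addr0 subr0 => e'.
rewrite !subr0 in ch ch'.
exists (x + c *: delta_mx 0 i + c' *: delta_mx 0 j); split.
  move=> k; rewrite !mxE eqxx /=.
  have -> : x 0 k + c * (k == i)%:R + c' * (k == j)%:R - x 0 k =
     c * (k == i)%:R + c' * (k == j)%:R by ring.
  rewrite (le_trans (ler_normD _ _))// mulr_natl mulr2n lerD// normrM.
    by apply: le_trans ch; case: eqP; rewrite ?normr1 ?normr0 ?mulr1 ?mulr0.
  by apply: le_trans ch'; case: eqP; rewrite ?normr1 ?normr0 ?mulr1 ?mulr0.
have comm a b : x + a *: delta_mx 0 i + b *: delta_mx 0 j = x + b *: delta_mx 0 j + a *: delta_mx 0 i :> Rd.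
  by rewrite addrAC.
by rewrite comm e -comm e'; ring.
Qed.

Lemma ler_dist_half (a b c e : R) :
  `|a - b| <= e / 2 -> `|c - b| <= e / 2 -> `|a - c| <= e.
Proof.
move=> ab cb; rewrite -(subrKA b) (le_trans (ler_normD _ _))//.
by rewrite (distrC b) (splitr e) lerD.
Qed.

(** The second difference is symmetric in i and j, so the two mixed derivatives take a common value
    at two points as close to x as desired; continuity does the rest. *)
Lemma partialC f i j (x : Rd) : Ck 2 f ->
  partial j (partial i f) x = partial i (partial j f) x.
Proof.
move=> Cf.
have [_ /(_ i)[_ [_ /(_ j)[_ [cji _]]]]] := Cf.
have [_ /(_ j)[_ [_ /(_ i)[_ [cij _]]]]] := Cf.
apply/eqP; rewrite -subr_eq0 -normr_le0; apply/ler_addgt0Pl => e e0; rewrite addr0.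
have e20 : 0 < e / 2 by rewrite divr_gt0.
have [r1 r10 xr1] : exists2 r : R, 0 < r & cbox x r `<=`
   [set y | `|partial j (partial i f) x - partial j (partial i f) y| <= e / 2].
  by apply/nbhs_cboxP; move/cvgrPdist_le : (cji x); apply.
have [r2 r20 xr2] : exists2 r : R, 0 < r & cbox x r `<=`
   [set y | `|partial i (partial j f) x - partial i (partial j f) y| <= e / 2].
  by apply/nbhs_cboxP; move/cvgrPdist_le : (cij x); apply.
pose h : R := Num.min r1 r2 / 2.
have h0 : 0 < h by rewrite divr_gt0// lt_min r10 r20.
have hr : 2 * `|h| = Num.min r1 r2 by rewrite gtr0_norm// /h mulrC divfK.
have [y [xy ey]] := partial_second_difference i j x h Cf.
have [z [xz ez]] := partial_second_difference j i x h Cf.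
have yz : partial j (partial i f) y = partial i (partial j f) z.
  have hh : h * h != 0 by rewrite mulf_neq0// gt_eqF.
  apply: (mulfI hh); apply: etrans (esym ey) (etrans _ ez).
  have -> : x + h *: delta_mx 0 j + h *: delta_mx 0 i = x + h *: delta_mx 0 i + h *: delta_mx 0 j :> Rd.
    by rewrite addrAC.
  have rr (a b c d0 : R) : a - b - (c - d0) = a - c - (b - d0) by ring.
  exact: rr.
move=> {ey ez}.
have /xr1 /= hy : cbox x r1 y.
  by move=> k; apply: le_trans (xy k) _; rewrite hr ge_min lexx.
have /xr2 /= hz : cbox x r2 z.
  by move=> k; apply: le_trans (xz k) _; rewrite hr ge_min lexx orbT.
by apply: ler_dist_half hy _; rewrite yz.
Qed.

End C1_lines.

(** * Smooth bump functions *)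

Section bump.
Context {R : realType}.

(* x^-j exp(-1/x) on x > 0: this family is closed under differentiation. *)
Definition flat (j : nat) (x : R) : R := if 0 < x then x ^- j * expR (- x^-1) else 0.

Lemma flat_ge0 j x : 0 <= flat j x.
Proof.
rewrite /flat; case: ifPn => // x0.
by rewrite mulr_ge0 ?expR_ge0// invr_ge0 exprn_ge0// ltW.
Qed.

Lemma flat_gt0 j x : 0 < x -> 0 < flat j x.
Proof. by move=> x0; rewrite /flat x0 mulr_gt0 ?expR_gt0// invr_gt0 exprn_gt0. Qed.

Lemma flat_eq0 j x : x <= 0 -> flat j x = 0.
Proof. by rewrite /flat leNgt => /negbTE ->. Qed.

Lemma flat0_le1 x : flat 0 x <= 1.
Proof.
rewrite /flat; case: ifPn => // x0; rewrite expr0 invr1 mul1r -expR0 ler_expR.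
by rewrite lerNl oppr0 invr_ge0 ltW.
Qed.

(** Comes from exp(1/x) >= x^-(j+1) / (j+1)!. Vanishing at a linear rate is enough for derivability
    at 0, because [flat j h] divided by h is again a member of the family. *)
Lemma flat_le j x : flat j x <= j.+1`!%:R * `|x|.
Proof.
rewrite /flat; case: ifPn => x0; last by rewrite mulr_ge0.
have xV0 : 0 < x^-1 by rewrite invr_gt0.
have := expR_ge1Dxn j (ltW xV0).
have fact0 : 0 < j.+1`!%:R :> R by rewrite ltr0n fact_gt0.
have xj : 0 < x ^+ j.+1 by rewrite exprn_gt0.
move=> H; have {}H : (j.+1`!%:R * x ^+ j.+1)^-1 <= expR x^-1.
  apply: le_trans H; rewrite exprVn invfM mulrC; lra.
rewrite expRN mulrC ler_pdivrMl ?expR_gt0// gtr0_norm//.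
rewrite (_ : x ^- j = (j.+1`!%:R * x ^+ j.+1)^-1 * (j.+1`!%:R * x)); last first.
  rewrite exprS; field; rewrite !gt_eqF ?exprn_gt0//.
by rewrite ler_pM2r// mulr_gt0.
Qed.

Lemma flatS_mul j x : x * flat j.+1 x = flat j x.
Proof.
rewrite /flat; case: ifPn => x0; last by rewrite mulr0.
by rewrite mulrA exprS invfM mulrA mulfV ?mul1r// gt_eqF.
Qed.

Lemma is_derive_flat j (x : R) :
  is_derive x (1 : R) (flat j) (- j%:R * flat j.+1 x + flat j.+2 x).
Proof.
have [x0|x0|->] := ltgtP x 0.
- rewrite !flat_eq0 ?(ltW x0)// mulr0 addr0.
  have E : {near x, cst (0 : R) =1 flat j}.
    near=> y; rewrite /= flat_eq0//; apply: ltW.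
    by near: y; exact: lt_nbhsl.
  exact: near_eq_is_derive E _.
- have E : {near x, (fun y => y^-1 ^+ j) * (fun y => expR (- y^-1)) =1 flat j}.
    near=> y; rewrite /flat ifT; first by rewrite -exprVn.
    by near: y; exact: lt_nbhsr.
  have xn0 : x != 0 by rewrite gt_eqF.
  apply: near_eq_is_derive E _.
  have dV : is_derive x (1 : R) (fun y : R => y^-1) (- x ^- 2 *: (1 : R)).
    by apply: is_deriveV.
  have dX := is_deriveX j dV.
  have dE : is_derive x (1 : R) (expR \o (fun y : R => - y^-1)) _ :=
    is_derive1_comp (is_derive_expR _) (is_deriveN dV).
  have -> : (fun y => y^-1 ^+ j) * (fun y => expR (- y^-1)) =
      ((fun y : R => y^-1) ^+ j) * (expR \o (fun y : R => - y^-1)).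
    by apply/funext => y; rewrite exprfctE.
  rewrite (_ : _ + _ = (((fun y : R => y^-1) ^+ j) x *:
     (expR (- x^-1) * - (- x ^- 2 *: (1 : R))) + (expR \o (fun y : R => - y^-1)) x *:
     ((j%:R * x^-1 ^+ j.-1) *: (- x ^- 2 *: (1 : R))))).
    exact: is_deriveM dX dE.
  have sE (a b : R) : a *: b = a * b by [].
  rewrite exprfctE /= /flat x0 !sE mulr1 opprK exprVn.
  have -> : x ^- j.+2 = x ^- j * x ^- 2 by rewrite -addn2 exprD invfM.
  case: j dX => [|k] _ /=; rewrite !exprVn; first by rewrite expr0; ring.
  have -> : x ^- k.+2 = x ^- k * x ^- 2 by rewrite -addn2 exprD invfM.
  ring.
- rewrite !flat_eq0// mulr0 addr0.
  have H : (fun h : R => h^-1 *: ((flat j \o shift 0) (h *: 1) - flat j 0)) @ 0^' --> (0:R).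
    apply/cvgrPdist_le => e e0; near=> h.
    have h0 : h != 0 by near: h; exact: nbhs_dnbhs_neq.
    rewrite sub0r normrN /= addr0 (flat_eq0 _ (lexx 0)) subr0.
    (* The difference quotient of [flat j] at 0 with increment h is [flat j.+1 h], which [flat_le]
       bounds linearly in h. *)
    rewrite [_%:A]mulr1 -flatS_mul [X in `|X|]mulKf//.
    rewrite ger0_norm ?flat_ge0// (le_trans (flat_le _ _))//.
    rewrite -ler_pdivlMl ?ltr0n ?fact_gt0//.
    near: h; apply: dnbhs0_le.
    by rewrite mulr_gt0// invr_gt0 ltr0n fact_gt0.
  by split; [apply/cvg_ex; exists 0; exact: H|apply: cvg_lim].
Unshelve. all: by end_near. Qed.

Lemma is_derive_affine (c m x : R) : is_derive x (1 : R) (fun s => c + s * m) m.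
Proof.
have -> : (fun s => c + s * m) = cst c + m *: id.
  by apply/funext => s; rewrite !fctE [_ *: _]mulrC.
have := is_deriveD (is_derive_cst c x (1 : R)) (is_deriveZ m (is_derive_id x (1 : R))).
by rewrite add0r [_ *: _]mulr1.
Qed.

Lemma flat_continuous j : continuous (flat j).
Proof.
move=> x; apply: differentiable_continuous; apply/derivable1_diffP.
by have [] := is_derive_flat j x.
Qed.

Variable d : nat.
Local Notation Rd := 'rV[R]_d.

Lemma is_derive_flat_coord j (b m : R) (i l : 'I_d) (x : Rd) :
  is_derive x (delta_mx 0 l : Rd) (fun y : Rd => flat j (b + m * y 0 i))
    (m * (i == l)%:R * (- j%:R * flat j.+1 (b + m * x 0 i) + flat j.+2 (b + m * x 0 i))).
Proof.
have H := (is_derive_lineP (fun y : Rd => flat j (b + m * y 0 i)) x (delta_mx 0 l) 0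
  (m * (i == l)%:R * (- j%:R * flat j.+1 (b + m * x 0 i) + flat j.+2 (b + m * x 0 i)))).2.
rewrite scale0r addr0 in H; apply: H.
rewrite (_ : (fun s => _) = flat j \o (fun s => (b + m * x 0 i) + s * (m * (i == l)%:R))).
  rewrite [X in is_derive _ _ _ X]mulrC.
  apply: is_derive1_comp; last exact: is_derive_affine.
  by have := is_derive_flat j (b + m * x 0 i); rewrite mul0r addr0.
by apply/funext => s /=; rewrite !mxE eqxx /=; congr flat; ring.
Qed.

Lemma smooth_flat (b m : R) (i : 'I_d) : smooth (fun y : Rd => flat 0 (b + m * y 0 i)).
Proof.
(* Differentiation raises the index j, so the induction on k must hold for all j at once. *)
suff H k j : Ck k (fun y : Rd => flat j (b + m * y 0 i)) by move=> k; exact: H.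
elim: k j => [|k IH] j.
  split => // x; apply: (@continuous_comp _ _ _ (fun y : Rd => b + m * y 0 i)).
    exact: (cvgD (cvg_cst b) (cvgM (cvg_cst m) (@coord_continuous R 1 d 0 i x))).
  exact: flat_continuous.
split.
  by apply: (@Ck_continuous _ _ k); exact: IH.
move=> l; split.
  by move=> x; have [] := is_derive_flat_coord j b m i l x.
rewrite (_ : partial l _ = (fun x => cst (m * (i == l)%:R) x * (cst (- j%:R) x * flat j.+1 (b + m * x 0 i) +
  flat j.+2 (b + m * x 0 i)))).
  apply: CkM; first exact: smooth_cst.
  apply: CkD; last exact: IH.
  by apply: CkM; [exact: smooth_cst|exact: IH].
by apply/funext => x; have [_ ] := is_derive_flat_coord j b m i l x.
Qed.

(** Coordinatewise product of [flat 0] at m (x_i - c_i + r) and at m (c_i + r - x_i). For m > 0 it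
    is positive exactly on the open box, and as m grows it tends to the indicator of that box; the
    arguments are expanded to fit [smooth_flat]. *)
Definition obump (c : Rd) (r m : R) (x : Rd) : R :=
  \prod_i (flat 0 (m * (r - c 0 i) + m * x 0 i) * flat 0 (m * (r + c 0 i) + (- m) * x 0 i)).

Lemma smooth_obump c r m : smooth (obump c r m).
Proof. by apply: smooth_prod => i; apply: smoothM; exact: smooth_flat. Qed.

Lemma obump_ge0 c r m x : 0 <= obump c r m x.
Proof. by apply: prodr_ge0 => i _; rewrite mulr_ge0// flat_ge0. Qed.

Lemma obump_le1 c r m x : obump c r m x <= 1.
Proof.
apply: prodr_ile1 => i _; rewrite mulr_ge0 ?flat_ge0//=.
by rewrite mulr_ile1 ?flat_ge0 ?flat0_le1.
Qed.

Lemma obump_eq0 c r m x : 0 <= m -> ~ obox c r x -> obump c r m x = 0.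
Proof.
move=> m0 /existsNP[i /negP]; rewrite -leNgt => ri.
rewrite /obump (bigD1 i)//=.
suff -> : flat 0 (m * (r - c 0 i) + m * x 0 i) * flat 0 (m * (r + c 0 i) + - m * x 0 i) = 0.
  by rewrite mul0r.
apply/eqP; rewrite mulf_eq0; apply/orP.
have [xc|xc] := leP 0 (x 0 i - c 0 i).
  right; rewrite flat_eq0// mulNr -mulrBr mulr_ge0_le0//.
  by rewrite ger0_norm// in ri; lra.
left; rewrite flat_eq0// -mulrDr mulr_ge0_le0//.
by rewrite ltr0_norm// in ri; lra.
Qed.

Lemma obump_gt0 c r m x : 0 < m -> obox c r x -> 0 < obump c r m x.
Proof.
move=> m0 xr; apply: prodr_gt0 => i _; have := xr i.
rewrite ltr_norml => /andP[h1 h2].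
by rewrite mulr_gt0 ?flat_gt0// ?mulNr -?mulrBr -?mulrDr mulr_gt0//; lra.
Qed.

Lemma obump_even r m x : obump 0 r m (- x) = obump 0 r m x.
Proof.
apply: eq_bigr => i _; rewrite !mxE subr0 addr0 mulrC mulrN mulNr.
by congr (flat _ _ * flat _ _); ring.
Qed.

Lemma flat0_cvg1 (y : R) : 0 < y -> (fun k => flat 0 (k.+1%:R * y)) @ \oo --> (1 : R).
Proof.
move=> y0.
rewrite (_ : (fun k => _) = expR \o (fun k : nat => - (k.+1%:R^-1 * y^-1))); last first.
  apply/funext => k /=; rewrite /flat mulr_gt0 ?ltr0n// expr0 invr1 mul1r.
  by rewrite invfM.
rewrite -[X in _ --> X]expR0; apply: continuous_cvg; first exact: continuous_expR.
rewrite -[X in _ --> X]oppr0; apply: cvgN.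
rewrite -[X in _ --> X](mul0r y^-1).
exact: (cvgM (@cvg_harmonic R) (cvg_cst y^-1)).
Qed.

Lemma obump_cvg1 c r x : obox c r x -> (fun k => obump c r k.+1%:R x) @ \oo --> (1 : R).
Proof.
move=> xr.
rewrite [X in _ --> X](_ : 1 = \prod_(i < d) (1 * 1)); last first.
  by rewrite big1// => i _; rewrite mulr1.
apply: cvg_big => [|i _].
  exact: mul_continuous.
have := xr i; rewrite ltr_norml => /andP[h1 h2].
by apply: cvgM; [under eq_fun do rewrite -mulrDr|under eq_fun do rewrite mulNr -mulrBr];
  apply: flat0_cvg1; lra.
Qed.

End bump.

(** * Bounded multipliers and dominated convergence for real integrals *)

Section Rintegral_extra.
Context d (T : measurableType d) (R : realType).
Variables (mu : {measure set T -> \bar R}) (D : set T).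
Hypothesis mD : measurable D.

Lemma integrable_bddM (f h : T -> R) (M : R) : measurable_fun D f ->
  (forall x, D x -> `|f x| <= M) -> mu.-integrable D (EFin \o h) ->
  mu.-integrable D (EFin \o (fun x => f x * h x)).
Proof.
move=> mf fM ih.
apply: (le_integrable mD (g := fun x => (M%:E * (h x)%:E)%E)).
- apply/measurable_EFinP; apply: measurable_funM => //.
  by apply/measurable_EFinP; exact: measurable_int ih.
- move=> x Dx; rewrite /= lee_fin !normrM ler_wpM2r// (le_trans (fM _ Dx))//.
  exact: ler_norm.
- exact: (integrableZl mD M ih).
Qed.

Lemma Rintegral_dominated_cvg (f_ : nat -> T -> R) (f g : T -> R) :
  (forall n, measurable_fun D (f_ n)) ->
  (forall x, D x -> f_^~ x @ \oo --> f x) ->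
  mu.-integrable D (EFin \o g) ->
  (forall n x, D x -> `|f_ n x| <= g x) ->
  mu.-integrable D (EFin \o f) /\
  (\int[mu]_(x in D) f_ n x) @[n --> \oo] --> \int[mu]_(x in D) f x.
Proof.
move=> mf_ ff ig fg.
have mf : measurable_fun D f.
  by apply: measurable_fun_cvg mf_ ff.
have := @dominated_convergence _ _ _ mu D mD (fun n => EFin \o f_ n) (EFin \o f) (EFin \o g).
case.
- by move=> n; exact/measurable_EFinP.
- exact/measurable_EFinP.
- by apply: aeW => x Dx; apply: cvg_EFin; [exact: nearW|exact: ff].
- exact: ig.
- by apply: aeW => x n Dx; rewrite lee_fin fg.
move=> intf _ cvgf; split => //.
apply: fine_cvg; rewrite /Rintegral fineK //.
exact: integrable_fin_num.
Qed.

End Rintegral_extra.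

(** * Approximation of indicators by test functions in weighted L^1 *)

Section density.
Context {R : realType} {d : nat}.
Local Notation Rd := 'rV[R]_d.
Local Notation mu := (@lebesgue_rV R d).
Variables (Omega : set Rd) (h : Rd -> R).
Hypothesis oO : open Omega.
Hypothesis h0 : forall x, 0 <= h x.
Hypothesis ih : mu.-integrable Omega (EFin \o h).

Let mO : measurable Omega := open_measurable_rV oO.
Let I (f : Rd -> R) : R := \int[mu]_(x in Omega) (`|f x| * h x).

Let intI (f : Rd -> R) : measurable_fun setT f -> (forall x, `|f x| <= 2) ->
  mu.-integrable Omega (EFin \o (fun x => `|f x| * h x)).
Proof.
move=> mf f2; apply: (@integrable_bddM _ _ _ _ _ mO _ _ 2 _ _ ih).
  by apply: measurable_funTS; apply: measurableT_comp mf.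
by move=> x _; rewrite normr_id.
Qed.

Let ler_I (f f1 f2 : Rd -> R) : measurable_fun setT f -> measurable_fun setT f1 ->
  measurable_fun setT f2 -> (forall x, `|f1 x| <= 2) -> (forall x, `|f2 x| <= 2) ->
  (forall x, Omega x -> `|f x| <= `|f1 x| + `|f2 x|) -> (forall x, `|f x| <= 2) ->
  I f <= I f1 + I f2.
Proof.
move=> mf m1 m2 b1 b2 ff b; rewrite -RintegralD//; [|exact: intI..].
apply: le_Rintegral => //; first exact: intI.
  have := integrableD mO (intI m1 b1) (intI m2 b2); exact.
by move=> x Ox; rewrite -mulrDl ler_wpM2r// ff.
Qed.

Let cvg_I (f : nat -> Rd -> R) : (forall n, measurable_fun setT (f n)) ->
  (forall n x, `|f n x| <= 2) -> (forall x, Omega x -> f ^~ x @ \oo --> (0:R)) ->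
  I (f n) @[n --> \oo] --> (0:R).
Proof.
move=> mf bf cf.
have [||||_] := @Rintegral_dominated_cvg _ _ _ mu Omega mO (fun n x => `|f n x| * h x) (cst 0) (fun x => 2 * h x).
- move=> n; apply: measurable_funM; first by apply: measurable_funTS; exact: measurableT_comp.
  by apply/measurable_EFinP; exact: measurable_int ih.
- move=> x Ox; rewrite -[X in _ --> X](mul0r (h x)).
  apply: cvgM; last exact: cvg_cst.
  by rewrite -(@normr0 _ R); apply: cvg_norm; exact: cf.
- have := integrableZl mO 2 ih; exact.
- move=> n x Ox; rewrite normrM normr_id (ger0_norm (h0 x)) ler_wpM2r//.
by rewrite [X in _ --> X -> _]/Rintegral integral0.
Qed.

(** Good-set principle: these sets form a sigma-algebra which contains the coordinate half-spaces,
    hence every measurable set. *)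
Let approx (A : set Rd) := measurable A /\ forall e : R, 0 < e ->
  exists g, [/\ smooth g, forall x, 0 <= g x <= 1 & I (\1_A \- g) < e].

Let mapprox (A : set Rd) g : measurable A -> smooth g -> measurable_fun setT (\1_A \- g : Rd -> R).
Proof.
move=> mA sg; apply: measurable_funB; first exact: measurable_indic.
by apply: continuous_measurable_rV; exact: smooth_continuous.
Qed.

Let indic01 (A : set Rd) x : 0 <= (\1_A x : R) <= 1.
Proof. by rewrite indicE; case: (_ \in _); rewrite !lexx ler01. Qed.

Let bapprox (a b : R) : 0 <= a <= 1 -> 0 <= b <= 1 -> `|a - b| <= 2.
Proof. by move=> /andP[? ?] /andP[? ?]; rewrite ler_norml; lra. Qed.

Let approx0 : approx set0.
Proof.
split=> // e e0; exists (cst 0); split.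
- exact: smooth_cst.
- by move=> x; rewrite lexx ler01.
- rewrite /I (_ : (fun x => _) = cst 0) ?Rintegral_cst ?mul0r//.
  by apply/funext => x /=; rewrite indicE in_set0 subr0 normr0 mul0r.
Qed.

Let approxC A : approx A -> approx (~` A).
Proof.
move=> [mA Ag]; split; first exact: measurableC.
move=> e /Ag[g [sg g01 Ie]]; exists (fun x => 1 - g x); split.
- by apply: smoothB => //; exact: smooth_cst.
- by move=> x; have := g01 x; lra.
rewrite (_ : I _ = I (\1_A \- g))//.
apply: eq_Rintegral => x _; congr (_ * _).
rewrite /= !indicE in_setC; case: (x \in A) => /=; rewrite distrC ?subr0; congr `|_|; ring.
Qed.

Let approxU A B : approx A -> approx B -> approx (A `|` B).
Proof.
move=> [mA Ag] [mB Bg]; split; first exact: measurableU.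
move=> e e0; have e20 : 0 < e / 2 by rewrite divr_gt0.
have [f [sf f01 If]] := Ag _ e20; have [g [sg g01 Ig]] := Bg _ e20.
(* Smooth counterpart of a union: its complement is the product of the complements, and all values
   stay in [0, 1]. *)
exists (fun x => 1 - (1 - f x) * (1 - g x)).
have s : smooth (fun x => 1 - (1 - f x) * (1 - g x)).
  by apply: smoothB; [exact: smooth_cst|apply: smoothM; apply: smoothB => //; exact: smooth_cst].
have b x : 0 <= 1 - (1 - f x) * (1 - g x) <= 1.
  have /andP[? ?] := f01 x; have /andP[? ?] := g01 x.
  by rewrite subr_ge0 mulr_ile1 /= ?gerBl ?mulr_ge0//; lra.
split => //; rewrite (splitr e); apply: le_lt_trans (ltrD If Ig).
apply: ler_I; try by apply: mapprox => //; exact: measurableU.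
- by move=> x; exact: bapprox.
- by move=> x; exact: bapprox.
- move=> x _ /=; rewrite !indicE in_setU.
  have /andP[? ?] := f01 x; have /andP[? ?] := g01 x.
  case: (x \in A) => /=.
    rewrite ?mulr1n subKr.
    rewrite normrM (le_trans (y := `|1 - f x|))// ?lerDl//.
    by rewrite ler_piMr// ler_norml; lra.
  case: (x \in B) => /=.
    rewrite ?mulr1n subKr.
    rewrite normrM (le_trans (y := `|1 - g x|))// ?lerDr//.
    by rewrite ler_piMl// ler_norml; lra.
  rewrite !sub0r !normrN !ger0_norm//; last by have /andP[] := b x.
  by rewrite (_ : 1 - _ = f x + g x - f x * g x); [rewrite gerBl mulr_ge0|ring].
- by move=> x; exact: bapprox.
Qed.

Let cvg0_lt (u : nat -> R) (e : R) : u @ \oo --> (0:R) -> 0 < e -> exists n, `|u n| < e.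
Proof.
move=> /cvgr0Pnorm_lt /(_ e) H e0; have [N _ HN] := H e0.
by exists N; exact: (HN N (leqnn N)).
Qed.

(** Finite unions converge to the countable one in the weighted norm by dominated convergence; half
    of e is spent there and half on approximating one finite union. *)
Let approx_bigcup (A : nat -> set Rd) : (forall n, approx (A n)) -> approx (\bigcup_k A k).
Proof.
move=> aA; pose B n := \big[setU/set0]_(k < n) A k.
have aB n : approx (B n).
  rewrite /B; elim: n => [|n IH]; last by rewrite big_ord_recr; exact: approxU.
  by rewrite big_ord0; exact: approx0.
have mU : measurable (\bigcup_k A k) by apply: bigcupT_measurable => k; have [] := aA k.
split => // e e0; have e20 : 0 < e / 2 by rewrite divr_gt0.
have mB n : measurable (B n) by have [] := aB n.
have [n In] : exists n, `|I (\1_(\bigcup_k A k) \- \1_(B n))| < e / 2.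
  apply: cvg0_lt => //; apply: cvg_I.
  - by move=> n; apply: measurable_funB; exact: measurable_indic.
  - by move=> n x; exact: bapprox.
  - move=> x _; rewrite -[X in _ --> X](subrr (\1_(\bigcup_k A k) x : R)).
    apply: cvgB; first exact: cvg_cst.
    have [[k _ Akx]|nA] := pselect ((\bigcup_k A k) x).
      apply: cvg_near_cst; exists k.+1 => // n /= kn.
      have Bx : B n x by rewrite /B -bigcup_mkord; exists k.
      have Ux : (\bigcup_k A k) x by exists k.
      by rewrite !indicE !mem_set.
    apply: cvg_near_cst; apply: nearW => n.
    rewrite !indicE !memNset// /B -bigcup_mkord => -[k _ Akx].
    by apply: nA; exists k.
have [g [sg g01 Ig]] := (aB n).2 _ e20; exists g; split => //.
rewrite (splitr e); apply: le_lt_trans (ltrD (le_lt_trans (ler_norm _) In) Ig).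
apply: ler_I.
- exact: mapprox.
- by apply: measurable_funB; exact: measurable_indic.
- exact: mapprox.
- by move=> x; exact: bapprox.
- by move=> x; exact: bapprox.
- by move=> x _ /=; rewrite -[X in `|X| <= _](subrKA (\1_(B n) x)) ler_normD.
- by move=> x; exact: bapprox.
Qed.

(** As n grows, [flat 0] of (n+1) (x_i - a) tends to the indicator of a < x_i. *)
Let approx_halfspace i (a : R) : approx [set x : Rd | a < x 0 i].
Proof.
have mA : measurable [set x : Rd | a < x 0 i].
  rewrite (_ : mkset _ = (fun x : Rd => x 0 i) @^-1` `]a, +oo[); last first.
    by apply/seteqP; split => x /=; rewrite in_itv /= andbT.
  rewrite -[X in measurable X]setTI.
  by apply: (measurable_coor i) => //; exact: measurable_itv.
split => // e e0.
pose g n (x : Rd) : R := flat 0 (n.+1%:R * - a + n.+1%:R * x 0 i).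
have sg n : smooth (g n) by exact: smooth_flat.
have g01 n x : 0 <= g n x <= 1 by rewrite flat_ge0 flat0_le1.
have [n In] : exists n, `|I (\1_[set x : Rd | a < x 0 i] \- g n)| < e.
  apply: cvg0_lt => //; apply: cvg_I.
  - by move=> n; exact: mapprox.
  - by move=> n x; exact: bapprox.
  - move=> x _.
    have [ax|xa] := ltP a (x 0 i).
      rewrite -[X in _ --> X](subrr (1 : R)); apply: cvgB.
        by rewrite indicE mem_set//; exact: cvg_cst.
      under eq_fun do rewrite /g -mulrDr.
      by apply: flat0_cvg1; rewrite addrC subr_gt0.
    apply: cvg_near_cst; apply: nearW => k.
    rewrite /= indicE memNset; last by rewrite /= ltNge xa.
    by rewrite /g flat_eq0 ?subr0// -mulrDr mulr_ge0_le0// addrC subr_le0.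
by exists (g n); split => //; exact: le_lt_trans (ler_norm _) In.
Qed.

Let approx_measurable A : measurable A -> approx A.
Proof.
have sC : sigma_algebra setT approx.
  split; [exact: approx0|by move=> B aB; rewrite setTD; exact: approxC|exact: approx_bigcup].
move: A; apply: smallest_sub => // A; rewrite -bigcup_seq => -[i _ [B mB <-]].
rewrite setTI; move: mB; have -> := RGenOInfty.measurableE R.
(* A second good-set argument, now for the Borel sets of one coordinate, generated by rays. *)
suff H : <<s @RGenOInfty.G R>> `<=` [set B : set R | approx ((fun x : Rd => x 0 i) @^-1` B)].
  exact: H.
apply: smallest_sub; first split => /=.
- by rewrite preimage_set0; exact: approx0.
  - by move=> C aC; rewrite setTD preimage_setC; exact: approxC.
  - by move=> C aC; rewrite preimage_bigcup; exact: approx_bigcup.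
move=> _ [a ->] /=; rewrite (_ : _ @^-1` _ = [set x : Rd | a < x 0 i]).
  exact: approx_halfspace.
by apply/seteqP; split => x /=; rewrite in_itv /= andbT.
Qed.

(* C_c^oo(Omega), for functions extended by zero. *)
Definition tfun (Omega : set Rd) (psi : Rd -> R) : Prop :=
  smooth psi /\ exists2 K, compact K /\ K `<=` Omega & forall x, ~ K x -> psi x = 0.

(** A smooth union of the first n bumps, with sharpness growing with n. For n > k it dominates the
    k-th bump, which tends to 1 on its box. *)
Lemma cutoff_seq : exists chi : nat -> Rd -> R,
  [/\ forall n, tfun Omega (chi n), forall n x, 0 <= chi n x <= 1 &
      forall x, Omega x -> chi ^~ x @ \oo --> (1 : R)].
Proof.
have [Oe|/set0P On0] := eqVneq Omega set0.
  exists (fun=> cst 0); split => [_|_ x|x]; last by rewrite Oe.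
    split; first exact: smooth_cst.
    by exists set0 => //; split => //; exact: compact0.
  by rewrite lexx ler01.
have [c [r [r0 crO OE]]] := open_bigcup_obox oO On0.
pose b k n x := obump (c k) (r k) n.+1%:R x.
have b01 k n x : 0 <= 1 - b k n x <= 1.
  by rewrite subr_ge0 gerBl obump_ge0 obump_le1.
pose chi n x : R := 1 - \prod_(k < n) (1 - b k n x).
have chi01 n x : 0 <= chi n x <= 1.
  rewrite /chi subr_ge0 gerBl; apply/andP; split.
    by apply: prodr_ile1 => k _; exact: b01.
  by apply: prodr_ge0 => k _; have /andP[] := b01 k n x.
exists chi; split => //.
- move=> n; split.
    apply: smoothB; first exact: smooth_cst.
    apply: smooth_prod => k; apply: smoothB; first exact: smooth_cst.
    exact: smooth_obump.
  exists (\big[setU/set0]_(k < n) cbox (c k) (r k)); first split.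
  + by apply: bigsetU_compact => k _; exact: cbox_compact.
  + by rewrite -(bigcup_mkord n (fun k => cbox (c k) (r k))) => x [k _]; exact: crO.
  + move=> x nx; rewrite /chi big1 ?subrr// => k _.
    rewrite /b obump_eq0 ?subr0 ?ler0n// => xk; apply: nx.
    rewrite -(bigcup_mkord n (fun k => cbox (c k) (r k))).
    by exists k => //=; exact: subset_obox_cbox.
- move=> x; rewrite {1}OE => -[k _ xk].
  apply: (@squeeze_cvgr _ _ _ _ (b k ^~ x) (cst 1)) => //; last 2 first.
  + exact: obump_cvg1.
  + exact: cvg_cst.
  exists k.+1 => // n /= kn; have /andP[_ ->] := chi01 n x; rewrite andbT.
  rewrite /chi (bigD1 (Ordinal kn))//= lerBrDr -lerBrDl.
  rewrite -[leRHS]mulr1 ler_wpM2l//; first by have /andP[] := b01 k n x.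
  by apply: prodr_ile1 => j _; exact: b01.
Qed.

(** A smooth approximation g on R^d times a cutoff; as g <= 1, the error is at most that of g plus
    that of the cutoff. *)
Lemma density (A : set Rd) (e : R) : measurable A -> 0 < e ->
  exists psi, [/\ tfun Omega psi, forall x, 0 <= psi x <= 1 &
    \int[mu]_(x in Omega) (`|\1_A x - psi x| * h x) < e].
Proof.
move=> mA e0; have e20 : 0 < e / 2 by rewrite divr_gt0.
have [g [sg g01 Ig]] := (approx_measurable mA).2 _ e20.
have [chi [tchi chi01 chi1]] := cutoff_seq.
have mchi n : measurable_fun setT (cst 1 \- chi n : Rd -> R).
  apply: measurable_funB => //; apply: continuous_measurable_rV.
  by apply: smooth_continuous; have [] := tchi n.
have c01 : 0 <= (1 : R) <= 1 by rewrite ler01 lexx.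
have [n In] : exists n, `|I (cst 1 \- chi n)| < e / 2.
  apply: cvg0_lt => //; apply: cvg_I => //.
  - by move=> n x; exact: bapprox.
  - move=> x Ox; rewrite -[X in _ --> X](subrr (1 : R)).
    by apply: cvgB; [exact: cvg_cst|exact: chi1].
have [schi [K [cK KO] K0]] := tchi n.
have b x : 0 <= g x * chi n x <= 1.
  have /andP[? ?] := g01 x; have /andP[? ?] := chi01 n x.
  by rewrite mulr_ge0// mulr_ile1.
exists (fun x => g x * chi n x); split => //.
  split; first exact: smoothM.
  by exists K => // x Kx; rewrite K0// mulr0.
rewrite (splitr e); apply: le_lt_trans (ltrD Ig (le_lt_trans (ler_norm _) In)).
apply: ler_I => //.
- by apply: mapprox => //; exact: smoothM.
- exact: mapprox.
- by move=> x; exact: bapprox.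
- by move=> x; exact: bapprox.
- move=> x _ /=; rewrite -[X in `|X| <= _](subrKA (g x)) (le_trans (ler_normD _ _))// lerD2l.
  rewrite -{1}[g x]mulr1 -mulrBr normrM ler_piMl//.
  by have /andP[? ?] := g01 x; rewrite ger0_norm.
- by move=> x; exact: bapprox.
Qed.

End density.

Lemma integrable_indic_fin d (T : measurableType d) (R : realType)
    (mu : {measure set T -> \bar R}) (A : set T) : measurable A -> (mu A < +oo)%E ->
  mu.-integrable setT (EFin \o (\1_A : T -> R)).
Proof.
move=> mA Afin; rewrite (_ : _ \o _ = (EFin \o cst (1 : R)) \_ A); last first.
  by apply/funext => x; rewrite /patch /= indicE; case: ifP.
apply: (iffLR (integrable_mkcond _ mA)); apply: measurable_bounded_integrable => //.
exact: bounded_cst.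
Qed.

(** * Test functions: integrals, translations, integration by parts *)

Section tfun_theory.
Context {R : realType} {d : nat}.
Local Notation Rd := 'rV[R]_d.
Local Notation mu := (@lebesgue_rV R d).
Implicit Types (Omega : set Rd) (f g psi : Rd -> R).

Lemma compact_support_bounded f (K : set Rd) : continuous f -> compact K ->
  (forall x, ~ K x -> f x = 0) -> exists2 M : R, 0 < M & forall x, `|f x| <= M.
Proof.
move=> cf cK fK.
have /compact_bounded[M [_ HM]] : compact (f @` K).
  by apply: continuous_compact => //; exact: continuous_subspaceT.
exists (`|M| + 1); first by rewrite ltr_wpDl.
move=> x; have [Kx|nK] := pselect (K x); last by rewrite fK// normr0 addr_ge0.
apply: HM; last by exists x.
by rewrite (le_lt_trans (ler_norm M))// ltrDl.
Qed.

Lemma compact_support_integrable f (K : set Rd) : continuous f -> compact K ->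
  (forall x, ~ K x -> f x = 0) -> mu.-integrable setT (EFin \o f).
Proof.
move=> cf cK fK; have [M M0 fM] := compact_support_bounded cf cK fK.
have mK : measurable K by apply: closed_measurable_rV; exact: compact_rV_closed.
have mf := continuous_measurable_rV cf.
have -> : EFin \o f = (EFin \o f) \_ K.
  apply/funext => x; rewrite /patch; case: ifPn => // /negP Kx /=.
  by rewrite fK// => /mem_set.
apply: (iffLR (integrable_mkcond _ mK)); apply: measurable_bounded_integrable => //.
- by apply: lebesgue_bounded_fin => //; exact: compact_bounded.
- exact: measurable_funTS.
- exists M; split; first exact: num_real.
  by move=> y My x _; exact: le_trans (fM x) (ltW My).
Qed.

Lemma continuous_cbox f : (forall x (e : R), 0 < e ->
    exists2 r : R, 0 < r & forall y, cbox x r y -> `|f x - f y| <= e) -> continuous f.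
Proof.
move=> H x A /nbhs_ballP[e /= e0 eA].
have [|r r0 xr] := H x (e / 2); first by rewrite divr_gt0.
apply/nbhs_cboxP; exists r => // y /xr fxy; apply: eA.
by rewrite /ball /= (le_lt_trans fxy)// ltr_pdivrMr// ltr_pMr// ltr1n.
Qed.

Lemma tfun_continuous Omega psi : tfun Omega psi -> continuous psi.
Proof. by move=> [/smooth_continuous]. Qed.

Lemma tfun_bounded Omega psi : tfun Omega psi -> exists2 M : R, 0 < M & forall x, `|psi x| <= M.
Proof.
move=> [s [K [cK _] K0]]; apply: compact_support_bounded K0 => //.
exact: smooth_continuous.
Qed.

Lemma tfun_integrable Omega psi : tfun Omega psi -> mu.-integrable setT (EFin \o psi).
Proof.
move=> [s [K [cK _] K0]]; apply: compact_support_integrable K0 => //.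
exact: smooth_continuous.
Qed.

Lemma tfun_out Omega psi x : tfun Omega psi -> ~ Omega x -> psi x = 0.
Proof. by move=> [s [K [cK KO] K0]] Ox; apply: K0 => /KO. Qed.

Lemma tfunS Omega Omega' psi : Omega `<=` Omega' -> tfun Omega psi -> tfun Omega' psi.
Proof.
move=> OO [s [K [cK KO] K0]]; split => //; exists K => //; split => //.
exact: subset_trans OO.
Qed.

Lemma partial_out f (K : set Rd) i x : compact K -> (forall x, ~ K x -> f x = 0) ->
  ~ K x -> partial i f x = 0.
Proof.
move=> cK fK Kx; rewrite /partial.
rewrite (near_eq_derive (g := cst 0)); first exact: derive_cst.
have : open (~` K) by apply: closed_openC; exact: compact_rV_closed.
move=> oK; near=> y; apply: fK; near: y; exact: open_nbhs_nbhs.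
Unshelve. all: by end_near. Qed.

Lemma tfun_partial Omega psi i : tfun Omega psi -> tfun Omega (partial i psi).
Proof.
move=> [s [K [cK KO] K0]]; split; first exact: smooth_partial.
by exists K => // x Kx; apply: partial_out Kx.
Qed.

Lemma tfunM Omega f psi : smooth f -> tfun Omega psi -> tfun Omega (fun x => f x * psi x).
Proof.
move=> sf [s [K [cK KO] K0]]; split; first exact: smoothM.
by exists K => // x Kx; rewrite K0// mulr0.
Qed.

Lemma Rintegral_out Omega f : measurable Omega -> (forall x, ~ Omega x -> f x = 0) ->
  \int[mu]_(x in Omega) f x = \int[mu]_x f x.
Proof.
move=> mO fO; rewrite Rintegral_mkcond; apply: eq_Rintegral => x _.
rewrite /patch; case: ifPn => // /negP Ox.
by rewrite fO// => /mem_set.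
Qed.

(** Translations and reflections preserve the measure, the factor |t|^d being 1; the change of
    variables is applied to positive and negative parts. *)
Lemma Rintegral_isometry f (c : Rd) (t : R) : `|t| = 1 -> measurable_fun setT f ->
  \int[mu]_x f (c + t *: x) = \int[mu]_x f x.
Proof.
move=> t1 mf; rewrite /Rintegral; congr fine.
have t0 : t != 0 by rewrite -normr_eq0 t1 oner_eq0.
have mEf : measurable_fun setT (EFin \o f) by exact/measurable_EFinP.
rewrite [RHS]integralE (ge0_integral_affine_rV c t0 (measurable_funepos mEf))//.
rewrite (ge0_integral_affine_rV c t0 (measurable_funeneg mEf))//.
rewrite t1 expr1n !mul1e [LHS]integralE.
by congr (_ - _)%E; apply: eq_integral => x _; rewrite ?funeposE ?funenegE.
Qed.

Lemma Rintegral_translate f (c : Rd) : measurable_fun setT f ->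
  \int[mu]_x f (x + c) = \int[mu]_x f x.
Proof.
move=> mf; rewrite -(@Rintegral_isometry f c 1) ?normr1//.
by apply: eq_Rintegral => x _; rewrite scale1r addrC.
Qed.

Lemma Rintegral_oppose f : measurable_fun setT f ->
  \int[mu]_x f (- x) = \int[mu]_x f x.
Proof.
move=> mf; rewrite -(@Rintegral_isometry f 0 (-1)) ?normrN1//.
by apply: eq_Rintegral => x _; rewrite scaleN1r add0r.
Qed.

Lemma is_derive_line_partial f i (x : Rd) (t : R) : Ck 1 f ->
  is_derive t (1 : R) (fun s => f (x + s *: delta_mx 0 i)) (partial i f (x + t *: delta_mx 0 i)).
Proof.
move=> Cf; apply: (is_derive_lineP f x (delta_mx 0 i) t _).1.
exact: is_derive_partial.
Qed.

(** The integral of f(x + s e_i) over x does not depend on s; differentiating under the integral at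
    s = 0 gives the claim. *)
Lemma Rintegral_partial f (K : set Rd) i : Ck 1 f -> compact K ->
  (forall x, ~ K x -> f x = 0) -> \int[mu]_x partial i f x = 0.
Proof.
move=> Cf cK fK.
have cf := Ck_continuous Cf.
have cpf : continuous (partial i f) by have [_ /(_ i)[_ []]] := Cf.
have pfK x : ~ K x -> partial i f x = 0 by exact: partial_out.
have [M M0 pM] := compact_support_bounded cpf cK pfK.
have [r Kr] := bounded_subset_cbox (compact_bounded cK).
pose F (s : R) (x : Rd) : R := f (x + s *: delta_mx 0 i).
have dF s x : is_derive s (1 : R) (F ^~ x) (partial i f (x + s *: delta_mx 0 i)).
  exact: is_derive_line_partial.
have mf : measurable_fun setT f := continuous_measurable_rV cf.
have I00 : (`](-1 : R), 1[%classic : set R) 0 by rewrite /= in_itv /= ltrN10 ltr01.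
(* Contains the supports of all translates with |s| < 1, so M times its indicator dominates. *)
pose B := cbox (0 : Rd) (r + 1).
have mB : measurable B by apply: closed_measurable_rV; exact: cbox_closed.
have := @differentiation_under_integral R _ _ mu F setT measurableT 0 (-1) 1 I00.
move=> /(_ _ _ (fun x => M * \1_B x)) H.
have : derive1 (fun s : R => \int[mu]_x F s x) 0 = \int[mu]_x partial i f x.
  rewrite H.
  - apply: eq_Rintegral => x _; rewrite /partial1of2 derive1E.
    by have [_ ->] := dF 0 x; rewrite scale0r addr0.
  - move=> s _; apply: (compact_support_integrable (K := (fun x => x - s *: delta_mx 0 i) @` K)).
    + by move=> x; apply: (@continuous_comp _ _ _ (fun x : Rd => x + s *: delta_mx 0 i)); [exact: shiftr_continuous|exact: cf].
    + apply: continuous_compact => //; apply: continuous_subspaceT.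
      exact: shiftr_continuous.
    + by move=> x nx; apply: fK => Kx; apply: nx; eexists; [exact: Kx|rewrite addrK].
  - by move=> s x _ _; have [] := dF s x.
  - by move=> x; rewrite mulr_ge0// ltW.
  - apply: (integrableZl measurableT M (f := EFin \o \1_B)).
    by apply: integrable_indic_fin => //; exact: lebesgue_cbox_fin.
  - move=> s x; rewrite /= in_itv /= => /andP[s1 s2] _.
    rewrite /partial1of2 derive1E; have [_ ->] := dF s x.
    have [Bx|nBx] := pselect (B x).
      by rewrite indicE mem_set// mulr1 pM.
    rewrite pfK ?normr0 ?mulr_ge0// 1?ltW// => /Kr Kx; apply: nBx => j.
    have := Kx j; rewrite !mxE eqxx /= !subr0 => Kj.
    rewrite (_ : x 0 j = x 0 j + s * (j == i)%:R - s * (j == i)%:R); last by rewrite addrK.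
    rewrite (le_trans (ler_normB _ _))// lerD//.
    rewrite normrM; case: (j == i); rewrite ?normr0 ?mulr0// normr1 mulr1.
    by rewrite ler_norml; lra.
rewrite (_ : (fun s => _) = cst (\int[mu]_x f x)); last first.
  by apply/funext => s; rewrite /F Rintegral_translate.
by rewrite derive1_cst.
Qed.

Lemma Ck1_lipschitz f (K : set Rd) : Ck 1 f -> compact K -> (forall x, ~ K x -> f x = 0) ->
  exists2 L : R, 0 < L & forall x y e, 0 <= e -> cbox x e y -> `|f y - f x| <= L * e.
Proof.
move=> Cf cK fK.
have : forall i, exists M : R, 0 < M /\ forall x, `|partial i f x| <= M.
  move=> i; have cp : continuous (partial i f) by have [_ /(_ i)[_ []]] := Cf.
  have pK x : ~ K x -> partial i f x = 0 by exact: partial_out.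
  by have [M M0 HM] := compact_support_bounded cp cK pK; exists M.
move=> /choice[M HM].
exists (\sum_i M i + 1).
  by rewrite ltr_wpDl// sumr_ge0// => i _; have [/ltW] := HM i.
move=> x y e e0 xy.
have [t|t [_]] := @MVT_dist R (fun s => f (x + s *: (y - x)))
  (fun s => \sum_i (y - x) 0 i * partial i f (x + s *: (y - x))) 0 1.
  exact: is_derive_along.
rewrite scale1r scale0r addr0 subrKC subr0 mulr1 => ->.
rewrite (le_trans (ler_norm_sum _ _ _))//.
rewrite mulrDl mulr_suml mul1r (le_trans (y := \sum_i M i * e)) ?lerDl//.
apply: ler_sum => i _; rewrite normrM mulrC ler_pM//; first by have [_] := HM i.
by rewrite !mxE; exact: xy.
Qed.

End tfun_theory.

(** * Weighted averages of translates of a test function *)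

Section average.
Context {R : realType} {d : nat}.
Local Notation Rd := 'rV[R]_d.
Context dZ (Z : measurableType dZ) (nu : {measure set Z -> \bar R}).
Variables (m : Z -> R) (a : Z -> Rd).
Hypothesis im : nu.-integrable setT (EFin \o m).
Hypothesis ma : measurable_fun setT a.

(** One formula for three uses: convolution with a kernel at scale t, averages along segments, and
    the pairing of u with translates of a test function. All derivatives fall on psi, so the average
    is smooth for every integrable weight. *)
Definition average (psi : Rd -> R) (y : Rd) : R := \int[nu]_z (m z * psi (y + a z)).

Lemma average_integrable psi y : tfun setT psi ->
  nu.-integrable setT (EFin \o (fun z => m z * psi (y + a z))).
Proof.
move=> tp; have [M M0 pM] := tfun_bounded tp.
under eq_fun do rewrite mulrC.
apply: (@integrable_bddM _ _ _ nu _ measurableT (fun z => psi (y + a z)) m M) => //.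
apply: (measurableT_comp (f := fun x => psi (y + x))) => //.
apply: continuous_measurable_rV; under eq_fun do rewrite addrC.
move=> x; apply: (@continuous_comp _ _ _ (fun x : Rd => x + y)).
  exact: shiftr_continuous.
exact: (tfun_continuous tp).
Qed.

Lemma average_continuous psi : tfun setT psi -> continuous (average psi).
Proof.
move=> tp; have [s [K [cK _] K0]] := tp.
have [L L0 psiL] := Ck1_lipschitz (s 1%N) cK K0.
pose I := \int[nu]_z `|m z|.
have I0 : 0 <= I by apply: Rintegral_ge0.
(* The difference is at most I L times the radius; I + 1 instead of I avoids a zero denominator. *)
apply: continuous_cbox => x e e0; exists (e / (L * (I + 1))).
  by rewrite divr_gt0// mulr_gt0// ltr_wpDl.
move=> y xy /=; rewrite distrC -RintegralB//; [|exact: average_integrable..].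
apply: le_trans (le_normr_Rintegral measurableT _) _.
  exact: (integrableB measurableT (average_integrable y tp) (average_integrable x tp)).
apply: (@le_trans _ _ (\int[nu]_z (`|m z| * (L * (e / (L * (I + 1))))))).
  apply: le_Rintegral => //.
  - have := integrable_norm (integrableB measurableT (average_integrable y tp) (average_integrable x tp)).
    by apply.
  - have := integrableZr measurableT (L * (e / (L * (I + 1)))) (integrable_norm im); exact.
  - move=> z _; rewrite -mulrBr normrM ler_wpM2l// psiL//.
      by rewrite divr_ge0 ?mulr_ge0 ?addr_ge0// ltW.
    by move=> i; have := xy i; rewrite !mxE opprD addrACA subrr addr0.
rewrite RintegralZr//; last exact: integrable_norm.
rewrite -/I (_ : L * _ = e / (I + 1)); last by field; rewrite !gt_eqF// ltr_wpDl.
by rewrite mulrCA ler_piMr// ?(ltW e0)// ler_pdivrMr ?ltr_wpDl// mul1r lerDl.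
Qed.

Lemma is_derive_average psi (i : 'I_d) y : tfun setT psi ->
  is_derive y (delta_mx 0 i : Rd) (average psi) (average (partial i psi) y).
Proof.
move=> tp; have [sp [K [cK _] K0]] := tp.
have [M M0 pM] := tfun_bounded (tfun_partial i tp).
have H := (is_derive_lineP (average psi) y (delta_mx 0 i) 0 (average (partial i psi) y)).2.
rewrite scale0r addr0 in H; apply: H.
pose F (s : R) z := m z * psi (y + s *: delta_mx 0 i + a z).
have dF s z : is_derive s (1 : R) (F ^~ z) (m z * partial i psi (y + s *: delta_mx 0 i + a z)).
  rewrite /F; under eq_fun do rewrite addrAC.
  rewrite addrAC; apply: is_deriveZ.
  by apply: is_derive_line_partial; exact: (sp 1%N).
have I00 : (`](-1 : R), 1[%classic : set R) 0 by rewrite /= in_itv /= ltrN10 ltr01.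
have h1 s : (`](-1 : R), 1[%classic : set R) s -> nu.-integrable setT (EFin \o F s).
  by move=> _; exact: average_integrable.
have h2 s z : (`](-1 : R), 1[%classic : set R) s -> setT z -> derivable (F ^~ z) s 1.
  by move=> _ _; have [] := dF s z.
have h3 z : 0 <= M * `|m z| by rewrite mulr_ge0// ltW.
have h4 : nu.-integrable setT (EFin \o (fun z => M * `|m z|)).
  exact: (integrableZl measurableT M (integrable_norm im)).
have h5 s z : (`](-1 : R), 1[%classic : set R) s -> setT z -> `|partial1of2 F s z| <= M * `|m z|.
  move=> _ _; rewrite /partial1of2 derive1E; have [_ ->] := dF s z.
  by rewrite normrM mulrC ler_wpM2r.
have D := @derivable_under_integral R _ _ nu F setT measurableT 0 (-1) 1 I00 h1 h2 _ h3 h4 h5.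
have E := @differentiation_under_integral R _ _ nu F setT measurableT 0 (-1) 1 I00 h1 h2 _ h3 h4 h5.
split; first exact: D.
rewrite -derive1E [LHS]E; apply: eq_Rintegral => z _.
by rewrite /partial1of2 derive1E; have [_ ->] := dF 0 z; rewrite scale0r addr0.
Qed.

Lemma partial_average psi i : tfun setT psi ->
  partial i (average psi) = average (partial i psi).
Proof. by move=> tp; apply/funext => y; have [_] := is_derive_average i y tp. Qed.

Lemma smooth_average psi : tfun setT psi -> smooth (average psi).
Proof.
move=> tp k; elim: k psi tp => [|k IH] psi tp; first by split => //; exact: average_continuous.
split; first exact: average_continuous.
move=> i; split; first by move=> y; have [] := is_derive_average i y tp.
by rewrite partial_average//; apply: IH; exact: tfun_partial.
Qed.

End average.

(** * Test fields, Frobenius norms and Radon norm bounds *)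

Section test_fields.
Context {R : realType} {d : nat}.
Local Notation Rd := 'rV[R]_d.
Local Notation mu := (@lebesgue_rV R d).
Implicit Types (Omega : set Rd).

Lemma tfun0 Omega : tfun Omega (cst 0).
Proof.
split; first exact: smooth_cst.
by exists set0 => //; split => //; exact: compact0.
Qed.

Lemma tfunD Omega f g : tfun Omega f -> tfun Omega g -> tfun Omega (fun x => f x + g x).
Proof.
move=> [sf [K [cK KO] K0]] [sg [L [cL LO] L0]]; split; first exact: smoothD.
exists (K `|` L); first by split; [exact: compactU|rewrite subUset].
move=> x /not_orP[Kx Lx]; by rewrite K0// L0// addr0.
Qed.

Lemma tfun_sum Omega I (s : seq I) (F : I -> Rd -> R) : (forall i, tfun Omega (F i)) ->
  tfun Omega (fun x => \sum_(i <- s) F i x).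
Proof.
move=> tF; elim: s => [|i s IH].
  rewrite (_ : (fun x => _) = cst 0); first exact: tfun0.
  by apply/funext => x; rewrite big_nil.
rewrite (_ : (fun x => _) = (fun x => F i x + \sum_(i <- s) F i x)).
  exact: tfunD.
by apply/funext => x; rewrite big_cons.
Qed.

Lemma tfunZ Omega c f : tfun Omega f -> tfun Omega (fun x => c * f x).
Proof. by move=> tf; apply: tfunM => //; exact: smooth_cst. Qed.

Lemma test_field_tfun p q (X : set 'M[R]_(p, q)) Omega phi i j :
  test_field X Omega phi -> tfun Omega (fun x => phi x i j).
Proof.
move=> [_ sphi cphi phiO]; split; first exact: sphi.
exists (closure [set x | phi x != 0]) => // x nx.
have /negP : ~ (phi x != 0) by move=> px; apply: nx; exact: subset_closure.
by rewrite negbK => /eqP ->; rewrite mxE.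
Qed.

Lemma tfun_test_field p q (X : set 'M[R]_(p, q)) Omega phi :
  (forall x, X (phi x)) -> (forall i j, tfun Omega (fun x => phi x i j)) ->
  test_field X Omega phi.
Proof.
move=> Xphi tphi.
have /choice[K HK] : forall ij : 'I_p * 'I_q, exists K : set Rd,
    [/\ compact K, K `<=` Omega & forall x, ~ K x -> phi x ij.1 ij.2 = 0].
  by move=> [i j]; have [_ [K [? ?] ?]] := tphi i j; exists K.
pose L := \big[setU/set0]_(ij : 'I_p * 'I_q) K ij.
have cL : compact L by apply: bigsetU_compact => ij _; have [] := HK ij.
have sL : [set x | phi x != 0] `<=` L.
  move=> x /= px; apply: contrapT => Lx; move/negP : px; apply; apply/eqP.
  apply/matrixP => i j; rewrite mxE; have [_ _ ->//] := HK (i, j).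
  by move=> Kx; apply: Lx; rewrite /L -bigcup_seq; exists (i, j) => //=; rewrite mem_index_enum.
have csL : closure [set x | phi x != 0] `<=` L.
  rewrite (closure_id L).1; last exact: compact_rV_closed.
  exact: closure_subset.
split => //.
- by move=> i j; have [] := tphi i j.
- apply: (subclosed_compact _ cL csL); exact: closed_closure.
- apply: subset_trans csL _; rewrite /L -bigcup_seq => x [ij _ Kx].
  by have [_ KO _] := HK ij; exact: KO.
Qed.

Lemma test_fieldZ p q (X : set 'M[R]_(p, q)) Omega phi k :
  (forall A (k : R), X A -> X (k *: A)) -> test_field X Omega phi ->
  test_field X Omega (fun x => k *: phi x).
Proof.
move=> XZ tphi; apply: tfun_test_field => [x|i j]; first by apply: XZ; have [] := tphi.
under eq_fun do rewrite mxE.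
exact: (tfunZ k (test_field_tfun i j tphi)).
Qed.

Lemma fnorm_ge0 p q (A : 'M[R]_(p, q)) : 0 <= fnorm A.
Proof. exact: sqrtr_ge0. Qed.

Lemma inner_ge0 p q (A : 'M[R]_(p, q)) : 0 <= inner A A.
Proof. by apply: sumr_ge0 => i _; apply: sumr_ge0 => j _; rewrite -expr2 sqr_ge0. Qed.

Lemma inner_pair p q (A B : 'M[R]_(p, q)) :
  inner A B = \sum_(ij : 'I_p * 'I_q) A ij.1 ij.2 * B ij.1 ij.2.
Proof. by rewrite /inner pair_bigA. Qed.

(** The constant is crude, p q in place of its square root; later estimates only track the
    dependence on s. *)
Lemma fnorm_le p q (A : 'M[R]_(p, q)) (s : R) : (forall i j, `|A i j| <= s) ->
  fnorm A <= (p * q)%:R * s.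
Proof.
move=> As; have [pq0|pq0] := posnP (p * q).
  rewrite pq0 mul0r /fnorm inner_pair big1 ?sqrtr0// => -[i j] _.
  suff : (0 < p * q)%N by rewrite pq0.
  by rewrite muln_gt0 (leq_ltn_trans _ (ltn_ord i))// (leq_ltn_trans _ (ltn_ord j)).
have s0 : 0 <= s.
  case: p q A As pq0 => [|p] [|q] A As; rewrite ?mul0n ?muln0// => _.
  exact: le_trans (normr_ge0 _) (As 0 0).
rewrite /fnorm -(ger0_norm (mulr_ge0 (ler0n _ _) s0)) -sqrtr_sqr ler_sqrt ?sqr_ge0//.
rewrite inner_pair (le_trans (y := \sum_(ij : 'I_p * 'I_q) s ^+ 2))//.
  apply: ler_sum => ij _; rewrite -expr2 -real_normK ?num_real//.
  by rewrite lerXn2r ?nnegrE// As.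
rewrite sumr_const card_prod !card_ord -(mulr_natl (s ^+ 2)) exprMn ler_wpM2r ?sqr_ge0//.
by rewrite -natrX ler_nat expnS expn1 leq_pmulr.
Qed.

Lemma fnorm_ge_entry p q (A : 'M[R]_(p, q)) i j : `|A i j| <= fnorm A.
Proof.
rewrite /fnorm -sqrtr_sqr ler_sqrt ?inner_ge0//.
rewrite inner_pair (bigD1 (i, j))//= expr2 lerDl.
by apply: sumr_ge0 => ij _; rewrite -expr2 sqr_ge0.
Qed.

Lemma normr_inner_le p q (A B : 'M[R]_(p, q)) (s : R) : (forall i j, `|B i j| <= s) ->
  `|inner A B| <= (\sum_i \sum_j `|A i j|) * s.
Proof.
move=> Bs; rewrite /inner (le_trans (ler_norm_sum _ _ _))// mulr_suml.
apply: ler_sum => i _; rewrite (le_trans (ler_norm_sum _ _ _))// mulr_suml.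
by apply: ler_sum => j _; rewrite normrM ler_wpM2l.
Qed.

Lemma innerDr p q (A B C : 'M[R]_(p, q)) : inner A (B + C) = inner A B + inner A C.
Proof.
rewrite /inner -big_split; apply: eq_bigr => i _; rewrite -big_split.
by apply: eq_bigr => j _; rewrite mxE mulrDr.
Qed.

Lemma innerZr p q (A B : 'M[R]_(p, q)) (k : R) : inner A (k *: B) = k * inner A B.
Proof.
rewrite /inner mulr_sumr; apply: eq_bigr => i _; rewrite mulr_sumr.
by apply: eq_bigr => j _; rewrite mxE mulrCA.
Qed.

Lemma innerC p q (A B : 'M[R]_(p, q)) : inner A B = inner B A.
Proof. by apply: eq_bigr => i _; apply: eq_bigr => j _; rewrite mulrC. Qed.

Lemma innerNr p q (A B : 'M[R]_(p, q)) : inner A (- B) = - inner A B.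
Proof. by rewrite -scaleN1r innerZr mulN1r. Qed.

Lemma radon_norm_ge p q (X : set 'M[R]_(p, q)) Omega T phi :
  test_field X Omega phi -> (forall x, fnorm (phi x) <= 1) ->
  ((T phi)%:E <= radon_norm X Omega T)%E.
Proof.
move=> tphi phi1; apply: ereal_sup_ubound; exists phi => //; split => //.
by apply: ge_ereal_sup => _ [x _ <-]; rewrite lee_fin.
Qed.

(** The definition tests only fields of norm at most 1, so phi is divided by its bound; k = 1 and k
    = -1 give the absolute value. Homogeneity at phi is a hypothesis because a [distrib] is an
    arbitrary function. *)
Lemma radon_norm_bound p q (X : set 'M[R]_(p, q)) Omega T phi (C s : R) :
  (radon_norm X Omega T <= C%:E)%E -> (forall A (k : R), X A -> X (k *: A)) ->
  (forall k, T (fun x => k *: phi x) = k * T phi) ->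
  test_field X Omega phi -> 0 <= s -> (forall x, fnorm (phi x) <= s) ->
  `|T phi| <= C * s.
Proof.
move=> TC XZ Tk tphi s0 phis.
have C0 : 0 <= C.
  rewrite -lee_fin (le_trans _ TC)//.
  rewrite (_ : 0 = T (fun x => 0 *: phi x)); last by rewrite Tk mul0r.
  apply: radon_norm_ge.
    exact: test_fieldZ.
  by move=> x; rewrite scale0r /fnorm inner_pair big1 ?sqrtr0// => ij _; rewrite mxE mul0r.
have H (s' : R) (k : R) : 0 < s' -> s <= s' -> `|k| = 1 -> k * T phi <= C * s'.
  move=> s'0 ss' k1; rewrite -ler_pdivrMr// mulrAC.
  have -> : k / s' * T phi = T (fun x => (k / s') *: phi x) by rewrite Tk.
  rewrite -lee_fin (le_trans _ TC)//; apply: radon_norm_ge.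
    exact: test_fieldZ.
  move=> x; rewrite /fnorm innerZr innerC innerZr mulrA -expr2.
  rewrite sqrtrM ?sqr_ge0// sqrtr_sqr normrM k1 mul1r normfV gtr0_norm//.
  by rewrite mulrC ler_pdivrMr// mul1r (le_trans (phis x)).
(* s may be 0, so the division is by a slightly larger s', whose surplus costs at most e. *)
apply/ler_addgt0Pl => e e0; pose s' := s + e / (C + 1).
have C10 : 0 < C + 1 by rewrite ltr_wpDl.
have es : 0 < e / (C + 1) by rewrite divr_gt0.
have s'0 : 0 < s' by rewrite /s' ltr_wpDl.
apply: (@le_trans _ _ (C * s')).
  rewrite ler_norml; apply/andP; split; last first.
    by rewrite -[T phi]mul1r; apply: H => //; [rewrite lerDl ltW|exact: normr1].
  by rewrite lerNl -mulN1r; apply: H => //; [rewrite lerDl ltW|exact: normrN1].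
rewrite /s' mulrDr addrC lerD2r mulrCA ler_piMr// ?(ltW e0)// ler_pdivrMr// mul1r.
by rewrite lerDl.
Qed.

End test_fields.

(** * Bounds for pairings of w from the two parts of the energy *)

Section dual_bounds.
Context {R : realType} {d : nat}.
Local Notation Rd := 'rV[R]_d.
Local Notation mu := (@lebesgue_rV R d).
Variables (Omega : set Rd).
Hypothesis oO : open Omega.
Let mO : measurable Omega := open_measurable_rV oO.

Lemma L1_mul (u psi : Rd -> R) : L1 Omega u -> tfun setT psi ->
  mu.-integrable Omega (EFin \o (fun x => u x * psi x)).
Proof.
move=> iu tp; have [M M0 pM] := tfun_bounded tp.
under eq_fun do rewrite mulrC.
apply: (@integrable_bddM _ _ _ mu _ mO psi u M) => //.
apply: measurable_funTS; apply: continuous_measurable_rV.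
exact: (tfun_continuous tp).
Qed.

Lemma L1_inner p q (w phi : Rd -> 'M[R]_(p, q)) : L1_field Omega w ->
  (forall i j, tfun setT (fun x => phi x i j)) ->
  mu.-integrable Omega (EFin \o (fun x => inner (w x) (phi x))).
Proof.
move=> iw tphi; rewrite (_ : _ \o _ = (fun x => \sum_i (fun y => \sum_j (w y i j * phi y i j)%:E)%E x)%E).
  apply: (integrable_sum mO) => i _.
  apply: (integrable_sum mO) => j _.
  exact: (L1_mul (iw i j) (tphi i j)).
by apply/funext => x /=; rewrite /inner -sumEFin; apply: eq_bigr => i _; rewrite -sumEFin.
Qed.

Lemma partialZ i (k : R) (f : Rd -> R) : smooth f ->
  partial i (fun x => k * f x) = (fun x => k * partial i f x).
Proof.
move=> sf; rewrite (_ : (fun x => k * f x) = k *: f)//; apply/funext => x.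
by apply: deriveZ; exact: smooth_derivable.
Qed.

Lemma vec_divZ (k : R) (phi : Rd -> Rd) x : (forall i, smooth (fun y => phi y 0 i)) ->
  vec_div (fun y => k *: phi y) x = k * vec_div phi x.
Proof.
move=> sphi; rewrite /vec_div mulr_sumr; apply: eq_bigr => i _.
have -> : (fun y => (k *: phi y) 0 i) = (fun y => k * phi y 0 i).
  by apply/funext => y; rewrite mxE.
by rewrite partialZ.
Qed.

Lemma mat_divZ (k : R) (phi : Rd -> 'M[R]_d) x : (forall i j, smooth (fun y => phi y i j)) ->
  mat_div (fun y => k *: phi y) x = k *: mat_div phi x.
Proof.
move=> sphi; apply/rowP => i; rewrite !mxE mulr_sumr; apply: eq_bigr => j _.
have -> : (fun y => (k *: phi y) i j) = (fun y => k * phi y i j).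
  by apply/funext => y; rewrite mxE.
by rewrite partialZ.
Qed.

Lemma tfun_vec_div (phi : Rd -> Rd) : test_field vec_space Omega phi -> tfun Omega (vec_div phi).
Proof.
move=> tphi; apply: tfun_sum => i; apply: tfun_partial.
exact: (test_field_tfun 0 i tphi).
Qed.

Lemma tfun_mat_div (phi : Rd -> 'M[R]_d) i : test_field sym_space Omega phi ->
  tfun Omega (fun x => mat_div phi x 0 i).
Proof.
move=> tphi; under eq_fun do rewrite mxE; apply: tfun_sum => j; apply: tfun_partial.
exact: (test_field_tfun i j tphi).
Qed.

Lemma tfunN (f : Rd -> R) : tfun Omega f -> tfun Omega (fun x => - f x).
Proof.
move=> tf; have := tfunZ (-1) tf.
by rewrite (_ : (fun x => -1 * f x) = (fun x => - f x))//; apply/funext => x; rewrite mulN1r.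
Qed.

Lemma weak_gradZ u (phi : Rd -> Rd) k : L1 Omega u -> test_field vec_space Omega phi ->
  weak_grad Omega u (fun x => k *: phi x) = k * weak_grad Omega u phi.
Proof.
move=> iu tphi; rewrite /weak_grad -RintegralZl//; last first.
  apply: (L1_mul iu); apply: (tfunS (@subsetT _ Omega)).
  by apply: tfunN; exact: tfun_vec_div.
apply: eq_Rintegral => x _; rewrite vec_divZ; last by move=> i; have [] := test_field_tfun 0 i tphi.
by rewrite -mulrN mulrCA.
Qed.

Lemma dist_ofZ p q (X : set 'M[R]_(p, q)) (w phi : Rd -> 'M[R]_(p, q)) k :
  L1_field Omega w -> test_field X Omega phi ->
  dist_of Omega w (fun x => k *: phi x) = k * dist_of Omega w phi.
Proof.
move=> iw tphi; rewrite /dist_of -RintegralZl//.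
  by apply: eq_Rintegral => x _; rewrite innerZr.
apply: L1_inner => // i j; apply: (tfunS (@subsetT _ Omega)).
exact: (test_field_tfun i j tphi).
Qed.

Lemma sym_gradZ (w : Rd -> Rd) phi k : L1_field Omega w -> test_field sym_space Omega phi ->
  sym_grad Omega w (fun x => k *: phi x) = k * sym_grad Omega w phi.
Proof.
move=> iw tphi; rewrite /sym_grad -(@dist_ofZ _ _ vec_space)//.
  rewrite /dist_of; apply: eq_Rintegral => x _; congr inner.
  by rewrite mat_divZ ?scalerN// => i j; have [] := test_field_tfun i j tphi.
apply: tfun_test_field => // i j; rewrite [i]ord1; under eq_fun do rewrite mxE.
by apply: tfunN; exact: tfun_mat_div.
Qed.

Lemma normr_RintegralM_le (u psi : Rd -> R) (s : R) : L1 Omega u ->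
  measurable_fun setT psi -> (forall x, `|psi x| <= s) ->
  `|\int[mu]_(x in Omega) (u x * psi x)| <= (\int[mu]_(x in Omega) `|u x|) * s.
Proof.
move=> iu mpsi psis.
have i1 : mu.-integrable Omega (EFin \o (fun x => u x * psi x)).
  under eq_fun do rewrite mulrC.
  by apply: (@integrable_bddM _ _ _ mu _ mO psi u s) => //; exact: measurable_funTS.
rewrite (le_trans (le_normr_Rintegral mO i1))// -RintegralZr//; last exact: integrable_norm.
apply: le_Rintegral => //; first exact: (integrable_norm i1).
  exact: (integrableZr mO s (integrable_norm iu)).
by move=> x Ox; rewrite normrM ler_wpM2l.
Qed.

(** The pairing is that of grad u minus that of grad u - w: the former is bounded through div phi
    and the L^1 norm of u, the latter by the energy. *)
Lemma vec_pairing_bound (w : Rd -> Rd) u (C s s' : R) phi :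
  L1_field Omega w -> L1 Omega u ->
  (radon_norm vec_space Omega (weak_grad Omega u - dist_of Omega w)%R <= C%:E)%E ->
  \int[mu]_(x in Omega) `|u x| <= C ->
  test_field vec_space Omega phi -> 0 <= s -> (forall x i, `|phi x 0 i| <= s) ->
  (forall x, `|vec_div phi x| <= s') ->
  `|\int[mu]_(x in Omega) inner (w x) (phi x)| <= C * (d%:R * s) + C * s'.
Proof.
move=> iw iu TC uC tphi s0 phis divs.
have tdiv := tfunS (@subsetT _ Omega) (tfun_vec_div tphi).
pose T := (weak_grad Omega u - dist_of Omega w)%R.
have TE psi : T psi = weak_grad Omega u psi - dist_of Omega w psi by [].
have H1 : `|T phi| <= C * (d%:R * s).
  apply: (radon_norm_bound TC) => //; last 2 first.
  - by rewrite mulr_ge0.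
  - move=> x; apply: le_trans (fnorm_le (s := s) _) _; last by rewrite mul1n.
    by move=> i j; rewrite [i]ord1.
  by move=> k; rewrite -/T !TE weak_gradZ// (dist_ofZ (X := vec_space))// mulrBr.
have H2 : `|weak_grad Omega u phi| <= C * s'.
  rewrite /weak_grad (le_trans (normr_RintegralM_le (s := s') iu _ _))//.
  - by apply: continuous_measurable_rV; exact: (tfun_continuous (tfunN (tfun_vec_div tphi))).
  - by move=> x; rewrite normrN.
  - by rewrite ler_wpM2r// (le_trans _ (divs 0)).
have -> : \int[mu]_(x in Omega) inner (w x) (phi x) = weak_grad Omega u phi - T phi.
  by rewrite TE opprB subrKC.
by rewrite (le_trans (ler_normB _ _))// addrC lerD.
Qed.

(** Same splitting for the symmetrized derivative: the pairing of w with div phi is that of c u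
    minus that of E w + c u with phi, so only sup norms of phi appear. *)
Lemma mat_pairing_bound (w : Rd -> Rd) u (c : 'M[R]_d) (C s : R) phi :
  L1_field Omega w -> L1 Omega u ->
  (radon_norm sym_space Omega
    (sym_grad Omega w + dist_of Omega (fun x => u x *: c))%R <= C%:E)%E ->
  \int[mu]_(x in Omega) `|u x| <= C ->
  test_field sym_space Omega phi -> 0 <= s -> (forall x i j, `|phi x i j| <= s) ->
  `|\int[mu]_(x in Omega) inner (w x) (mat_div phi x)| <=
    C * ((d * d)%:R * s) + C * ((\sum_i \sum_j `|c i j|) * s).
Proof.
move=> iw iu TC uC tphi s0 phis.
pose T := (sym_grad Omega w + dist_of Omega (fun x => u x *: c))%R.
have TE psi : T psi = sym_grad Omega w psi + dist_of Omega (fun x => u x *: c) psi by [].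
have iuc : L1_field Omega (fun x => u x *: c).
  move=> i j; rewrite /L1 (_ : _ \o _ = (fun x => (u x)%:E * (c i j)%:E)%E); last first.
    by apply/funext => x /=; rewrite mxE.
  exact: (integrableZr mO (c i j) iu).
have tij i j := tfunS (@subsetT _ Omega) (test_field_tfun i j tphi).
have H1 : `|T phi| <= C * ((d * d)%:R * s).
  apply: (radon_norm_bound TC) => //; last 2 first.
  - by rewrite mulr_ge0.
  - by move=> x; exact: fnorm_le.
  - by move=> A k; rewrite /sym_space /= linearZ /= => ->.
  by move=> k; rewrite -/T !TE sym_gradZ// (dist_ofZ (X := sym_space))// mulrDr.
have H2 : `|dist_of Omega (fun x => u x *: c) phi| <= C * ((\sum_i \sum_j `|c i j|) * s).
  rewrite /dist_of (_ : \int[_]_(_ in _) _ = \int[mu]_(x in Omega) (u x * inner c (phi x))); last first.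
    by apply: eq_Rintegral => x _; rewrite innerC innerZr innerC.
  rewrite (le_trans (normr_RintegralM_le (s := (\sum_i \sum_j `|c i j|) * s) iu _ _))//.
  - apply: continuous_measurable_rV.
    rewrite /inner; apply: (tfun_continuous (Omega := setT)).
    by apply: tfun_sum => i; apply: tfun_sum => j; exact: tfunZ.
  - by move=> x; exact: normr_inner_le.
  - by rewrite ler_wpM2r// mulr_ge0// sumr_ge0// => i _; exact: sumr_ge0.
have -> : \int[mu]_(x in Omega) inner (w x) (mat_div phi x) = dist_of Omega (fun x => u x *: c) phi - T phi.
  rewrite TE opprD addrCA subrr addr0 /sym_grad /dist_of -[LHS]opprK; congr -%R.
  rewrite -mulN1r -RintegralZl//.
    by apply: eq_Rintegral => x _; rewrite mulN1r innerNr.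
  apply: L1_inner => // i j; rewrite [i]ord1; apply: (tfunS (@subsetT _ Omega)).
  exact: tfun_mat_div.
by rewrite (le_trans (ler_normB _ _))// addrC lerD.
Qed.

End dual_bounds.

(** * Rescaled functions and kernels with prescribed first moments *)

Section affine_smooth.
Context {R : realType} {d : nat}.
Local Notation Rd := 'rV[R]_d.
Local Notation mu := (@lebesgue_rV R d).

Lemma affine_continuous (c : Rd) (t : R) : continuous (fun y : Rd => c + t *: y).
Proof.
by move=> x; exact: (cvgD (cvg_cst c) (cvgZ (cvg_cst t) (@cvg_id _ (nbhs x)))).
Qed.

Lemma is_derive_affine_rV (f : Rd -> R) (c : Rd) (t : R) i (y : Rd) : Ck 1 f ->
  is_derive y (delta_mx 0 i : Rd) (fun y => f (c + t *: y)) (t * partial i f (c + t *: y)).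
Proof.
move=> Cf.
have H := (is_derive_lineP (fun y => f (c + t *: y)) y (delta_mx 0 i) 0 (t * partial i f (c + t *: y))).2.
rewrite scale0r addr0 in H; apply: H.
rewrite (_ : (fun s => _) = (fun s => f (c + t *: y + s *: delta_mx 0 i)) \o (fun s => 0 + s * t)).
  rewrite [X in is_derive _ _ _ X]mulrC; apply: is_derive1_comp; last exact: is_derive_affine.
  have := is_derive_line_partial i (c + t *: y) (0 + 0 * t) Cf.
  by rewrite mul0r addr0 scale0r addr0.
by apply/funext => s /=; rewrite add0r scalerDr addrA scalerA mulrC.
Qed.

Lemma partial_affine (f : Rd -> R) (c : Rd) (t : R) i : Ck 1 f ->
  partial i (fun y => f (c + t *: y)) = (fun y => t * partial i f (c + t *: y)).
Proof. by move=> Cf; apply/funext => y; have [] := is_derive_affine_rV c t i y Cf. Qed.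

Lemma smooth_affine (f : Rd -> R) (c : Rd) (t : R) : smooth f -> smooth (fun y => f (c + t *: y)).
Proof.
move=> sf k; elim: k f sf => [|k IH] f sf.
  split => // x; apply: continuous_comp; first exact: affine_continuous.
  exact: smooth_continuous.
split=> [x|i].
  apply: continuous_comp; first exact: affine_continuous.
  exact: smooth_continuous.
rewrite partial_affine//; split.
  by move=> x; have [] := is_derive_affine_rV c t i x (sf 1%N).
by apply: CkM; [exact: smooth_cst|apply: IH; exact: smooth_partial].
Qed.

Lemma is_derive_coord (i a : 'I_d) (y : Rd) :
  is_derive y (delta_mx 0 i : Rd) (fun y : Rd => y 0 a) (a == i)%:R.
Proof.
have H := (is_derive_lineP (fun y : Rd => y 0 a) y (delta_mx 0 i) 0 (a == i)%:R).2.
rewrite scale0r addr0 in H; apply: H.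
rewrite (_ : (fun s => _) = (fun s => y 0 a + s * (a == i)%:R)); first exact: is_derive_affine.
by apply/funext => s; rewrite !mxE eqxx.
Qed.

Lemma partial_coord (i a : 'I_d) : partial i (fun y : Rd => y 0 a) = cst (a == i)%:R.
Proof. by apply/funext => y; have [] := is_derive_coord i a y. Qed.

Lemma smooth_coord (a : 'I_d) : smooth (fun y : Rd => y 0 a).
Proof.
move=> [|k]; split => //; try exact: coord_continuous.
move=> i; rewrite partial_coord; split; last exact: smooth_cst.
by move=> x; have [] := is_derive_coord i a x.
Qed.

Lemma lebesgue_cbox_gt0 (c : Rd) (r : R) : 0 < r -> (0 < lebesgue_rV d (cbox c r))%E.
Proof.
move=> r0; rewrite cboxE (lebesgue_rV_box (A := fun i => `[c 0 i - r, c 0 i + r]%classic)); last first.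
  by move=> i; exact: measurable_itv.
elim/big_ind : _ => // [a b|i _]; first exact: mule_gt0.
by rewrite lebesgue_measure_itv /= lte_fin ifT -?EFinB ?lte_fin; lra.
Qed.

(** By continuity f is at least half of f(c) on a box, which has positive measure. *)
Lemma Rintegral_gt0 (f : Rd -> R) (c : Rd) : mu.-integrable setT (EFin \o f) ->
  continuous f -> (forall x, 0 <= f x) -> 0 < f c -> 0 < \int[mu]_x f x.
Proof.
move=> intf cf f0 fc.
have fc2 : 0 < f c / 2 by rewrite divr_gt0.
have [e e0 cfe] : exists2 e : R, 0 < e & cbox c e `<=` [set x | `|f c - f x| <= f c / 2].
  by apply/nbhs_cboxP; move/cvgrPdist_le : (cf c); apply.
have mB : measurable (cbox c e) by apply: closed_measurable_rV; exact: cbox_closed.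
have iB := integrable_indic_fin mB (lebesgue_cbox_fin c e).
apply: (@lt_le_trans _ _ (\int[mu]_x (f c / 2 * \1_(cbox c e) x))).
  rewrite RintegralZl// mulr_gt0// /Rintegral integral_indic// setIT fine_gt0//.
  by rewrite lebesgue_cbox_gt0// lebesgue_cbox_fin.
apply: le_Rintegral => //; first exact: (integrableZl measurableT (f c / 2) iB).
move=> x _; rewrite indicE; have [|] := boolP (x \in cbox c e); last by rewrite mulr0.
by move=> /set_mem/cfe /=; rewrite mulr1 ler_distlC => /andP[h1 h2]; lra.
Qed.

Lemma tfun_obump c r m : 0 <= m -> tfun setT (obump c r m : Rd -> R).
Proof.
move=> m0; split; first exact: smooth_obump.
exists (cbox c r); first by split => //; exact: cbox_compact.
by move=> x nx; apply: obump_eq0 => // /subset_obox_cbox.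
Qed.

(** k is minus the i-th derivative of a bump divided by the integral of the bump; integrating x_a
    against it by parts leaves the Kronecker delta. *)
Lemma kernel_exists (xi : Rd) (r : R) (i : 'I_d) : 0 < r ->
  exists k : Rd -> R, [/\ tfun setT k, forall x, ~ cbox xi r x -> k x = 0 &
    forall a, \int[mu]_x (k x * x 0 a) = (a == i)%:R].
Proof.
move=> r0; pose rho : Rd -> R := obump xi r 1.
have trho : tfun setT rho by apply: tfun_obump.
have srho : smooth rho by case: trho.
have rho0 x : ~ cbox xi r x -> rho x = 0.
  by move=> nx; apply: obump_eq0 => // /subset_obox_cbox.
pose I := \int[mu]_x rho x.
have I0 : 0 < I.
  apply: (Rintegral_gt0 (c := xi) (tfun_integrable trho)).
  - exact: tfun_continuous trho.
  - exact: obump_ge0.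
  - by apply: obump_gt0 => // j; rewrite subrr normr0.
have tk := tfunZ (- I^-1) (tfun_partial i trho).
exists (fun x => - I^-1 * partial i rho x); split => //.
- by move=> x nx; rewrite (partial_out i (cbox_compact (r:=r)) rho0 nx) mulr0.
move=> a.
have tm : tfun setT (fun x : Rd => x 0 a * rho x) by apply: tfunM => //; exact: smooth_coord.
have := Rintegral_partial i (tm.1 1%N) (cbox_compact (c := xi) (r := r)).
have H0 x : ~ cbox xi r x -> x 0 a * rho x = 0 by move=> /rho0 ->; rewrite mulr0.
move=> /(_ H0).
rewrite partialM; last 2 first.
- by move=> x; apply: smooth_derivable; exact: smooth_coord.
- by move=> x; exact: smooth_derivable.
rewrite partial_coord RintegralD//; last 2 first.
- exact: (tfun_integrable (tfunM (smooth_coord a) (tfun_partial i trho))).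
- under eq_fun do rewrite mulrC.
  exact: (tfun_integrable (tfunZ _ trho)).
rewrite RintegralZr//; last exact: tfun_integrable trho.
move=> /eqP; rewrite addr_eq0 => /eqP H.
rewrite (_ : \int[mu]_x _ = \int[mu]_x (- I^-1 * (x 0 a * partial i rho x))); last first.
  by apply: eq_Rintegral => x _; rewrite -mulrA [_ * x 0 a]mulrC.
rewrite RintegralZl//; last first.
  exact: (tfun_integrable (tfunM (smooth_coord a) (tfun_partial i trho))).
by rewrite H mulrNN /cst /= mulKf// gt_eqF.
Qed.

End affine_smooth.

(** * Convolution with a kernel at scale t *)

Section convolution.
Context {R : realType} {d : nat}.
Local Notation Rd := 'rV[R]_d.
Local Notation mu := (@lebesgue_rV R d).
Implicit Types (m psi : Rd -> R) (t : R).

Lemma measurable_scale_rV t : measurable_fun setT (fun x : Rd => t *: x).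
Proof.
rewrite (_ : (fun x => _) = (fun x : Rd => 0 + t *: x)); first exact: measurable_affine_rV.
by apply/funext => x; rewrite add0r.
Qed.

(** The substitution y - t x produces the factor t^-d and leaves the sup norm to the kernel, so psi
    enters through its L^1 norm. *)
Lemma convolution_bound m psi t (M : R) y : 0 < t -> tfun setT m -> tfun setT psi ->
  (forall x, `|m x| <= M) ->
  `|average mu m (fun x => - t *: x) psi y| <= M * (t ^+ d)^-1 * \int[mu]_x `|psi x|.
Proof.
move=> t0 tm tp mM.
have ia := average_integrable (tfun_integrable tm) (measurable_scale_rV (- t)) y tp.
apply: le_trans (le_normr_Rintegral measurableT ia) _.
have mpsi := continuous_measurable_rV (tfun_continuous tp).
have t0' : - t != 0 by rewrite oppr_eq0 gt_eqF.
have ms : measurable_fun setT (fun z : Rd => psi (y + - t *: z)).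
  by apply: (measurableT_comp mpsi); exact: measurable_affine_rV.
have E : (\int[mu]_x `|psi x|%:E = (t ^+ d)%:E * \int[mu]_x `|psi (y + - t *: x)|%:E)%E.
  rewrite (ge0_integral_affine_rV y t0') ?normrN ?gtr0_norm//.
  by apply/measurable_EFinP; apply: measurableT_comp mpsi.
have tn0 : 0 < t ^+ d by rewrite exprn_gt0.
have E' : (\int[mu]_x `|psi (y + - t *: x)|%:E = (t ^+ d)^-1%:E * \int[mu]_x `|psi x|%:E)%E.
  by rewrite E muleA -EFinM mulVf ?mul1e// gt_eqF.
have ip : mu.-integrable setT (EFin \o (fun x => `|psi (y + - t *: x)|)).
  apply/integrableP; split.
    by apply/measurable_EFinP; apply: measurableT_comp ms.
  under eq_integral do rewrite /= normr_id.
  rewrite E' lte_mul_pinfty// ?lee_fin ?invr_ge0 ?(ltW tn0)//.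
  by have /integrableP[] := tfun_integrable tp.
have M0 : 0 <= M by rewrite (le_trans _ (mM 0)).
apply: (@le_trans _ _ (\int[mu]_x (M * `|psi (y + - t *: x)|))).
  apply: le_Rintegral => //.
  - exact: (integrable_norm ia).
  - exact: (integrableZl measurableT M ip).
  - by move=> x _; rewrite normrM ler_wpM2r.
rewrite RintegralZl// -mulrA ler_wpM2l// /Rintegral E' fineM//.
by apply: integrable_fin_num => //; exact: (integrable_norm (tfun_integrable tp)).
Qed.

(** Integration by parts moves the derivative to the kernel at the price 1/t. This is what bounds
    div P by the L^1 norm of psi, with no derivative of psi. *)
Lemma convolution_partial m psi t i y : 0 < t -> tfun setT m -> tfun setT psi ->
  average mu m (fun x => - t *: x) (partial i psi) y =
  t^-1 * average mu (partial i m) (fun x => - t *: x) psi y.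
Proof.
move=> t0 tm tp; rewrite /average.
have sa : smooth (fun x => psi (y + - t *: x)) by apply: smooth_affine; case: tp.
have tf : tfun setT (fun x => psi (y + - t *: x) * m x) by exact: tfunM.
have [K [cK _] K0] := tm.2.
have := Rintegral_partial i (tf.1 1%N) cK.
have H0 x : ~ K x -> psi (y + - t *: x) * m x = 0 by move=> /K0 ->; rewrite mulr0.
move=> /(_ H0); rewrite partialM; last 2 first.
- by move=> x; exact: smooth_derivable.
- by move=> x; apply: smooth_derivable; case: tm.
rewrite partial_affine; last exact: (tp.1 1%N).
have i1 : mu.-integrable setT (EFin \o (fun x => psi (y + - t *: x) * partial i m x)).
  exact: (tfun_integrable (tfunM sa (tfun_partial i tm))).
have i2 : mu.-integrable setT (EFin \o (fun x => m x * partial i psi (y + - t *: x))).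
  under eq_fun do rewrite mulrC.
  apply: (tfun_integrable (Omega := setT)); apply: tfunM => //.
  by apply: smooth_affine; apply: smooth_partial; case: tp.
have i3 : mu.-integrable setT (EFin \o (fun x => m x * (- t * partial i psi (y + - t *: x)))).
  rewrite (_ : (fun x => _) = (fun x => - t * (m x * partial i psi (y + - t *: x)))).
    exact: (integrableZl measurableT (- t) i2).
  by apply/funext => x; rewrite mulrCA.
rewrite RintegralD// => /eqP; rewrite addr_eq0 => /eqP H.
rewrite (_ : \int[mu]_z (partial i m z * psi _) = \int[mu]_x (psi (y + - t *: x) * partial i m x)).
  rewrite H (_ : \int[mu]_x (m x * (- t * _)) =
    - t * \int[mu]_x (m x * partial i psi (y + - t *: x))).
    by rewrite mulNr opprK mulKf// gt_eqF.
  by rewrite -RintegralZl//; apply: eq_Rintegral => x _; rewrite mulrCA.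
by apply: eq_Rintegral => x _; rewrite mulrC.
Qed.

End convolution.

(** * Finite sums and tensor products of integrable functions *)

Lemma integrable_prod d1 d2 (T1 : measurableType d1) (T2 : measurableType d2) (R : realType)
    (m1 : {sigma_finite_measure set T1 -> \bar R}) (m2 : {sigma_finite_measure set T2 -> \bar R})
    (f : T1 -> R) (g : T2 -> R) :
  m1.-integrable setT (EFin \o f) -> m2.-integrable setT (EFin \o g) ->
  (m1 \x m2)%E.-integrable setT (EFin \o (fun z => f z.1 * g z.2)).
Proof.
move=> iif iig.
have mf : measurable_fun setT f by apply/measurable_EFinP; exact: measurable_int iif.
have mg : measurable_fun setT g by apply/measurable_EFinP; exact: measurable_int iig.
apply/integrable12ltyP.
  apply/measurable_EFinP; apply: measurable_funM.
    by apply: (measurableT_comp mf); exact: measurable_fst.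
  by apply: (measurableT_comp mg); exact: measurable_snd.
have [_ fo] := integrableP _ _ _ iif; have [_ go] := integrableP _ _ _ iig.
rewrite (_ : (\int[m1]_x _)%E = (\int[m1]_x (`|(f x)%:E| * (\int[m2]_y `|(g y)%:E|)))%E).
  have gfin : (\int[m2]_y `|(g y)%:E|)%E \is a fin_num by rewrite ge0_fin_numE ?integral_ge0.
  rewrite -(fineK gfin) ge0_integralZr//.
  - by rewrite muleC lte_mul_pinfty// lee_fin fine_ge0// integral_ge0.
  - by apply: measurableT_comp => //; exact/measurable_EFinP.
  - by rewrite lee_fin fine_ge0// integral_ge0.
apply: eq_integral => x _; rewrite -ge0_integralZl//.
- by apply: eq_integral => y _; rewrite /= normrM EFinM.
- by apply: measurableT_comp => //; exact/measurable_EFinP.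
Qed.

Lemma integrable_sumr d (T : measurableType d) (R : realType) (mu : {measure set T -> \bar R})
    (D : set T) I (s : seq I) (F : I -> T -> R) : measurable D ->
  (forall i, mu.-integrable D (EFin \o F i)) ->
  mu.-integrable D (EFin \o (fun x => \sum_(i <- s) F i x)).
Proof.
move=> mD iF; rewrite (_ : _ \o _ = (fun x => \sum_(i <- s) (F i x)%:E)%E).
  by apply: (integrable_sum mD) => i _; exact: iF.
by apply/funext => x /=; rewrite sumEFin.
Qed.

Lemma Rintegral_sum d (T : measurableType d) (R : realType) (mu : {measure set T -> \bar R})
    (D : set T) I (s : seq I) (F : I -> T -> R) : measurable D ->
  (forall i, mu.-integrable D (EFin \o F i)) ->
  \int[mu]_(x in D) (\sum_(i <- s) F i x) = \sum_(i <- s) \int[mu]_(x in D) F i x.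
Proof.
move=> mD iF; elim: s => [|i s IH].
  rewrite big_nil (_ : (fun x => _) = cst 0) ?Rintegral_cst ?mul0r//.
  by apply/funext => x; rewrite big_nil.
rewrite big_cons -IH -RintegralD//; last exact: integrable_sumr.
by apply: eq_Rintegral => x _; rewrite big_cons.
Qed.

Lemma Rintegral_prod d1 d2 (T1 : measurableType d1) (T2 : measurableType d2) (R : realType)
    (m1 : {sigma_finite_measure set T1 -> \bar R}) (m2 : {sigma_finite_measure set T2 -> \bar R})
    (f : T1 -> R) (g : T2 -> R) :
  m1.-integrable setT (EFin \o f) -> m2.-integrable setT (EFin \o g) ->
  \int[(m1 \x m2)%E]_z (f z.1 * g z.2) = (\int[m1]_x f x) * (\int[m2]_y g y).
Proof.
move=> iif iig; rewrite /Rintegral -(integral12_prod_meas1 (integrable_prod iif iig)).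
rewrite (_ : (\int[m1]_x _)%E = (\int[m1]_x ((f x)%:E * \int[m2]_y (g y)%:E))%E); last first.
  by apply: eq_integral => x _; rewrite /fubini_F -integralZl.
have gfin : (\int[m2]_y (g y)%:E)%E \is a fin_num by exact: (integrable_fin_num measurableT iig).
rewrite -(fineK gfin) integralZr// fineM//.
exact: (integrable_fin_num measurableT iif).
Qed.

(** * Equi-integrability estimate under a cone condition *)

Section key_inequality.
Context {R : realType} {d : nat}.
Local Notation Rd := 'rV[R]_d.
Local Notation mu := (@lebesgue_rV R d).
Local Notation leb := (@lebesgue_measure R).
Variables (Omega Omega' : set Rd) (xi : Rd) (r : R) (i : 'I_d) (k : Rd -> R).
Hypothesis oO : open Omega.
Hypothesis cone : forall y eta (s : R), Omega' y -> cbox xi r eta -> 0 <= s <= 1 ->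
  Omega (y + s *: eta).
Hypothesis r0 : 0 < r.
Hypothesis tk : tfun setT k.
Hypothesis k0 : forall x, ~ cbox xi r x -> k x = 0.
Hypothesis kmom : forall a, \int[mu]_x (k x * x 0 a) = (a == i)%:R.

(** First and second moment densities of the kernel; [mm a b] is symmetric in a and b, and so will
    be [Phi]. *)
Let m (a : 'I_d) (x : Rd) : R := x 0 a * k x.
Let mm (a b : 'I_d) (x : Rd) : R := x 0 b * m a x.

Let tm a : tfun setT (m a).
Proof. exact: tfunM (smooth_coord a) tk. Qed.

Let tmm a b : tfun setT (mm a b).
Proof. exact: tfunM (smooth_coord b) (tm a). Qed.

Section fixed_scale.
Variables (t : R) (psi : Rd -> R).
Hypothesis t01 : 0 < t <= 1.
Hypothesis tpsi' : tfun Omega' psi.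

Let t0 : 0 < t. Proof. by case/andP: t01. Qed.
Let tpsi : tfun setT psi := tfunS (@subsetT _ Omega') tpsi'.

Let P a := average mu (m a) (fun x => - t *: x) psi.
Let Z := (measurableTypeR R * Rd)%type.
Let mZ a b (z : Z) : R := \1_(`[0%R, t]%classic : set R) z.1 * mm a b z.2.
Let aZ (z : Z) : Rd := - z.1 *: z.2.
Let nu := (leb \x mu)%E.
(* Averages of psi over the segments from y - t eta to y, so that the b-derivatives
   of mm integrate out to psi(y) - psi(y - t eta): see div_Phi. *)
Let Phi a b := average nu (mZ a b) aZ psi.

Let imZ a b : nu.-integrable setT (EFin \o mZ a b).
Proof.
apply: integrable_prod; last exact: tfun_integrable (tmm a b).
apply: integrable_indic_fin; first exact: measurable_itv.
by rewrite /= lebesgue_measure_itv /=; case: ifP => _; rewrite // -EFinB ltry.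
Qed.

Let maZ : measurable_fun setT aZ.
Proof.
apply: measurable_fun_rV => j; under eq_fun do rewrite mxE.
apply: measurable_funM.
  by apply: measurable_funN; exact: measurable_fst.
apply: (measurableT_comp (f := fun x : Rd => x 0 j : measurableTypeR R)).
  exact: measurable_coor.
exact: measurable_snd.
Qed.

(** K is what the support of psi sweeps along the segments; the cone condition puts it inside
    Omega. *)
Let smear : exists K : set Rd, [/\ compact K, K `<=` Omega &
  forall y eta (s : R), cbox xi r eta -> 0 <= s <= 1 -> ~ K y -> psi (y + - s *: eta) = 0].
Proof.
have [_ [K [cK KO] K0]] := tpsi'.
pose f (p : Rd * R * Rd) : Rd := p.1.1 + p.1.2 *: p.2.
pose B := K `*` (`[0%R, 1]%classic : set R) `*` cbox xi r.
exists (f @` B); split.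
- apply: continuous_compact; last first.
    apply: compact_setX; last exact: cbox_compact.
    by apply: compact_setX => //; exact: segment_compact.
  apply: continuous_subspaceT => p; apply: cvgD.
    by apply: continuous_comp; [exact: cvg_fst|exact: cvg_fst].
  apply: cvgZ; last exact: cvg_snd.
  by apply: continuous_comp; [exact: cvg_fst|exact: cvg_snd].
- move=> _ [[[y s] eta] [[/= Ky s01] xe] <-]; rewrite /f /=; apply: cone => //.
  exact: KO.
- move=> y eta s xe s01 nK; apply: K0 => Ky; apply: nK.
  exists (y + - s *: eta, s, eta) => //=; rewrite /f /=.
  by rewrite scaleNr subrK.
Qed.

Let tP a : tfun Omega (P a).
Proof.
have [K [cK KO K0]] := smear; split.
  by apply: smooth_average => //; [exact: tfun_integrable|exact: measurable_scale_rV].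
exists K => // y nK; rewrite /P /average.
rewrite (_ : (fun z => _) = cst 0) ?Rintegral_cst ?mul0r//.
apply/funext => x; have [xr|xr] := pselect (cbox xi r x).
  by rewrite K0 ?mulr0//; case/andP: t01 => /ltW -> ->.
by rewrite /m k0// mulr0 mul0r.
Qed.

Let tPhi a b : tfun Omega (Phi a b).
Proof.
have [K [cK KO K0]] := smear; split; first exact: smooth_average.
exists K => // y nK; rewrite /Phi /average.
rewrite (_ : (fun z => _) = cst 0) ?Rintegral_cst ?mul0r//.
apply/funext => -[s x]; rewrite /mZ /aZ /=.
have [xr|xr] := pselect (cbox xi r x); last by rewrite /mm /m k0// !mulr0 mul0r.
rewrite indicE; have [/set_mem /=|] := boolP (s \in _); last by rewrite !mul0r.
rewrite in_itv /= => /andP[s0 st]; rewrite K0 ?mulr0// s0 (le_trans st)//.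
by case/andP: t01.
Qed.

Let div_Phi a y : \sum_b partial b (Phi a b) y = (a == i)%:R * psi y - P a y.
Proof.
have ipsi b := average_integrable (imZ a b) maZ y (tfun_partial b tpsi).
have -> : \sum_b partial b (Phi a b) y = \sum_b \int[nu]_z (mZ a b z * partial b psi (y + aZ z)).
  by apply: eq_bigr => b _; rewrite partial_average.
have -> : \sum_b \int[nu]_z (mZ a b z * partial b psi (y + aZ z)) =
  \int[nu]_z (\sum_b mZ a b z * partial b psi (y + aZ z)).
  by rewrite Rintegral_sum.
have iS := integrable_sumr (index_enum 'I_d) measurableT ipsi.
(* Fubini with s innermost: for fixed x the sum over b is an exact derivative in s. *)
rewrite /Rintegral -(integral21_prod_meas1 iS).
have ia := average_integrable (tfun_integrable (tm a)) (measurable_scale_rV (- t)) y tpsi.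
have ik : mu.-integrable setT (EFin \o (fun x => k x * x 0 a)).
  by under eq_fun do rewrite mulrC; exact: tfun_integrable (tm a).
(* The moment condition on k writes the Kronecker term as an integral of [m a] times psi y. *)
have -> : (a == i)%:R * psi y - P a y = \int[mu]_x (m a x * (psi y - psi (y + - t *: x))).
  rewrite -kmom -RintegralZr//.
  rewrite -RintegralB//.
  - by apply: eq_Rintegral => x _; rewrite /m mulrBr; congr (_ * _ - _); rewrite mulrC.
  - exact: (integrableZr measurableT (psi y) ik).
rewrite /Rintegral; congr fine; apply: eq_integral => x _.
rewrite /fubini_G /mZ /aZ /=.
have C1psi : Ck 1 psi := tpsi.1 1%N.
pose g s := \sum_b (- x) 0 b * partial b psi (y + s *: - x).
have ig : leb.-integrable `[0%R, t] (EFin \o g).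
  have := @continuous_compact_integrable R g _ (@segment_compact R 0 t).
  apply; apply: continuous_subspaceT; apply: continuous_big => [|b _ s]; first exact: add_continuous.
  apply: cvgM; first exact: cvg_cst.
  by apply: continuous_along; exact: tfun_continuous (tfun_partial b tpsi).
transitivity (\int[leb]_(s in `[0%R, t]) ((- m a x)%:E * (g s)%:E))%E.
  rewrite [RHS]integral_mkcond; apply: eq_integral => s _.
  rewrite /patch indicE; case: ifPn => _; last first.
    by rewrite big1// => b _; rewrite !mul0r.
  rewrite -EFinM; congr EFin; rewrite mulr_sumr.
  apply: eq_bigr => b _; rewrite !mxE /mm scaleNr scalerN mul1r; ring.
rewrite integralZl// FTC_along// -EFinM scalerN scaleNr.
by congr EFin; ring.
Qed.

Variables (C : R) (c : 'M[R]_d) (w : Rd -> Rd) (u : Rd -> R) (M M' S : R).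
Hypothesis iw : L1_field Omega w.
Hypothesis iu : L1 Omega u.
Hypothesis gradC : (radon_norm vec_space Omega
  (weak_grad Omega u - dist_of Omega w)%R <= C%:E)%E.
Hypothesis symC : (radon_norm sym_space Omega
  (sym_grad Omega w + dist_of Omega (fun x => u x *: c))%R <= C%:E)%E.
Hypothesis uC : \int[mu]_(x in Omega) `|u x| <= C.
Hypothesis psi1 : forall x, `|psi x| <= 1.
Hypothesis mM : forall a x, `|m a x| <= M.
Hypothesis mM' : forall a x, `|partial a (m a) x| <= M'.
Hypothesis mmS : forall a b, \int[mu]_x `|mm a b x| <= S.

Let N : R := \int[mu]_x `|psi x|.
Let mO : measurable Omega := open_measurable_rV oO.

Let S0 : 0 <= S.
Proof. exact: le_trans (Rintegral_ge0 _ _) (mmS i i). Qed.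

Let N0 : 0 <= N. Proof. exact: Rintegral_ge0. Qed.

(** The factor t is the length of the segments, the source of the smallness. *)
Let Phi_le a b y : `|Phi a b y| <= t * S.
Proof.
have ia := average_integrable (imZ a b) maZ y tpsi.
apply: le_trans (le_normr_Rintegral measurableT ia) _.
apply: (@le_trans _ _ (\int[nu]_z `|mZ a b z|)).
  apply: le_Rintegral => //; [exact: (integrable_norm ia)|exact: (integrable_norm (imZ a b))|].
  by move=> z _; rewrite normrM ler_piMr.
have i1 : leb.-integrable setT (EFin \o (\1_(`[0%R, t]%classic : set R) : R -> R)).
  apply: integrable_indic_fin; first exact: measurable_itv.
  by rewrite /= lebesgue_measure_itv /=; case: ifP => _; rewrite // -EFinB ltry.
rewrite (_ : \int[nu]_z _ = \int[nu]_z (\1_(`[0%R, t]%classic : set R) z.1 * `|mm a b z.2|)); last first.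
  by apply: eq_Rintegral => z _; rewrite /mZ normrM ger0_norm.
rewrite (Rintegral_prod i1 (integrable_norm (tfun_integrable (tmm a b)))).
have -> : \int[leb]_x \1_(`[0%R, t]%classic : set R) x = t.
  have mI : measurable (`[0%R, t]%classic : set R) by exact: measurable_itv.
  by rewrite /Rintegral integral_indic// setIT /= lebesgue_measure_itv /= lte_fin t0 -EFinB /= subr0.
by apply: ler_wpM2l; [exact: ltW|exact: mmS].
Qed.

(** Splits psi e_i as V + div F. The first two terms are the cost of V and of its divergence, the
    last two that of F. *)
Lemma key_fixed_scale : `|\int[mu]_(x in Omega) (w x 0 i * psi x)| <=
  C * (d%:R * (M * (t ^+ d)^-1 * N)) + C * (d%:R * (t^-1 * (M' * (t ^+ d)^-1 * N))) +
  (C * ((d * d)%:R * (t * S)) + C * ((\sum_i \sum_j `|c i j|) * (t * S))).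
Proof.
pose V x : Rd := \row_a P a x.
pose F x : 'M[R]_d := \matrix_(a, b) Phi a b x.
have tV : test_field vec_space Omega V.
  apply: tfun_test_field => // a b; rewrite [a]ord1.
  by under eq_fun do rewrite mxE; exact: tP.
have tF : test_field sym_space Omega F.
  apply: tfun_test_field => [x|a b]; last by under eq_fun do rewrite mxE; exact: tPhi.
  apply/matrixP => a b; rewrite !mxE; congr (average _ _ _ _ _).
  by apply/funext => z; rewrite /mZ; congr (_ * _); rewrite /mm /m mulrCA.
have -> : \int[mu]_(x in Omega) (w x 0 i * psi x) =
    \int[mu]_(x in Omega) inner (w x) (V x) + \int[mu]_(x in Omega) inner (w x) (mat_div F x).
  rewrite -RintegralD//; last 2 first.
  - apply: L1_inner => // a b; apply: (tfunS (@subsetT _ Omega)).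
    exact: (test_field_tfun a b tV).
  - apply: L1_inner => // a b; apply: (tfunS (@subsetT _ Omega)).
    by rewrite [a]ord1; exact: tfun_mat_div.
  apply: eq_Rintegral => x _; rewrite -innerDr /inner big_ord1.
  have dF a : (V x + mat_div F x) 0 a = (a == i)%:R * psi x.
    have Fab b : (fun y => F y a b) = Phi a b by apply/funext => y; rewrite mxE.
    rewrite !mxE; under eq_bigr do rewrite Fab.
    by rewrite div_Phi subrKC.
  rewrite (bigD1 i)//= dF eqxx mul1r big1 ?addr0// => a ai.
  by rewrite dF (negbTE ai) mul0r mulr0.
have ti0 : 0 < t^-1 by rewrite invr_gt0.
have M0 : 0 <= M by rewrite (le_trans _ (mM i 0)).
have td0 : 0 <= (t ^+ d)^-1 by rewrite invr_ge0 exprn_ge0// ltW.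
rewrite (le_trans (ler_normD _ _))// lerD//.
- apply: (vec_pairing_bound oO iw iu gradC uC tV) => //.
  + by rewrite !mulr_ge0.
  + by move=> x a; rewrite mxE; exact: convolution_bound.
  + move=> x; rewrite /vec_div (le_trans (ler_norm_sum _ _ _))//.
    rewrite (le_trans (y := \sum_(a < d) t^-1 * (M' * (t ^+ d)^-1 * N)))//; last first.
      by rewrite sumr_const card_ord mulr_natl.
    apply: ler_sum => a _.
    have -> : (fun y => V y 0 a) = P a by apply/funext => y; rewrite mxE.
    rewrite /P partial_average//; [|exact: tfun_integrable|exact: measurable_scale_rV].
    rewrite (convolution_partial a x t0 (tm a) tpsi) normrM (ger0_norm (ltW ti0)).
    apply: (ler_wpM2l (ltW ti0)).
    exact: (convolution_bound x t0 (tfun_partial a (tm a)) tpsi (mM' a)).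
- apply: (mat_pairing_bound oO iw iu symC uC tF) => //.
  + by rewrite mulr_ge0// ltW.
  + by move=> x a b; rewrite mxE.
Qed.

End fixed_scale.

(** The contribution of F is t A, at most e once t <= e / (A + 1); the negative powers of t are
    stored in D, which does not depend on w, u or psi. *)
Lemma key_local (C e : R) (c : 'M[R]_d) : 0 <= C -> 0 < e ->
  exists2 D : R, 0 <= D & forall w u, L1_field Omega w -> L1 Omega u ->
   (radon_norm vec_space Omega (weak_grad Omega u - dist_of Omega w)%R <= C%:E)%E ->
   (radon_norm sym_space Omega
     (sym_grad Omega w + dist_of Omega (fun x => u x *: c))%R <= C%:E)%E ->
   \int[mu]_(x in Omega) `|u x| <= C ->
   forall psi, tfun Omega' psi -> (forall x, `|psi x| <= 1) ->
   `|\int[mu]_(x in Omega) (w x 0 i * psi x)| <= e + D * \int[mu]_x `|psi x|.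
Proof.
move=> C0 e0.
have /choice[M HM] a : exists M : R, 0 < M /\ forall x, `|m a x| <= M.
  by have [K K0 HK] := tfun_bounded (tm a); exists K.
have /choice[M' HM'] a : exists M : R, 0 < M /\ forall x, `|partial a (m a) x| <= M.
  by have [K K0 HK] := tfun_bounded (tfun_partial a (tm a)); exists K.
have le_sum (F : 'I_d -> R) a : (forall b, 0 <= F b) -> F a <= \sum_b F b.
  by move=> F0; rewrite (bigD1 a)//= lerDl sumr_ge0.
pose Ms := \sum_a M a; pose Ms' := \sum_a M' a.
pose S := \sum_a \sum_b \int[mu]_x `|mm a b x|.
have S0 : 0 <= S by apply: sumr_ge0 => a _; apply: sumr_ge0 => b _; exact: Rintegral_ge0.
have Ms0 : 0 <= Ms by apply: sumr_ge0 => a _; have [/ltW] := HM a.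
have Ms0' : 0 <= Ms' by apply: sumr_ge0 => a _; have [/ltW] := HM' a.
pose A := C * ((d * d)%:R * S) + C * ((\sum_i \sum_j `|c i j|) * S).
have A0 : 0 <= A.
  by rewrite addr_ge0// !mulr_ge0// sumr_ge0// => j _; exact: sumr_ge0.
(* The cone condition covers 0 <= s <= 1, hence the minimum with 1. *)
pose t := Num.min 1 (e / (A + 1)).
have A1 : 0 < A + 1 by rewrite ltr_wpDl.
have t0 : 0 < t by rewrite lt_min ltr01 divr_gt0.
have t01 : 0 < t <= 1 by rewrite t0 ge_min lexx.
exists (C * (d%:R * (Ms * (t ^+ d)^-1)) + C * (d%:R * (t^-1 * (Ms' * (t ^+ d)^-1)))).
  by rewrite addr_ge0// !mulr_ge0// invr_ge0 ?exprn_ge0// ltW.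
move=> w u iw iu gC sC uC psi tpsi psi1.
have H := @key_fixed_scale t psi t01 tpsi C c w u Ms Ms' S iw iu gC sC uC psi1.
apply: le_trans (H _ _ _) _.
- move=> a x; have [_ /(_ x) mMa] := HM a; apply: le_trans mMa _.
  by apply: le_sum => b; have [/ltW] := HM b.
- move=> a x; have [_ /(_ x) mMa] := HM' a; apply: le_trans mMa _.
  by apply: le_sum => b; have [/ltW] := HM' b.
- move=> a b; apply: (@le_trans _ _ (\sum_b \int[mu]_x `|mm a b x|)).
    by apply: (le_sum (fun b => \int[mu]_x `|mm a b x|)) => b'; exact: Rintegral_ge0.
  apply: (le_sum (fun a => \sum_b \int[mu]_x `|mm a b x|)) => a'.
  by apply: sumr_ge0 => b' _; exact: Rintegral_ge0.
rewrite addrC lerD//.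
  rewrite (_ : _ + _ = t * A); last by rewrite /A; ring.
  apply: (@le_trans _ _ (e / (A + 1) * A)).
    by rewrite ler_wpM2r// ge_min lexx orbT.
  by rewrite mulrAC ler_pdivrMr// ler_wpM2l ?lerDl// ltW.
by rewrite le_eqVlt; apply/orP; left; apply/eqP; ring.
Qed.

End key_inequality.

(** * From test functions to measurable sets *)

Section set_bound.
Context {R : realType} {d : nat}.
Local Notation Rd := 'rV[R]_d.
Local Notation mu := (@lebesgue_rV R d).

Lemma le_lebesgue_rV (A B : set Rd) : measurable A -> measurable B -> A `<=` B ->
  (mu A <= mu B)%E.
Proof. by move=> mA mB AB; apply: le_measure => //; apply/mem_set. Qed.

Lemma RintegralIl (D A : set Rd) (f : Rd -> R) : A `<=` D ->
  \int[mu]_(x in A) f x = \int[mu]_(x in D) (\1_A x * f x).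
Proof.
move=> AD; rewrite Rintegral_mkcond [RHS]Rintegral_mkcond; apply: eq_Rintegral => x _.
rewrite !patchE indicE; case: (boolP (x \in A)) => xA; last by rewrite mul0r; case: ifP.
by rewrite mul1r ifT//; apply/mem_set/AD/set_mem.
Qed.

(** The indicator of A is replaced by a test function close to it for the weight |f| + 1: the first
    summand controls the integral of f, the second the measure of A. *)
Lemma set_bound (Omega Omega' A : set Rd) (f : Rd -> R) (e D : R) :
  open Omega -> open Omega' -> Omega' `<=` Omega -> (mu Omega' < +oo)%E -> 0 <= D ->
  L1 Omega f ->
  (forall psi, tfun Omega' psi -> (forall x, `|psi x| <= 1) ->
   `|\int[mu]_(x in Omega) (f x * psi x)| <= e + D * \int[mu]_x `|psi x|) ->
  measurable A -> A `<=` Omega' ->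
  `|\int[mu]_(x in A) f x| <= e + D * fine (mu A).
Proof.
move=> oO oO' OO Ofin D0 iF H mA AO.
have mO' := open_measurable_rV oO'; have mO := open_measurable_rV oO.
have ifO' : mu.-integrable Omega' (EFin \o f) by exact: integrableS iF.
pose h x := `|f x| + 1.
have h0 x : 0 <= h x by rewrite addr_ge0.
have i1 : mu.-integrable Omega' (EFin \o (cst 1 : Rd -> R)).
  apply/integrableP; split; first exact/measurable_EFinP.
  by under eq_integral do rewrite /= normr1; rewrite integral_cst// mul1e.
have ih : mu.-integrable Omega' (EFin \o h).
  exact: (integrableD mO' (integrable_norm ifO') i1).
apply/ler_addgt0Pr => e1 e10.
(* The two errors e2 and D e2 add up to e1. *)
pose e2 := e1 / (D + 1).
have D1 : 0 < D + 1 by rewrite ltr_wpDl.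
have e20 : 0 < e2 by rewrite divr_gt0.
have [psi [tpsi psi01 I]] := density oO' h0 ih mA e20.
have psi1 x : `|psi x| <= 1 by have /andP[p0 p1] := psi01 x; rewrite ger0_norm.
have mpsi := continuous_measurable_rV (tfun_continuous tpsi).
have mdf : measurable_fun Omega' (fun x => \1_A x - psi x).
  by apply: measurable_funB; [exact: measurable_indic|exact: measurable_funTS].
have df1 x : `|\1_A x - psi x| <= 1.
  have /andP[p0 p1] := psi01 x; rewrite indicE; case: (x \in A) => /=.
    by rewrite ger0_norm; lra.
  by rewrite sub0r normrN ger0_norm; lra.
have idf : mu.-integrable Omega' (EFin \o (fun x => (\1_A x - psi x) * f x)).
  by apply: (integrable_bddM mO' mdf _ ifO') => x _; exact: df1.
have ipf : mu.-integrable Omega' (EFin \o (fun x => psi x * f x)).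
  by apply: (integrable_bddM mO' (measurable_funTS mpsi) _ ifO') => x _; exact: psi1.
have idh : mu.-integrable Omega' (EFin \o (fun x => `|\1_A x - psi x| * h x)).
  apply: (integrable_bddM mO' _ _ ih (M := 1)) => [|x _]; last by rewrite normr_id.
  exact: measurableT_comp mdf.
have E1 : \int[mu]_(x in A) f x = \int[mu]_(x in Omega') ((\1_A x - psi x) * f x) +
    \int[mu]_(x in Omega) (f x * psi x).
  rewrite (_ : \int[mu]_(x in Omega) _ = \int[mu]_(x in Omega') (psi x * f x)); last first.
    rewrite [RHS](RintegralIl _ OO); apply: eq_Rintegral => x _.
    rewrite indicE; have [xO'|xO'] := pselect (Omega' x).
      by rewrite mem_set// mul1r mulrC.
    by rewrite (tfun_out tpsi)// mulr0 mul0r mulr0.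
  rewrite -RintegralD// (RintegralIl _ AO); apply: eq_Rintegral => x _.
  by rewrite -mulrDl subrK.
have L1' : `|\int[mu]_(x in Omega') ((\1_A x - psi x) * f x)| <= e2.
  apply: le_trans (le_normr_Rintegral mO' idf) _; apply: le_trans (ltW I).
  apply: le_Rintegral => //; first exact: (integrable_norm idf).
  by move=> x _; rewrite normrM ler_wpM2l// lerDl.
have iA : mu.-integrable Omega' (EFin \o \1_A).
  apply: integrableS (integrable_indic_fin mA _) => //.
  by apply: le_lt_trans Ofin; exact: le_lebesgue_rV.
have L2 : \int[mu]_x `|psi x| <= fine (mu A) + e2.
  have -> : \int[mu]_x `|psi x| = \int[mu]_(x in Omega') `|psi x|.
    rewrite [RHS](RintegralIl _ (@subsetT _ Omega')); apply: eq_Rintegral => x _.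
    rewrite indicE; have [xO'|xO'] := pselect (Omega' x); first by rewrite mem_set// mul1r.
    by rewrite (tfun_out tpsi)// normr0 mulr0.
  have <- : \int[mu]_(x in Omega') \1_A x = fine (mu A).
    by rewrite /Rintegral integral_indic// setIidl.
  apply: le_trans (lerD (lexx _) (ltW I)).
  rewrite -RintegralD//; apply: le_Rintegral => //.
  - apply: integrableS (integrable_norm (tfun_integrable tpsi)) => //.
  - exact: (integrableD mO' iA idh).
  - move=> x _; apply: (@le_trans _ _ (\1_A x + `|\1_A x - psi x|)).
      have {1}-> : psi x = \1_A x - (\1_A x - psi x) by ring.
      by apply: le_trans (ler_normB _ _) _; rewrite lerD2r// ger0_norm.
    by rewrite lerD2l ler_peMr// lerDr.
have L3 := H psi tpsi psi1.
have L4 : D * \int[mu]_x `|psi x| <= D * (fine (mu A) + e2) by exact: ler_wpM2l.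
have L5 : e2 + D * e2 = e1.
  by rewrite /e2 -{1}[e1 / (D + 1)]mul1r -mulrDl addrC mulrC divfK// gt_eqF.
rewrite E1; apply: le_trans (ler_normD _ _) _.
rewrite -L5; move: L1' L2 L3 L4; rewrite mulrDr.
set a1 := `|_|; set a2 := `|_|; set a3 := D * \int[mu]_x _; set a4 := D * _; set a5 := D * e2.
move=> *; lra.
Qed.

End set_bound.

(** * Equi-integrability on bounded Lipschitz domains *)

Section equiintegrability.
Context {R : realType} {n : nat}.
Local Notation Rd := 'rV[R]_n.+1.
Local Notation mu := (@lebesgue_rV R n.+1).

(** The pairs (w, u) over which the estimates have to be uniform, with a single constant for both
    parts of the energy and for u. *)
Definition controlled (Omega : set Rd) (c : 'M[R]_n.+1) (C : R) (w : Rd -> Rd) (u : Rd -> R) : Prop :=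
  [/\ L1_field Omega w, L1 Omega u,
   (radon_norm vec_space Omega (weak_grad Omega u - dist_of Omega w)%R <= C%:E)%E,
   (radon_norm sym_space Omega
     (sym_grad Omega w + dist_of Omega (fun x => u x *: c))%R <= C%:E)%E &
   \int[mu]_(x in Omega) `|u x| <= C].

(** Near a boundary point, moving by s along a direction close to the graph axis raises the last
    coordinate by at least s (t - r B) and the graph by at most s |L| n r B. At interior points
    small displacements in every direction work, so xi = 0. *)
Lemma lipschitz_cone (Omega : set Rd) x : open Omega -> lipschitz_boundary Omega ->
  closure Omega x -> exists (rho r : R) (xi : Rd), [/\ 0 < rho, 0 < r &
    forall y eta (s : R), Omega y -> obox x rho y -> cbox xi r eta -> 0 <= s <= 1 ->
      Omega (y + s *: eta)].
Proof.
move=> oO lip clx; have [Ox|nOx] := pselect (Omega x).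
  have /nbhs_cboxP[e e0 eO] : nbhs x Omega by exact: open_nbhs_nbhs.
  exists (e / 2), (e / 2), 0; split; rewrite ?divr_gt0// => y eta s _ yx etar /andP[s0 s1].
  apply: eO => i; rewrite !mxE addrAC (le_trans (ler_normD _ _))//.
  have h1 := yx i; have h2 := etar i; rewrite mxE subr0 in h2.
  rewrite [leRHS](splitr e); apply: lerD; first exact: ltW.
  by rewrite normrM ger0_norm//; apply: le_trans h2; rewrite ler_piMl.
have [|Q [gamma [U [QQ [L gL] /nbhs_cboxP[e e0 eU] UO]]]] := lip x.
  by split => // /interior_subset.
have QQ' : Q^T *m Q = 1%:M by exact: mulmx1C.
(* Bounds every entry of Q and every column sum of absolute values. *)
pose B := \sum_a \sum_b `|Q a b|.
have QB a b : `|Q a b| <= B.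
  rewrite /B (bigD1 a)//= (bigD1 b)//= -addrA lerDl addr_ge0// sumr_ge0// => i _.
  by rewrite sumr_ge0.
have B0 : 0 <= B := le_trans (normr_ge0 _) (QB 0 0).
pose K := `|L| * n%:R + 1.
have K1 : 1 <= K by rewrite lerDr mulr_ge0.
(* t (B + 1) = e / 4 keeps the displaced point in the chart box; r K (B + 1) = t makes the slope
   loss at most the gain t. *)
pose t := e / (4 * (B + 1)); pose r := t / (K * (B + 1)).
have B1 : 0 < B + 1 by rewrite ltr_wpDl.
have K0 : 0 < K := lt_le_trans ltr01 K1.
have t0 : 0 < t by rewrite divr_gt0// mulr_gt0.
have r0 : 0 < r by rewrite divr_gt0// mulr_gt0.
have rKB : r * (K * (B + 1)) = t by rewrite divfK// mulf_neq0// gt_eqF.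
have tB : t * (B + 1) = e / 4.
  by rewrite /t invfM mulrA divfK// gt_eqF.
have rt : r <= t.
  by rewrite -rKB ler_peMr ?(ltW r0)// mulr_ege1// lerDr.
(* A direction along the graph axis, long enough to beat the Lipschitz slope. *)
pose xi : Rd := t *: (delta_mx 0 ord_max *m Q^T).
exists (e / 2), r, xi; split=> [||y]; [by rewrite divr_gt0|exact: r0|].
move=> eta s Oy yx etar /andP[s0 s1].
have xiE j : xi 0 j = t * Q j ord_max by rewrite mxE -rowE !mxE.
have yU : U y.
  by apply: eU => j; rewrite (le_trans (ltW (yx j)))// ler_pdivrMr// ler_peMr ?ler1n// ltW.
pose z := y + s *: eta.
have zU : U z.
  apply: eU => j; rewrite /z !mxE addrAC (le_trans (ler_normD _ _))//.
  rewrite [leRHS](splitr e) lerD ?(ltW (yx j))// normrM (ger0_norm s0).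
  apply: (@le_trans _ _ `|eta 0 j|); first by rewrite ler_piMl.
  have -> : eta 0 j = (eta 0 j - xi 0 j) + xi 0 j by rewrite subrK.
  rewrite (le_trans (ler_normD _ _))// (le_trans (lerD (etar j) (lexx _)))//.
  rewrite xiE normrM (gtr0_norm t0).
  apply: (@le_trans _ _ (t + t * B)).
    by rewrite lerD// ler_wpM2l// ltW.
  by rewrite -{1}(mulr1 t) -mulrDr [1 + B]addrC tB; move: e0; lra.
pose dl := eta - xi.
have dlQ j : `|(dl *m Q) 0 j| <= r * B.
  rewrite mxE (le_trans (ler_norm_sum _ _ _))// /B mulr_sumr ler_sum// => k _.
  rewrite normrM ler_pM//; first by have := etar k; rewrite /dl !mxE.
  by rewrite (bigD1 j)//= lerDl sumr_ge0.
have zQ : z *m Q = y *m Q + s *: (t *: delta_mx 0 ord_max + dl *m Q).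
  rewrite /z mulmxDl -scalemxAl; congr (_ + s *: _).
  have -> : eta = xi + dl by rewrite /dl addrC subrK.
  by rewrite mulmxDl -scalemxAl -mulmxA QQ' mulmx1.
have /UO : U z by [].
move=> UOz; apply/UOz; have /(UO _ yU) gy := Oy.
have cz : col' ord_max (z *m Q) - col' ord_max (y *m Q) = s *: col' ord_max (dl *m Q).
  apply/rowP => j; rewrite zQ !mxE addrAC subrr add0r; congr (_ * _).
  by rewrite eq_sym (negbTE (neq_lift _ _)) andbF mulr0 add0r.
have fz : fnorm (col' ord_max (z *m Q) - col' ord_max (y *m Q)) <= s * (n%:R * (r * B)).
  rewrite cz; apply: (le_trans (fnorm_le (s := s * (r * B)) _)).
    move=> i j; rewrite [i]ord1 !mxE normrM (ger0_norm s0) ler_wpM2l//.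
    by have := dlQ (lift ord_max j); rewrite mxE.
  by rewrite mul1n mulrCA.
have gz : gamma (col' ord_max (z *m Q)) <= gamma (col' ord_max (y *m Q)) + `|L| * (s * (n%:R * (r * B))).
  rewrite -lerBlDl (le_trans (ler_norm _))// (le_trans (gL _ _))//.
  apply: (@le_trans _ _ (`|L| * fnorm (col' ord_max (z *m Q) - col' ord_max (y *m Q)))).
    by rewrite ler_wpM2r ?fnorm_ge0// ler_norm.
  exact: ler_wpM2l.
apply: (le_lt_trans gz).
have -> : (z *m Q) 0 ord_max = (y *m Q) 0 ord_max + s * (t + (dl *m Q) 0 ord_max).
  by rewrite zQ; move: (y *m Q) (dl *m Q) => p q; rewrite !mxE !eqxx mulr1.
rewrite ltr_leD//.
have -> : `|L| * (s * (n%:R * (r * B))) = s * (`|L| * n%:R * (r * B)) by ring.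
rewrite ler_wpM2l//.
have := dlQ ord_max; rewrite ler_norml => /andP[h _].
apply: le_trans (lerD (lexx _) h).
rewrite lerBrDr -rKB /K.
rewrite (_ : _ + _ = r * ((`|L| * n%:R + 1) * B)); last by ring.
by rewrite ler_wpM2l ?(ltW r0)// ler_wpM2l// ?lerDl// ltW.
Qed.

Section global.
Variables (Omega : set Rd) (C : R) (c : 'M[R]_n.+1) (i : 'I_n.+1).
Hypotheses (oO : open Omega) (bO : bounded_set Omega) (C0 : 0 <= C).

(** The estimate on the part of Omega in V, with D uniform in (w, u); it passes to finite unions,
    which reduces the claim to small boxes. *)
Let good (V : set Rd) := forall e : R, 0 < e -> exists2 D : R, 0 <= D &
  forall w u A, controlled Omega c C w u -> measurable A -> A `<=` Omega `&` V ->
    `|\int[mu]_(x in A) w x 0 i| <= e + D * fine (mu A).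

Let mO : measurable Omega := open_measurable_rV oO.

Let muS A : A `<=` Omega -> measurable A -> (mu A < +oo)%E.
Proof.
move=> AO mA; apply: (@le_lt_trans _ _ (mu Omega)); last exact: lebesgue_bounded_fin.
exact: le_lebesgue_rV.
Qed.

Let good_local x : lipschitz_boundary Omega -> closure Omega x ->
  exists2 rho : R, 0 < rho & good (obox x rho).
Proof.
move=> lip clx; have [rho [r [xi [rho0 r0 cone]]]] := lipschitz_cone oO lip clx.
exists rho => // e e0.
have [k [tk k0 kmom]] := kernel_exists xi i r0.
have oO' : open (Omega `&` obox x rho) by apply: openI => //; exact: obox_open.
have cone' y eta (s : R) : (Omega `&` obox x rho) y -> cbox xi r eta -> 0 <= s <= 1 ->
  Omega (y + s *: eta) by move=> [Oy xy]; exact: cone.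
have [D D0 H] := key_local oO cone' tk k0 kmom c C0 e0.
exists D => // w u A [iw iu gC sC uC] mA AO.
apply: (set_bound oO oO' _ _ D0) => //.
- by apply: muS => //; exact: open_measurable_rV.
- exact: (H w u iw iu gC sC uC).
Qed.

Let good_setU V W : measurable V -> good V -> good W -> good (V `|` W).
Proof.
move=> mV gV gW e e0; have e20 : 0 < e / 2 by rewrite divr_gt0.
have [D D0 HD] := gV _ e20; have [D' D0' HD'] := gW _ e20.
exists (D + D') => [|w u A cw mA AO]; first exact: addr_ge0.
have mAV : measurable (A `&` V) by exact: measurableI.
have mAV' : measurable (A `\` V) by exact: measurableD.
have AOm : A `<=` Omega by move=> x /AO[].
have le1 : fine (mu (A `&` V)) <= fine (mu A).
  apply: fine_le; rewrite ?ge0_fin_numE// ?muS//; first by move=> x [/AOm].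
  by apply: le_lebesgue_rV => //; exact: subIsetl.
have le2 : fine (mu (A `\` V)) <= fine (mu A).
  apply: fine_le; rewrite ?ge0_fin_numE// ?muS//; first by move=> x [/AOm].
  by apply: le_lebesgue_rV => //; exact: subDsetl.
have [iw _ _ _ _] := cw.
have -> : \int[mu]_(x in A) w x 0 i = \int[mu]_(x in A `&` V) w x 0 i + \int[mu]_(x in A `\` V) w x 0 i.
  rewrite -Rintegral_setU//; first by rewrite setUIDK.
  - by rewrite setUIDK; apply: integrableS (iw 0 i).
  - by apply/disj_setPS => x [[_ Vx] [_ nVx]].
have h1 := HD w u _ cw mAV; have h2 := HD' w u _ cw mAV'.
apply: le_trans (ler_normD _ _) _.
apply: (@le_trans _ _ (e / 2 + D * fine (mu A) + (e / 2 + D' * fine (mu A)))).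
  apply: lerD.
    apply: le_trans (h1 _) _; first by move=> x [/AO[] ? _].
    by rewrite lerD2l ler_wpM2l.
  apply: le_trans (h2 _) _; first by move=> x [/AO[? []//]].
  by rewrite lerD2l ler_wpM2l.
by rewrite [in leRHS](splitr e) mulrDl; lra.
Qed.

(** Boundedness makes the closure of Omega compact, so finitely many good boxes cover it, boundary
    points included. *)
Lemma equiintegrable (e : R) : lipschitz_boundary Omega -> 0 < e ->
  exists2 D : R, 0 <= D &
  forall w u A, controlled Omega c C w u -> measurable A -> A `<=` Omega ->
    `|\int[mu]_(x in A) w x 0 i| <= e + D * fine (mu A).
Proof.
move=> lip e0.
have /choice[rho Hrho] x : exists rho : R, closure Omega x -> 0 < rho /\ good (obox x rho).
  have [clx|nclx] := pselect (closure Omega x); last by exists 1.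
  by have [rho rho0 g] := good_local lip clx; exists rho.
have cK : compact (closure Omega).
  have [r Or] := bounded_subset_cbox bO.
  apply: subclosed_compact (@cbox_compact _ _ 0 r) _; first exact: closed_closure.
  by rewrite [X in _ `<=` X](closure_id _).1; [exact: closure_subset|exact: cbox_closed].
move: cK; rewrite compact_cover => /(_ Rd (closure Omega) (fun x => obox x (rho x))).
case=> [x _|x clx|s sO cov]; first exact: obox_open.
  exists x => //; have [rho0 _] := Hrho x clx.
  exact: (nbhs_singleton (nbhs_obox x rho0)).
have gU : good (\bigcup_(x in [set` s]) obox x (rho x)).
  rewrite bigcup_fset.
  have : {in enum_fset s, forall x, good (obox x (rho x))}.
    by move=> x xs; have [] := Hrho x (set_mem (sO x xs)).
  elim: (enum_fset s) => [_|x l IH Hl].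
    rewrite big_nil => e' e0'; exists 0 => // w u A _ _; rewrite setI0 subset0 => ->.
    by rewrite Rintegral_set0 normr0 mul0r addr0 ltW.
  rewrite big_cons; apply: good_setU; first exact: obox_measurable.
    by apply: Hl; rewrite mem_head.
  by apply: IH => y yl; apply: Hl; rewrite inE yl orbT.
have [D D0 HD] := gU e e0; exists D => // w u A cw mA AO; apply: (HD w u) => //.
by move=> x Ax; split; [exact: AO|exact/cov/subset_closure/AO].
Qed.

End global.
End equiintegrability.

(** * Weak L^1 limits of equi-integrable sequences *)

(** The values cluster at some point along U by compactness, and an ultrafilter contains the
    preimage of each neighbourhood of that point or its complement; the latter would exclude
    clustering. *)
Lemma ultra_cvg_bounded (R : realType) T (U : set_system T) (a : T -> R) (M : R) :
  UltraFilter U -> (forall k, `|a k| <= M) -> exists l : R, a k @[k --> U] --> l.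
Proof.
move=> UU aM; have cM : compact (`[- M, M]%classic : set R) by exact: segment_compact.
have [|p [_ clp]] := cM (fmap a U) _.
  by apply: (@filterE _ U) => k /=; rewrite in_itv /= -ler_norml.
exists p => V Vp; have [//|nV] := in_ultra_setVsetC (a @^-1` V) UU.
by have [x [/= nVx Vx]] := clp (~` V) V nV Vp.
Qed.

(* The sum is the integer part of s. *)
Lemma staircase (R : realType) N (s : R) : 0 <= s <= N%:R ->
  `|s - \sum_(j < N) (j.+1%:R <= s)%R%:R| <= 1.
Proof.
elim: N => [|N IH] /andP[s0 sN].
  by rewrite big_ord0 subr0 ger0_norm// (le_trans sN)//.
rewrite big_ord_recr /=; have [sN'|sN'] := leP s N%:R.
  rewrite (_ : (N.+1%:R <= s) = false) ?addr0; first by apply: IH; rewrite s0 sN'.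
  by apply/negbTE; rewrite -ltNge (le_lt_trans sN')// ltr_nat.
rewrite (eq_bigr (fun=> 1)); last first.
  by move=> j _; rewrite (le_trans _ (ltW sN'))// ler_nat.
rewrite sumr_const card_ord; case: (leP N.+1%:R s) => [Ns|sN1] /=.
  have -> : s = N.+1%:R by apply/eqP; rewrite eq_le sN.
  by rewrite -natr1 subrr normr0.
rewrite addr0 ger0_norm ?subr_ge0 ?(ltW sN')//.
by rewrite lerBlDl natr1 ltW.
Qed.

Section weak_compactness.
Context d (T : measurableType d) (R : realType).
Variables (mu : {sigma_finite_measure set T -> \bar R}) (Omega : set T).
Variables (f : nat -> T -> R) (U : set_system nat).
Hypothesis mO : measurable Omega.
Hypothesis Ofin : (mu Omega < +oo)%E.
Hypothesis iF : forall k, mu.-integrable Omega (EFin \o f k).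
Hypothesis equi : forall e : R, 0 < e -> exists2 D : R, 0 <= D &
  forall k A, measurable A -> A `<=` Omega ->
    `|\int[mu]_(x in A) f k x| <= e + D * fine (mu A).
Hypothesis UU : UltraFilter U.

Let m A : R := fine (mu (A `&` Omega)).
Let a A k : R := \int[mu]_(x in A `&` Omega) f k x.
(** The ultrafilter provides limits for all measurable sets at once, so additivity passes to the
    limit without extracting subsequences. *)
Let weak_lim A : R := lim (a A k @[k --> U]).

Lemma le_measure_sub A B : measurable A -> measurable B -> A `<=` B -> (mu A <= mu B)%E.
Proof. by move=> mA mB AB; apply: le_measure => //; apply/mem_set. Qed.

Lemma measurable_capO A : measurable A -> measurable (A `&` Omega).
Proof. by move=> mA; exact: measurableI. Qed.

Lemma capO_fin A : measurable A -> (mu (A `&` Omega) < +oo)%E.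
Proof. by move=> mA; apply: le_lt_trans Ofin; apply: le_measure_sub => //; exact: measurable_capO. Qed.

Lemma capO_finE A : measurable A -> mu (A `&` Omega) = (m A)%:E.
Proof. by move=> mA; rewrite fineK// ge0_fin_numE// capO_fin. Qed.

Lemma capO_le A : measurable A -> m A <= fine (mu Omega).
Proof.
move=> mA; rewrite -lee_fin -capO_finE// fineK ?ge0_fin_numE//.
by apply: le_measure_sub => //; exact: measurable_capO.
Qed.

Lemma capO_int_bound (e : R) : 0 < e -> exists2 D : R, 0 <= D & forall k A, measurable A ->
  `|a A k| <= e + D * m A.
Proof.
move=> e0; have [D D0 HD] := equi e0; exists D => // k A mA.
by apply: HD => //; exact: measurable_capO.
Qed.

Lemma capO_int_cvg A : measurable A -> a A k @[k --> U] --> weak_lim A.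
Proof.
move=> mA; have [D D0 HD] := capO_int_bound ltr01.
have [l al] := ultra_cvg_bounded UU (fun k => HD k A mA).
by apply/cvg_ex; exists l.
Qed.

Lemma weak_lim_bound (e : R) : 0 < e -> exists2 D : R, 0 <= D & forall A, measurable A ->
  `|weak_lim A| <= e + D * m A.
Proof.
move=> e0; have [D D0 HD] := capO_int_bound e0; exists D => // A mA.
apply: (cvgr_to_le (cvg_norm (capO_int_cvg mA))).
by apply: nearW => k; exact: HD.
Qed.

Lemma weak_limU A B : measurable A -> measurable B -> [disjoint A & B] ->
  weak_lim (A `|` B) = weak_lim A + weak_lim B.
Proof.
move=> mA mB AB; apply: (@cvg_unique _ (@norm_hausdorff _ _) (a (A `|` B) @ U)).
  exact: capO_int_cvg (measurableU _ _ mA mB).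
rewrite (_ : a (A `|` B) = (fun k => a A k + a B k)).
  by apply: cvgD; exact: capO_int_cvg.
apply/funext => k; rewrite /a setIUl Rintegral_setU//; [exact: measurable_capO|exact: measurable_capO| |].
- by apply: integrableS (iF k) => //; [exact: measurableU (measurable_capO mA) (measurable_capO mB)|rewrite -setIUl].
- apply/disj_setPS => x [[Ax _] [Bx _]]; move/disj_setPS : AB => /(_ x); exact.
Qed.

Lemma weak_lim0 : weak_lim set0 = 0.
Proof.
have /(weak_limU measurable0 measurable0) : [disjoint set0 & set0 : set T].
  by apply/disj_setPS; rewrite set0I.
by rewrite setU0 => /eqP; rewrite -subr_eq0 opprD addNKr oppr_eq0 => /eqP.
Qed.

Definition limit_charge (A : set T) : \bar R := (weak_lim A)%:E.

Lemma weak_lim_sum (F : nat -> set T) n : (forall i, measurable (F i)) -> trivIset setT F ->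
  weak_lim (\big[setU/set0]_(i < n) F i) = \sum_(0 <= i < n) weak_lim (F i).
Proof.
move=> mF tF; elim: n => [|n IH]; first by rewrite big_ord0 big_nil weak_lim0.
rewrite big_ord_recr /= weak_limU//; first by rewrite IH big_nat_recr.
  exact: bigsetU_measurable.
apply/disj_setPS => x [].
rewrite -bigcup_mkord => -[i /= iN Fix] Fnx.
by have := tF i n I I; move=> /(_ (ex_intro _ x (conj Fix Fnx))) iE; rewrite iE ltnn in iN.
Qed.

Lemma limit_charge0 : limit_charge set0 = 0%E.
Proof. by rewrite /limit_charge weak_lim0. Qed.

Lemma limit_charge_fin A : measurable A -> limit_charge A \is a fin_num.
Proof. by []. Qed.

(** By finite additivity the defect is the value on a tail, bounded by e/2 + D times the measure of
    the tail; that measure tends to 0 because Omega has finite measure. *)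
Lemma limit_charge_sigma : semi_sigma_additive limit_charge.
Proof.
move=> F mF tF mUF; rewrite /limit_charge; under eq_fun do rewrite sumEFin.
apply: cvg_EFin; first exact: nearW.
under eq_fun => n /= do rewrite -weak_lim_sum//.
pose tail n := \bigcup_i F i `\` \big[setU/set0]_(i < n) F i.
have mS n : measurable (\big[setU/set0]_(i < n) F i) by exact: bigsetU_measurable.
have mt n : measurable (tail n) by exact: measurableD.
have St n : \bigcup_i F i = (\big[setU/set0]_(i < n) F i) `|` tail n.
  rewrite /tail setDUK//; apply: bigsetU_bigcup.
have tE n : weak_lim (\bigcup_i F i) = weak_lim (\big[setU/set0]_(i < n) F i) + weak_lim (tail n).
  by rewrite [in LHS](St n) weak_limU//; apply/disj_setPS => x [? []].
have mtail : (fun n => m (tail n)) @ \oo --> 0.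
  have tl0 : \bigcap_n (tail n `&` Omega) = set0.
    rewrite -subset0 => x tx; have [[[i _ Fix] _] _] := tx 0%N I.
    have [[_ nF] _] := tx i.+1 I; apply: nF.
    by rewrite big_ord_recr; right.
  have : mu (tail n `&` Omega) @[n --> \oo] --> mu (\bigcap_n (tail n `&` Omega)).
    apply: nonincreasing_cvg_mu; [exact: capO_fin|by move=> n; exact: measurable_capO|by rewrite tl0|].
    move=> n p np; apply/subsetPset => x [[Fx nF] Ox]; split => //; split => //.
    by move=> Fn; apply: nF; exact: subset_bigsetU np _ Fn.
  rewrite tl0 measure0; under eq_fun => n do rewrite capO_finE//.
  by move/fine_cvgP => [].
apply/cvgrPdist_le => e e0; have e20 : 0 < e / 2 by rewrite divr_gt0.
have [D D0 HD] := weak_lim_bound e20.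
have D1 : 0 < D + 1 by rewrite ltr_wpDl.
have eD : 0 < e / 2 / (D + 1) by rewrite divr_gt0.
move/cvgrPdist_le : mtail => /(_ _ eD); apply: filterS => n /=.
rewrite sub0r normrN => mn; rewrite (tE n) addrAC subrr add0r.
apply: le_trans (HD _ (mt n)) _; rewrite [leRHS](splitr e) lerD2l.
apply: (@le_trans _ _ (D * (e / 2 / (D + 1)))).
  by rewrite ler_wpM2l// (le_trans (ler_norm _)).
by rewrite mulrCA ger_pMr// ler_pdivrMr// mul1r lerDl.
Qed.

HB.instance Definition _ := isCharge.Build _ T R limit_charge
  limit_charge0 limit_charge_fin limit_charge_sigma.

(** On a null set the bound of [weak_lim_bound] reduces to e, for every e > 0. *)
Lemma limit_charge_dom : limit_charge `<< mu.
Proof.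
apply/null_content_dominatesP => A mA A0; rewrite /limit_charge; congr EFin.
apply/eqP; rewrite -normr_le0; apply/ler_addgt0Pr => e e0.
have [D D0 HD] := weak_lim_bound e0; rewrite add0r.
have mA0 : m A = 0.
  rewrite /m (_ : mu _ = 0%E)//; apply/eqP; rewrite -measure_le0 -A0.
  by apply: le_measure_sub => //; exact: measurable_capO.
by have := HD A mA; rewrite mA0 mulr0 addr0.
Qed.

(** The set bound with e = 1, applied where [f k] is nonnegative and where it is negative. *)
Lemma equi_norm_bound : exists2 K : R, 0 < K & forall k, \int[mu]_(x in Omega) `|f k x| <= K.
Proof.
have [D D0 HD] := capO_int_bound ltr01.
pose K := 1 + D * fine (mu Omega).
have K0 : 0 < K by rewrite ltr_pwDl// mulr_ge0// fine_ge0.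
exists (K + K) => [|k]; first exact: addr_gt0.
have mf : measurable_fun Omega (f k) by apply/measurable_EFinP; exact: measurable_int (iF k).
pose P := Omega `&` [set x | 0 <= f k x]; pose N := Omega `\` P.
have mP : measurable P by exact: measurable_fun_le.
have mN : measurable N by exact: measurableD.
have PN : Omega = P `|` N.
  by rewrite /N setDUK//; exact: subIsetl.
have iPN A : A `<=` Omega -> measurable A -> mu.-integrable A (EFin \o f k).
  by move=> AO mA; apply: integrableS (iF k).
rewrite PN Rintegral_setU//; last 2 first.
- by rewrite -PN; exact: (integrable_norm (iF k)).
- by apply/disj_setPS => x [Px [_]].
have PO : P `<=` Omega by apply: subIsetl.
have NO : N `<=` Omega by apply: subDsetl.
have N0 x : N x -> f k x < 0.
  by move=> [Ox nP]; rewrite ltNge; apply/negP => h; apply: nP.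
have HK A : A `<=` Omega -> measurable A -> `|\int[mu]_(x in A) f k x| <= K.
  move=> AO mA; have := HD k A mA; rewrite /a setIidl// => /le_trans; apply.
  by rewrite lerD2l ler_wpM2l// capO_le.
apply: lerD.
  rewrite (_ : \int[mu]_(x in P) _ = \int[mu]_(x in P) f k x).
    exact: le_trans (ler_norm _) (HK P PO mP).
  by apply: eq_Rintegral => x /set_mem[_ /= h]; rewrite ger0_norm.
rewrite (_ : \int[mu]_(x in N) _ = \int[mu]_(x in N) (-1 * f k x)); last first.
  by apply: eq_Rintegral => x /set_mem/N0 h; rewrite ltr0_norm// mulN1r.
rewrite RintegralZl//; last exact: iPN.
by rewrite mulN1r; apply: le_trans (HK N NO mN); rewrite -normrN; exact: ler_norm.
Qed.

(** The density is the Radon-Nikodym derivative of the limit charge. Convergence holds on indicators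
    by construction, hence on finite combinations of them, and extends to bounded functions by
    uniform approximation, the L^1 norms of the sequence being bounded. *)
Lemma weak_compact : exists2 w : T -> R, mu.-integrable Omega (EFin \o w) &
  forall (psi : T -> R) (M : R), measurable_fun Omega psi ->
    (forall x, Omega x -> `|psi x| <= M) ->
    (\int[mu]_(x in Omega) (f k x * psi x)) @[k --> U] --> \int[mu]_(x in Omega) (w x * psi x).
Proof.
pose g := Radon_Nikodym limit_charge mu; pose w x := fine (g x).
have gE : g = EFin \o w.
  by apply/funext => x; rewrite /= fineK//; apply: Radon_Nikodym_fin_num; exact: limit_charge_dom.
have ig : mu.-integrable setT (EFin \o w) by rewrite -gE; apply: Radon_Nikodym_integrable; exact: limit_charge_dom.
have iw : mu.-integrable Omega (EFin \o w) by exact: integrableS ig.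
exists w => //.
have nuE A : measurable A -> weak_lim A = \int[mu]_(x in A) w x.
  by move=> mA; have := Radon_Nikodym_integral limit_charge_dom mA; rewrite -/g gE /Rintegral => <-.
have cA A : measurable A -> A `<=` Omega ->
    (\int[mu]_(x in A) f k x) @[k --> U] --> \int[mu]_(x in A) w x.
  by move=> mA AO; rewrite -nuE//; have := capO_int_cvg mA; rewrite /a setIidl.
have [K K0 HK] := equi_norm_bound.
pose K' := \int[mu]_(x in Omega) `|w x|.
have K'0 : 0 <= K' by exact: Rintegral_ge0.
pose good (psi : T -> R) := (\int[mu]_(x in Omega) (f k x * psi x)) @[k --> U] -->
   \int[mu]_(x in Omega) (w x * psi x).
have bdd_int (h psi : T -> R) (M : R) : mu.-integrable Omega (EFin \o h) ->
    measurable_fun Omega psi -> (forall x, Omega x -> `|psi x| <= M) ->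
    mu.-integrable Omega (EFin \o (fun x => h x * psi x)).
  by move=> ih mpsi psiM; under eq_fun do rewrite mulrC; exact: (integrable_bddM mO mpsi psiM ih).
have bdd_le (h psi : T -> R) (M : R) : mu.-integrable Omega (EFin \o h) ->
    measurable_fun Omega psi -> (forall x, Omega x -> `|psi x| <= M) ->
    `|\int[mu]_(x in Omega) (h x * psi x)| <= M * \int[mu]_(x in Omega) `|h x|.
  move=> ih mpsi psiM; have ihp := bdd_int _ _ _ ih mpsi psiM.
  apply: le_trans (le_normr_Rintegral mO ihp) _.
  rewrite -RintegralZl//; last exact: (integrable_norm ih).
  apply: le_Rintegral => //; first exact: (integrable_norm ihp).
    exact: (integrableZl mO M (integrable_norm ih)).
  by move=> x Ox; rewrite normrM mulrC ler_wpM2r// psiM.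
have good_lin (psi phi : T -> R) (b M M' : R) : measurable_fun Omega psi -> measurable_fun Omega phi ->
   (forall x, Omega x -> `|psi x| <= M) -> (forall x, Omega x -> `|phi x| <= M') ->
   good psi -> good phi -> good (fun x => b * psi x + phi x).
  move=> mpsi mphi psiM phiM gpsi gphi; rewrite /good.
  have E h : mu.-integrable Omega (EFin \o h) ->
     \int[mu]_(x in Omega) (h x * (b * psi x + phi x)) =
     b * \int[mu]_(x in Omega) (h x * psi x) + \int[mu]_(x in Omega) (h x * phi x).
    move=> ih; have i1 := bdd_int _ _ _ ih mpsi psiM; have i2 := bdd_int _ _ _ ih mphi phiM.
    rewrite -RintegralZl// -RintegralD//; last exact: (integrableZl mO b i1).
    by apply: eq_Rintegral => x _; rewrite mulrDr mulrCA.
  rewrite E//; under eq_fun => k do rewrite E//.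
  by apply: cvgD gphi; apply: cvgMr.
have good_indic A : measurable A -> good (\1_A).
  move=> mA; rewrite /good.
  have E h : \int[mu]_(x in Omega) (h x * \1_A x) = \int[mu]_(x in A `&` Omega) h x.
    rewrite Rintegral_mkcond [RHS]Rintegral_mkcond; apply: eq_Rintegral => x _.
    rewrite !patchE in_setI indicE; case: (x \in A); case: (x \in Omega) => //=.
      by rewrite mulr1.
    by rewrite mulr0.
  rewrite E; under eq_fun => k do rewrite E.
  by apply: cA; [exact: measurable_capO|exact: subIsetr].
have good_sum N (A : nat -> set T) b : (forall j, measurable (A j)) ->
    good (fun x => b * \sum_(j < N) \1_(A j) x).
  move=> mA; elim: N => [|N IH].
    rewrite (_ : (fun x => _) = \1_set0); first exact: good_indic.
    by apply/funext => x; rewrite big_ord0 mulr0 indic0.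
  rewrite (_ : (fun x => _) = (fun x => b * \1_(A N) x + b * \sum_(j < N) \1_(A j) x)).
    apply: (good_lin _ _ _ 1 (`|b| * N%:R)) => //.
    - apply: measurable_funM => //; apply: measurable_sum => j; exact: measurable_indic.
    - by move=> x _; rewrite indicE; case: (x \in _); rewrite ?normr1// normr0.
    - move=> x _; rewrite normrM ler_wpM2l// (le_trans (ler_norm_sum _ _ _))//.
      have -> : N%:R = \sum_(j < N) 1 :> R by rewrite sumr_const card_ord.
      apply: ler_sum => j _; by rewrite indicE; case: (x \in _); rewrite ?normr1// normr0.
    - exact: good_indic.
  by apply/funext => x; rewrite big_ord_recr /= mulrDr addrC.
have good01 (psi : T -> R) : measurable_fun Omega psi -> (forall x, Omega x -> 0 <= psi x <= 1) -> good psi.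
  move=> mpsi psi01; rewrite /good; apply/cvgrPdist_le => e e0.
  pose L := K + K' + 1; have L0 : 0 < L by rewrite ltr_wpDl// addr_ge0// ltW.
  (* Makes (K + K') / (N + 1) at most e / 2, the error of replacing psi by a staircase in both
     integrals. *)
  have [N NL] : exists N : nat, 2 * L / e < N.+1%:R.
    by exists (Num.trunc (2 * L / e)); exact: Num.Theory.truncnS_gt.
  (* Level sets of (N + 1) psi: the sum of their indicators is its integer part on Omega. *)
  pose A j := Omega `&` [set x | j.+1%:R <= N.+1%:R * psi x].
  have mA j : measurable (A j).
    by apply: measurable_fun_le => //; apply: measurable_funM.
  pose s x : R := N.+1%:R^-1 * \sum_(j < N.+1) \1_(A j) x.
  have ms : measurable_fun Omega s.
    by apply: measurable_funM => //; apply: measurable_sum => j; exact: measurable_indic.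
  have N0 : 0 < N.+1%:R :> R by rewrite ltr0n.
  have sE x : Omega x -> `|psi x - s x| <= N.+1%:R^-1.
    move=> Ox; have -> : psi x - s x =
        N.+1%:R^-1 * (N.+1%:R * psi x - \sum_(j < N.+1) (j.+1%:R <= N.+1%:R * psi x)%R%:R).
      rewrite mulrBr mulKf ?gt_eqF// /s; congr (_ - _ * _); apply: eq_bigr => j _.
      by rewrite indicE /A; congr (nat_of_bool _)%:R; rewrite in_setI (mem_set Ox) /= mem_setE.
    rewrite normrM gtr0_norm ?invr_gt0// ger_pMr ?invr_gt0//; apply: staircase.
    by have /andP[p0 p1] := psi01 x Ox; rewrite mulr_ge0//= ger_pMr.
  have gs := good_sum N.+1 A N.+1%:R^-1 mA.
  have e20 : 0 < e / 2 by rewrite divr_gt0.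
  have mps : measurable_fun Omega (fun x => psi x - s x) by exact: measurable_funB.
  have E h : mu.-integrable Omega (EFin \o h) -> `|\int[mu]_(x in Omega) (h x * psi x) -
       \int[mu]_(x in Omega) (h x * s x)| <= N.+1%:R^-1 * \int[mu]_(x in Omega) `|h x|.
    move=> ih; rewrite -RintegralB//.
    - have -> : \int[mu]_(x in Omega) (h x * psi x - h x * s x) =
          \int[mu]_(x in Omega) (h x * (psi x - s x)).
        by apply: eq_Rintegral => x _; rewrite mulrBr.
      exact: bdd_le.
    - apply: (bdd_int _ _ 1) => // x Ox; have /andP[p0 p1] := psi01 x Ox; by rewrite ger0_norm.
    - apply: (bdd_int _ _ 2) => // x Ox; have /andP[p0 p1] := psi01 x Ox.
      have -> : s x = psi x - (psi x - s x) by ring.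
      rewrite (le_trans (ler_normB _ _))// [leRHS](_ : 2 = 1 + 1)// lerD//; first by rewrite ger0_norm.
      by rewrite (le_trans (sE x Ox))// invf_le1// ler1n.
  move/cvgrPdist_le : gs => /(_ _ e20); apply: filterS => k.
  rewrite -/s => Hk.
  have E1 := E _ iw; have E2 := E _ (iF k).
  have L2 : N.+1%:R^-1 * (K + K') <= e / 2.
    rewrite mulrC ler_pdivrMr//; move: NL; rewrite ltr_pdivrMr// => NL.
    rewrite (_ : e / 2 * _ = N.+1%:R * e / 2); last by ring.
    by move: NL; rewrite /L; lra.
  have E3 : N.+1%:R^-1 * \int[mu]_(x in Omega) `|f k x| <= N.+1%:R^-1 * K.
    by rewrite ler_wpM2l ?invr_ge0 ?HK.
  rewrite -/K' in E1; rewrite mulrDr in L2.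
  rewrite (_ : _ - _ = (\int[mu]_(x in Omega) (w x * psi x) - \int[mu]_(x in Omega) (w x * s x)) +
    (\int[mu]_(x in Omega) (w x * s x) - \int[mu]_(x in Omega) (f k x * s x)) -
    (\int[mu]_(x in Omega) (f k x * psi x) - \int[mu]_(x in Omega) (f k x * s x))); last by ring.
  rewrite (le_trans (ler_normB _ _))// (le_trans (lerD (ler_normD _ _) (lexx _)))//.
  have aux (x1 x2 x3 p q q' : R) : x1 <= e / 2 -> x2 <= p -> x3 <= q -> q <= q' ->
    q' + p <= e / 2 -> x2 + x1 + x3 <= e by lra.
  exact: aux Hk E1 E2 E3 L2.
move=> psi M mpsi psiM.
pose M1 := `|M| + 1; have M10 : 0 < M1 by rewrite ltr_wpDl.
(* Affine rescaling into [0, 1], undone at the end by [good_lin]. *)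
pose phi x := (psi x / M1 + 1) / 2.
have mphi : measurable_fun Omega phi.
  by apply: measurable_funM => //; apply: measurable_funD => //; apply: measurable_funM.
have phi01 x : Omega x -> 0 <= phi x <= 1.
  move=> Ox; have /ler_normlP[h1 h2] : `|psi x| <= M1.
    by rewrite (le_trans (psiM x Ox))// (le_trans (ler_norm _))// lerDl.
  have h3 : psi x / M1 <= 1 by rewrite ler_pdivrMr// mul1r.
  have h4 : -1 <= psi x / M1 by rewrite ler_pdivlMr// mulN1r lerNl.
  by rewrite /phi; apply/andP; split; lra.
have gphi := good01 _ mphi phi01.
have phi1 x : Omega x -> `|phi x| <= 1.
  by move=> Ox; have /andP[p0 p1] := phi01 x Ox; rewrite ger0_norm.
have indic1 A x : Omega x -> `|\1_A x| <= 1 :> R.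
  by move=> _; rewrite indicE; case: (x \in _); rewrite ?normr1// normr0.
(* The constant - M1 as a combination of indicators; the empty set supplies a zero summand to fit
   [good_lin]. *)
have g1 : good (fun x => - M1 * \1_setT x + \1_set0 x).
  by apply: (good_lin _ _ _ 1 1) => //; [exact: indic1|exact: indic1|exact: good_indic|exact: good_indic].
have -> : psi = (fun x => (2 * M1) * phi x + (- M1 * \1_setT x + \1_set0 x)).
  by apply/funext => x; rewrite indicT indic0 /phi /=; field; rewrite gt_eqF.
apply: (good_lin _ _ _ 1 M1) => //.
- by apply: measurable_funD; [apply: measurable_funM => //|]; exact: measurable_indic.
- by move=> x _; rewrite indicT indic0 /= addr0 mulr1 normrN gtr0_norm.
Qed.

End weak_compactness.

(** * Radon norms as seminorms *)

Section radon_norm_theory.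
Context {R : realType} {d p q : nat}.
Local Notation Rd := 'rV[R]_d.
Variables (X : set 'M[R]_(p, q)) (Omega : set Rd).
Hypothesis XZ : forall A (k : R), X A -> X (k *: A).
Hypothesis X0 : X 0.

Let D := distrib (R := R) (d := d) p q.
Let test (phi : Rd -> 'M[R]_(p, q)) := test_field X Omega phi.

(** The part of linearity that the norm estimates use, [distrib] itself carrying none. *)
Definition homogeneous_on (T : D) : Prop := forall phi k, test phi ->
  T (fun x => k *: phi x) = k * T phi.

Lemma test_field0 : test (cst 0).
Proof.
apply: tfun_test_field => // i j; under eq_fun do rewrite mxE; exact: tfun0.
Qed.

Lemma fnorm0 m n : fnorm (0 : 'M[R]_(m, n)) = 0.
Proof. by rewrite /fnorm inner_pair big1 ?sqrtr0// => ij _; rewrite mxE mul0r. Qed.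

Lemma fnormZ m n (k : R) (A : 'M[R]_(m, n)) : fnorm (k *: A) = `|k| * fnorm A.
Proof.
by rewrite /fnorm innerZr innerC innerZr mulrA -expr2 sqrtrM ?sqr_ge0// sqrtr_sqr.
Qed.

(** Test fields vanish outside Omega, so the supremum over Omega controls all points. *)
Lemma sup_norm_le1 phi : test phi ->
  (sup_norm Omega phi <= 1)%E <-> forall x, fnorm (phi x) <= 1.
Proof.
move=> tphi; split => [s1 x|phi1]; last first.
  by apply: ge_ereal_sup => _ [x _ <-]; rewrite lee_fin.
have [Ox|nOx] := pselect (Omega x).
  by rewrite -lee_fin (le_trans _ s1)//; apply: ereal_sup_ubound; exists x.
rewrite (_ : phi x = 0) ?fnorm0//; apply/matrixP => i j; rewrite mxE.
exact: (tfun_out (test_field_tfun i j tphi) nOx).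
Qed.

Lemma radon_norm_le (T : D) (c : \bar R) :
  (radon_norm X Omega T <= c)%E <->
  forall phi, test phi -> (forall x, fnorm (phi x) <= 1) -> ((T phi)%:E <= c)%E.
Proof.
split=> [Tc phi tphi phi1|H]; first exact: le_trans (radon_norm_ge _ tphi phi1) Tc.
by apply: ge_ereal_sup => _ [phi [tphi /(sup_norm_le1 tphi) phi1] <-]; exact: H.
Qed.

Lemma radon_norm_ge0 T : homogeneous_on T -> (0 <= radon_norm X Omega T)%E.
Proof.
move=> hT; have := hT (cst 0) 0 test_field0; rewrite mul0r => E.
rewrite (_ : 0%E = (T (fun x => 0 *: cst 0 x))%:E); last by rewrite E.
apply: radon_norm_ge => [|x]; first by apply: test_fieldZ => //; exact: test_field0.
by rewrite scale0r fnorm0.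
Qed.

Lemma eq_radon_norm T S : (forall phi, test phi -> T phi = S phi) ->
  radon_norm X Omega T = radon_norm X Omega S.
Proof.
move=> TS; apply/eqP; rewrite eq_le; apply/andP; split; apply/radon_norm_le => phi tphi phi1.
  by rewrite TS//; exact: radon_norm_ge.
by rewrite -TS//; exact: radon_norm_ge.
Qed.

(** The sign of k is absorbed into the test field. *)
Lemma radon_normZ_le T (k : R) : homogeneous_on T ->
  (radon_norm X Omega (fun phi => (k * T phi)%R) <= `|k|%:E * radon_norm X Omega T)%E.
Proof.
move=> hT; apply/radon_norm_le => phi tphi phi1.
have -> : k * T phi = `|k| * T (fun x => Num.sg k *: phi x).
  by rewrite hT// mulrA [_ * Num.sg k]mulrC -numEsg.
rewrite EFinM; apply: lee_wpmul2l; first by rewrite lee_fin.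
apply: radon_norm_ge => [|x]; first exact: test_fieldZ.
rewrite fnormZ normr_sg; have := phi1 x.
by case: (k != 0); rewrite ?mul1r// mul0r.
Qed.

Lemma radon_normD_le T S : homogeneous_on T -> homogeneous_on S ->
  (radon_norm X Omega (T + S)%R <= radon_norm X Omega T + radon_norm X Omega S)%E.
Proof.
move=> hT hS; apply/radon_norm_le => phi tphi phi1.
by rewrite [(T + S)%R phi]/(T phi + S phi) EFinD; apply: leeD; exact: radon_norm_ge.
Qed.

Lemma homogeneous_onD T S : homogeneous_on T -> homogeneous_on S -> homogeneous_on (T + S)%R.
Proof. by move=> hT hS phi k tphi; rewrite /= !fctE /= hT// hS// mulrDr. Qed.

Lemma homogeneous_onN T : homogeneous_on T -> homogeneous_on (- T)%R.
Proof. by move=> hT phi k tphi; rewrite /= !fctE /= hT// mulrN. Qed.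

End radon_norm_theory.

(** * Nonnegativity, homogeneity, triangle inequality and properness *)

Section TGV_basic.
Context {R : realType} {d : nat}.
Local Notation Rd := 'rV[R]_d.
Local Notation mu := (@lebesgue_rV R d).
Variables (Omega : set Rd) (alpha beta : R) (c : 'M[R]_d).
Hypothesis oO : open Omega.
Hypotheses (alpha0 : 0 < alpha) (beta0 : 0 < beta).

Let mO : measurable Omega := open_measurable_rV oO.

Lemma sym_spaceZ (A : 'M[R]_d) (k : R) : sym_space A -> sym_space (k *: A).
Proof. by rewrite /sym_space /= => AA; rewrite linearZ /= AA. Qed.

Lemma sym_space0 : (sym_space : set 'M[R]_d) 0. Proof. by rewrite /sym_space /= trmx0. Qed.

Let Gd u w : distrib 1 d := (weak_grad Omega u - dist_of Omega w)%R.
Let Ed u w : distrib d d := (sym_grad Omega w + dist_of Omega (fun x => u x *: c))%R.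

Definition TGV_energy (u : Rd -> R) (w : Rd -> Rd) : \bar R :=
  (alpha%:E * radon_norm vec_space Omega (Gd u w) +
   beta%:E * radon_norm sym_space Omega (Ed u w))%E.

Lemma L1D u v : L1 Omega u -> L1 Omega v -> L1 Omega (fun x => u x + v x).
Proof. by move=> iu iv; exact: (integrableD mO iu iv). Qed.

Lemma L1Z (k : R) u : L1 Omega u -> L1 Omega (fun x => k * u x).
Proof. by move=> iu; exact: (integrableZl mO k iu). Qed.

Lemma L1_fieldD p q (w z : Rd -> 'M[R]_(p, q)) : L1_field Omega w -> L1_field Omega z ->
  L1_field Omega (fun x => w x + z x).
Proof.
move=> iw iz i j; rewrite /L1; under eq_fun do rewrite /= mxE; exact: L1D.
Qed.

Lemma L1_fieldZ p q (k : R) (w : Rd -> 'M[R]_(p, q)) : L1_field Omega w ->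
  L1_field Omega (fun x => k *: w x).
Proof. by move=> iw i j; rewrite /L1; under eq_fun do rewrite /= mxE; exact: L1Z. Qed.

Lemma L1_fieldZc p q (A : 'M[R]_(p, q)) u : L1 Omega u -> L1_field Omega (fun x => u x *: A).
Proof.
move=> iu i j; rewrite /L1; under eq_fun do rewrite /= mxE mulrC; exact: L1Z.
Qed.

Section linearity.
Variables (p q : nat) (X : set 'M[R]_(p, q)).

Lemma dist_ofD_l (w z phi : Rd -> 'M[R]_(p, q)) : L1_field Omega w -> L1_field Omega z ->
  (forall i j, tfun setT (fun x => phi x i j)) ->
  dist_of Omega (fun x => w x + z x) phi = dist_of Omega w phi + dist_of Omega z phi.
Proof.
move=> iw iz tphi; rewrite /dist_of -RintegralD//; [|exact: L1_inner|exact: L1_inner].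
by apply: eq_Rintegral => x _; rewrite innerC innerDr innerC [X in _ + X]innerC.
Qed.

Lemma dist_ofZ_l (k : R) (w phi : Rd -> 'M[R]_(p, q)) : L1_field Omega w ->
  (forall i j, tfun setT (fun x => phi x i j)) ->
  dist_of Omega (fun x => k *: w x) phi = k * dist_of Omega w phi.
Proof.
move=> iw tphi; rewrite /dist_of -RintegralZl//; last exact: L1_inner.
by apply: eq_Rintegral => x _; rewrite innerC innerZr innerC.
Qed.

Lemma test_field_tfunT (phi : Rd -> 'M[R]_(p, q)) : test_field X Omega phi ->
  forall i j, tfun setT (fun x => phi x i j).
Proof.
by move=> tphi i j; apply: (tfunS (@subsetT _ Omega)); exact: (test_field_tfun i j tphi).
Qed.

End linearity.

Lemma tfun_opp_mat_div (phi : Rd -> 'M[R]_d) : test_field sym_space Omega phi ->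
  forall i j, tfun setT (fun x => (- mat_div phi x) i j).
Proof.
move=> tphi i j; rewrite [i]ord1; apply: (tfunS (@subsetT _ Omega)).
by under eq_fun do rewrite mxE; apply: tfunN; exact: tfun_mat_div.
Qed.

Lemma weak_gradD_l u v phi : L1 Omega u -> L1 Omega v -> test_field vec_space Omega phi ->
  weak_grad Omega (fun x => u x + v x) phi = weak_grad Omega u phi + weak_grad Omega v phi.
Proof.
move=> iu iv tphi; have td := tfunS (@subsetT _ Omega) (tfunN (tfun_vec_div tphi)).
rewrite /weak_grad -RintegralD//; [|exact: L1_mul|exact: L1_mul].
by apply: eq_Rintegral => x _; rewrite mulrDl.
Qed.

Lemma weak_gradZ_l (k : R) u phi : L1 Omega u -> test_field vec_space Omega phi ->
  weak_grad Omega (fun x => k * u x) phi = k * weak_grad Omega u phi.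
Proof.
move=> iu tphi; have td := tfunS (@subsetT _ Omega) (tfunN (tfun_vec_div tphi)).
rewrite /weak_grad -RintegralZl//; last exact: L1_mul.
by apply: eq_Rintegral => x _; rewrite mulrA.
Qed.

Lemma homogeneous_weak_grad u : L1 Omega u -> homogeneous_on vec_space Omega (weak_grad Omega u).
Proof. by move=> iu phi k; exact: weak_gradZ. Qed.

Lemma homogeneous_dist_of p q (X : set 'M[R]_(p, q)) w : L1_field Omega w ->
  homogeneous_on X Omega (dist_of Omega w).
Proof. by move=> iw phi k; exact: dist_ofZ. Qed.

Lemma homogeneous_sym_grad w : L1_field Omega w -> homogeneous_on sym_space Omega (sym_grad Omega w).
Proof. by move=> iw phi k; exact: sym_gradZ. Qed.

Lemma homogeneous_grad_part u w : L1 Omega u -> L1_field Omega w -> homogeneous_on vec_space Omega (Gd u w).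
Proof.
move=> iu iw; apply: homogeneous_onD; first exact: homogeneous_weak_grad.
by apply: homogeneous_onN; exact: homogeneous_dist_of.
Qed.

Lemma homogeneous_sym_part u w : L1 Omega u -> L1_field Omega w -> homogeneous_on sym_space Omega (Ed u w).
Proof.
move=> iu iw; apply: homogeneous_onD; first exact: homogeneous_sym_grad.
by apply: homogeneous_dist_of; exact: L1_fieldZc.
Qed.

(** An L^1 field is a distribution of finite Radon norm; adding or subtracting it preserves
    finiteness, which is how membership in BV and BD is obtained. *)
Lemma dist_of_bound p q (X : set 'M[R]_(p, q)) w : L1_field Omega w -> exists K : R,
  forall phi, test_field X Omega phi -> (forall x, fnorm (phi x) <= 1) ->
  `|dist_of Omega w phi| <= K.
Proof.
move=> iw; exists (\sum_i \sum_j \int[mu]_(x in Omega) `|w x i j|) => phi tphi phi1.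
have tT := test_field_tfunT tphi.
have -> : dist_of Omega w phi = \sum_i \sum_j \int[mu]_(x in Omega) (w x i j * phi x i j).
  rewrite /dist_of /inner Rintegral_sum//.
    by apply: eq_bigr => i _; rewrite Rintegral_sum// => j; exact: (L1_mul oO (iw i j) (tT i j)).
  by move=> i; apply: integrable_sumr => // j; exact: (L1_mul oO (iw i j) (tT i j)).
rewrite (le_trans (ler_norm_sum _ _ _))// ler_sum// => i _.
rewrite (le_trans (ler_norm_sum _ _ _))// ler_sum// => j _.
rewrite -[leRHS]mulr1; apply: (normr_RintegralM_le oO (iw i j)).
  by apply: continuous_measurable_rV; exact: (tfun_continuous (tT i j)).
by move=> x; exact: le_trans (fnorm_ge_entry _ _ _) (phi1 x).
Qed.

Lemma TGV_energy_ge0 u w : L1 Omega u -> L1_field Omega w -> (0 <= TGV_energy u w)%E.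
Proof.
move=> iu iw; apply: adde_ge0; apply: mule_ge0; rewrite ?lee_fin ?(ltW alpha0) ?(ltW beta0)//.
  by apply: radon_norm_ge0 => //; exact: homogeneous_grad_part.
apply: (radon_norm_ge0 sym_spaceZ sym_space0); exact: homogeneous_sym_part.
Qed.

Local Notation TGV := (TGV_osci Omega alpha beta c).

Lemma TGV_BV u : BV Omega u -> TGV u = ereal_inf [set TGV_energy u w | w in BD Omega].
Proof. by move=> /asboolP uBV; rewrite /TGV_osci uBV. Qed.

Lemma TGV_notBV u : ~ BV Omega u -> TGV u = +oo%E.
Proof. by move=> uBV; rewrite /TGV_osci; case: asboolP. Qed.

Lemma TGV_finBV u : TGV u != +oo%E -> BV Omega u.
Proof.
move=> uoo; have [//|uBV] := pselect (BV Omega u).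
by rewrite (TGV_notBV uBV) eqxx in uoo.
Qed.

Lemma TGV_le u w : BV Omega u -> BD Omega w -> (TGV u <= TGV_energy u w)%E.
Proof. by move=> uBV wBD; rewrite TGV_BV//; apply: ereal_inf_lbound; exists w. Qed.

Lemma TGV_ge u (a : \bar R) : (BV Omega u -> forall w, BD Omega w -> (a <= TGV_energy u w)%E) ->
  (a <= TGV u)%E.
Proof.
move=> H; have [uBV|uBV] := pselect (BV Omega u); last by rewrite TGV_notBV// leey.
by rewrite TGV_BV//; apply: le_ereal_inf_tmp => _ [w wBD <-]; exact: H.
Qed.

Lemma TGV_ge0 u : L1 Omega u -> (0 <= TGV u)%E.
Proof. by move=> iu; apply: TGV_ge => _ w [iw _]; exact: TGV_energy_ge0. Qed.

Lemma BVD u v : BV Omega u -> BV Omega v -> BV Omega (fun x => u x + v x).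
Proof.
move=> [iu uV] [iv vV]; split; first exact: L1D.
rewrite (@eq_radon_norm _ _ _ _ _ _ _ (weak_grad Omega u + weak_grad Omega v)%R); last first.
  by move=> phi tphi; rewrite weak_gradD_l.
apply: le_lt_trans (radon_normD_le _ _) _; [exact: homogeneous_weak_grad..|].
by rewrite lte_add_pinfty.
Qed.

Lemma BVZ (k : R) u : BV Omega u -> BV Omega (fun x => k * u x).
Proof.
move=> [iu uV]; split; first exact: L1Z.
rewrite (@eq_radon_norm _ _ _ _ _ _ _ (fun phi => k * weak_grad Omega u phi)); last first.
  by move=> phi tphi; rewrite weak_gradZ_l.
apply: le_lt_trans (radon_normZ_le _ _ _) _ => //; first exact: homogeneous_weak_grad.
by rewrite lte_mul_pinfty// lee_fin.
Qed.

Lemma sym_gradD_l w z phi : L1_field Omega w -> L1_field Omega z -> test_field sym_space Omega phi ->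
  sym_grad Omega (fun x => w x + z x) phi = sym_grad Omega w phi + sym_grad Omega z phi.
Proof. by move=> iw iz tphi; apply: dist_ofD_l => //; exact: tfun_opp_mat_div. Qed.

Lemma sym_gradZ_l (k : R) w phi : L1_field Omega w -> test_field sym_space Omega phi ->
  sym_grad Omega (fun x => k *: w x) phi = k * sym_grad Omega w phi.
Proof. by move=> iw tphi; apply: dist_ofZ_l => //; exact: tfun_opp_mat_div. Qed.

Lemma BDD w z : BD Omega w -> BD Omega z -> BD Omega (fun x => w x + z x).
Proof.
move=> [iw wV] [iz zV]; split; first exact: L1_fieldD.
rewrite (@eq_radon_norm _ _ _ _ _ _ _ (sym_grad Omega w + sym_grad Omega z)%R); last first.
  by move=> phi tphi; rewrite sym_gradD_l.
apply: le_lt_trans (radon_normD_le _ _) _; [exact: homogeneous_sym_grad..|].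
by rewrite lte_add_pinfty.
Qed.

Lemma BDZ (k : R) w : BD Omega w -> BD Omega (fun x => k *: w x).
Proof.
move=> [iw wV]; split; first exact: L1_fieldZ.
rewrite (@eq_radon_norm _ _ _ _ _ _ _ (fun phi => k * sym_grad Omega w phi)); last first.
  by move=> phi tphi; rewrite sym_gradZ_l.
apply: le_lt_trans (radon_normZ_le sym_spaceZ k _) _; first exact: homogeneous_sym_grad.
by rewrite lte_mul_pinfty// lee_fin.
Qed.

Lemma TGV_energyD u v w z : L1 Omega u -> L1 Omega v -> L1_field Omega w -> L1_field Omega z ->
  (TGV_energy (fun x => u x + v x)%R (fun x => w x + z x)%R <= TGV_energy u w + TGV_energy v z)%E.
Proof.
move=> iu iv iw iz; rewrite /TGV_energy addeACA -!ge0_muleDr//; last 4 first.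
- apply: (radon_norm_ge0 sym_spaceZ sym_space0); exact: homogeneous_sym_part.
- apply: (radon_norm_ge0 sym_spaceZ sym_space0); exact: homogeneous_sym_part.
- by apply: radon_norm_ge0 => //; exact: homogeneous_grad_part.
- by apply: radon_norm_ge0 => //; exact: homogeneous_grad_part.
apply: leeD; apply: lee_wpmul2l; rewrite ?lee_fin ?(ltW alpha0) ?(ltW beta0)//.
  rewrite (@eq_radon_norm _ _ _ _ _ _ _ (Gd u w + Gd v z)%R).
    by apply: radon_normD_le; exact: homogeneous_grad_part.
  move=> phi tphi; rewrite /Gd !fctE /= weak_gradD_l// dist_ofD_l//; first by ring.
  exact: test_field_tfunT tphi.
rewrite (@eq_radon_norm _ _ _ _ _ _ _ (Ed u w + Ed v z)%R).
  by apply: radon_normD_le; exact: homogeneous_sym_part.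
move=> phi tphi; rewrite /Ed !fctE /= sym_gradD_l//.
rewrite (_ : (fun x => (u x + v x) *: c) = (fun x => u x *: c + v x *: c)).
  by rewrite dist_ofD_l//; [ring|exact: L1_fieldZc|exact: L1_fieldZc|exact: test_field_tfunT tphi].
by apply/funext => x; rewrite scalerDl.
Qed.

Lemma TGV_energyZ (k : R) u w : L1 Omega u -> L1_field Omega w ->
  (TGV_energy (fun x => k * u x)%R (fun x => k *: w x)%R <= `|k|%:E * TGV_energy u w)%E.
Proof.
move=> iu iw; rewrite /TGV_energy ge0_muleDr; last 2 first.
- apply: mule_ge0; first by rewrite lee_fin ltW.
  by apply: radon_norm_ge0 => //; exact: homogeneous_grad_part.
- apply: mule_ge0; first by rewrite lee_fin ltW.
  apply: (radon_norm_ge0 sym_spaceZ sym_space0); exact: homogeneous_sym_part.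
rewrite !(muleCA `|k|%:E).
apply: leeD; apply: lee_wpmul2l; rewrite ?lee_fin ?(ltW alpha0) ?(ltW beta0)//.
  rewrite (@eq_radon_norm _ _ _ _ _ _ _ (fun phi => k * Gd u w phi)).
    by apply: radon_normZ_le => //; exact: homogeneous_grad_part.
  move=> phi tphi; rewrite /Gd !fctE /= weak_gradZ_l// dist_ofZ_l//; first by ring.
  exact: test_field_tfunT tphi.
rewrite (@eq_radon_norm _ _ _ _ _ _ _ (fun phi => k * Ed u w phi)).
  apply: (radon_normZ_le sym_spaceZ); exact: homogeneous_sym_part.
move=> phi tphi; rewrite /Ed !fctE /= sym_gradZ_l//.
rewrite (_ : (fun x => (k * u x) *: c) = (fun x => k *: (u x *: c))).
  by rewrite dist_ofZ_l//; [ring|exact: L1_fieldZc|exact: test_field_tfunT tphi].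
by apply/funext => x; rewrite scalerA.
Qed.

Lemma TGVZ_le (k : R) u : k != 0 -> L1 Omega u -> (TGV (fun x => k * u x)%R <= `|k|%:E * TGV u)%E.
Proof.
move=> k0 iu; have nk0 : 0 < `|k| by rewrite normr_gt0.
rewrite -lee_pdivrMl//; apply: TGV_ge => uBV w wBD; rewrite lee_pdivrMl//.
apply: le_trans (TGV_le (BVZ k uBV) (BDZ k wBD)) _.
by apply: TGV_energyZ => //; have [] := wBD.
Qed.

(** Sums of near-minimizers, each within e/2, compete for u + v; infinite values are set aside first
    because near-minimizers exist only for a finite infimum. *)
Lemma TGVD_le u v : L1 Omega u -> L1 Omega v -> (TGV (fun x => u x + v x)%R <= TGV u + TGV v)%E.
Proof.
move=> iu iv; have u0 := TGV_ge0 iu; have v0 := TGV_ge0 iv.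
have addoo (x : \bar R) : (0 <= x)%E -> (+oo + x = +oo)%E by case: x.
have [->|uoo] := eqVneq (TGV u) +oo%E; first by rewrite (addoo _ v0) leey.
have [->|voo] := eqVneq (TGV v) +oo%E; first by rewrite addeC (addoo _ u0) leey.
have fin (x : \bar R) : (0 <= x)%E -> x != +oo%E -> x \is a fin_num by case: x.
have uf := fin _ u0 uoo; have vf := fin _ v0 voo.
have uBV := TGV_finBV uoo; have vBV := TGV_finBV voo.
apply/lee_addgt0Pr => e e0; have e20 : 0 < e / 2 by rewrite divr_gt0.
have uE := TGV_BV uBV; have vE := TGV_BV vBV.
rewrite uE in uf; rewrite vE in vf.
have [_ [w wBD <-] Hw] := lb_ereal_inf_adherent e20 uf.
have [_ [z zBD <-] Hz] := lb_ereal_inf_adherent e20 vf.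
apply: le_trans (TGV_le (BVD uBV vBV) (BDD wBD zBD)) _.
apply: le_trans (TGV_energyD iu iv wBD.1 zBD.1) _.
apply: le_trans (leeD (ltW Hw) (ltW Hz)) _.
rewrite -uE -vE.
have aux (x y : \bar R) : (x + (e / 2)%:E + (y + (e / 2)%:E) = x + y + e%:E)%E.
  by rewrite addeACA -EFinD -splitr.
by rewrite aux.
Qed.

Lemma TGV0 : TGV (cst 0) = 0%E.
Proof.
have i0 : L1 Omega (cst 0) by rewrite /L1; exact: integrable0.
have i0f : L1_field Omega (cst 0 : Rd -> Rd) by move=> i j; under eq_fun do rewrite mxE.
have r0 p q (X : set 'M[R]_(p, q)) (T : distrib p q) : (forall phi, T phi = 0) ->
    (radon_norm X Omega T <= 0)%E.
  by move=> T0; apply/radon_norm_le => phi _ _; rewrite T0.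
have gE phi : weak_grad Omega (cst 0) phi = 0.
  by rewrite /weak_grad; under eq_Rintegral do rewrite mul0r; rewrite Rintegral_cst// mul0r.
have dE p q (w phi : Rd -> 'M[R]_(p, q)) : (forall x, w x = 0) -> dist_of Omega w phi = 0.
  move=> w0; rewrite /dist_of; under eq_Rintegral do rewrite w0 -(scale0r 0) innerC innerZr mul0r.
  by rewrite Rintegral_cst// mul0r.
have BV0 : BV Omega (cst 0).
  by split => //; apply: le_lt_trans (r0 _ _ _ _ gE) _; rewrite ltry.
have BD0 : BD Omega (cst 0).
  split => //; apply: le_lt_trans (r0 _ _ _ _ _) _; last by rewrite ltry.
  by move=> phi; exact: dE.
apply/eqP; rewrite eq_le TGV_ge0// andbT (le_trans (TGV_le BV0 BD0))//.
rewrite /TGV_energy -(adde0 0%E); apply: leeD.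
  rewrite -(mule0 alpha%:E); apply: lee_wpmul2l; first by rewrite lee_fin ltW.
  by apply: r0 => phi; rewrite /Gd !fctE /= gE dE// subrr.
rewrite -(mule0 beta%:E); apply: lee_wpmul2l; first by rewrite lee_fin ltW.
apply: r0 => phi; rewrite /Ed !fctE /= /sym_grad !dE ?addr0// => x.
by rewrite scale0r.
Qed.

(** For k nonzero the converse inequality is [TGVZ_le] for k^-1 and k u; for k = 0 the product is 0
    by convention, even at infinity, and [TGV0] applies. *)
Lemma TGVZ (k : R) u : L1 Omega u -> TGV (fun x => k * u x)%R = (`|k|%:E * TGV u)%E.
Proof.
move=> iu; have [->|k0] := eqVneq k 0.
  rewrite normr0 mul0e (_ : (fun x => _) = cst 0) ?TGV0//.
  by apply/funext => x; rewrite mul0r.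
apply/eqP; rewrite eq_le TGVZ_le//= -lee_pdivlMl ?normr_gt0//.
have := TGVZ_le (invr_neq0 k0) (L1Z k iu).
rewrite (_ : (fun x => _) = u); last by apply/funext => x; rewrite mulKf.
by rewrite normfV.
Qed.

Lemma TGV_proper : L1_proper Omega TGV.
Proof.
split=> [u iu|]; first by rewrite (lt_le_trans _ (TGV_ge0 iu))// ltNyr.
exists (cst 0); split; first by rewrite /L1; exact: integrable0.
by rewrite TGV0 ltry.
Qed.

End TGV_basic.

(** * The energy as a supremum over pairs of test fields *)

Section energy_duality.
Context {R : realType} {d : nat}.
Local Notation Rd := 'rV[R]_d.
Local Notation mu := (@lebesgue_rV R d).
Variables (Omega : set Rd) (alpha beta : R) (c : 'M[R]_d).
Hypothesis oO : open Omega.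
Hypotheses (alpha0 : 0 < alpha) (beta0 : 0 < beta).

Let Gd u w : distrib 1 d := (weak_grad Omega u - dist_of Omega w)%R.
Let Ed u w : distrib d d := (sym_grad Omega w + dist_of Omega (fun x => u x *: c))%R.

Lemma grad_part_ge0 u w : L1 Omega u -> L1_field Omega w ->
  (0 <= radon_norm vec_space Omega (Gd u w))%E.
Proof.
move=> iu iw; apply: (radon_norm_ge0 (fun _ _ _ => I) I).
exact: homogeneous_grad_part.
Qed.

Lemma sym_part_ge0 u w : L1 Omega u -> L1_field Omega w ->
  (0 <= radon_norm sym_space Omega (Ed u w))%E.
Proof.
move=> iu iw; apply: (radon_norm_ge0 (@sym_spaceZ R d) (@sym_space0 R d)).
exact: homogeneous_sym_part.
Qed.

Lemma energy_le_parts u w (a : R) : L1 Omega u -> L1_field Omega w ->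
  (TGV_energy Omega alpha beta c u w <= a%:E)%E ->
  (radon_norm vec_space Omega (Gd u w) <= (a / alpha)%:E)%E /\
  (radon_norm sym_space Omega (Ed u w) <= (a / beta)%:E)%E.
Proof.
move=> iu iw; rewrite /TGV_energy -/(Gd u w) -/(Ed u w) => H.
have h1 := grad_part_ge0 iu iw; have h2 := sym_part_ge0 iu iw.
have h3 : (0 <= alpha%:E * radon_norm vec_space Omega (Gd u w))%E.
  by apply: mule_ge0 => //; rewrite lee_fin ltW.
have h4 : (0 <= beta%:E * radon_norm sym_space Omega (Ed u w))%E.
  by apply: mule_ge0 => //; rewrite lee_fin ltW.
split; rewrite mulrC EFinM lee_pdivlMl//; apply: le_trans H; [exact: leeDl|exact: leeDr].
Qed.

Lemma energy_ge u w phi psi : L1 Omega u -> L1_field Omega w ->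
  test_field vec_space Omega phi -> (forall x, fnorm (phi x) <= 1) ->
  test_field sym_space Omega psi -> (forall x, fnorm (psi x) <= 1) ->
  ((alpha * Gd u w phi + beta * Ed u w psi)%:E <= TGV_energy Omega alpha beta c u w)%E.
Proof.
move=> iu iw tphi phi1 tpsi psi1; rewrite EFinD !EFinM; apply: leeD.
  apply: lee_wpmul2l; first by rewrite lee_fin ltW.
  exact: radon_norm_ge.
apply: lee_wpmul2l; first by rewrite lee_fin ltW.
exact: radon_norm_ge.
Qed.

(** Converse of [energy_ge]: the two suprema are over independent fields, so psi is frozen while phi
    varies, then released. In this form the energy passes to weak limits. *)
Lemma energy_le u w (a : R) : L1 Omega u -> L1_field Omega w ->
  (forall phi psi,
    test_field vec_space Omega phi -> (forall x, fnorm (phi x) <= 1) ->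
    test_field sym_space Omega psi -> (forall x, fnorm (psi x) <= 1) ->
    alpha * Gd u w phi + beta * Ed u w psi <= a) ->
  (TGV_energy Omega alpha beta c u w <= a%:E)%E.
Proof.
move=> iu iw H.
have h1 := grad_part_ge0 iu iw.
have G1 psi : test_field sym_space Omega psi -> (forall x, fnorm (psi x) <= 1) ->
    (radon_norm vec_space Omega (Gd u w) <= ((a - beta * Ed u w psi) / alpha)%:E)%E.
  move=> tpsi psi1; apply/radon_norm_le => phi tphi phi1.
  by rewrite lee_fin ler_pdivlMr// lerBrDr mulrC; exact: H.
(* psi = 0 shows that the gradient norm is finite, so that it can be moved across the inequality as
   a real number. *)
have t0 := test_field0 Omega (@sym_space0 R d).
have t01 (x : Rd) : fnorm ((cst 0 : Rd -> 'M[R]_d) x) <= 1 by rewrite fnorm0.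
have gfin : radon_norm vec_space Omega (Gd u w) \is a fin_num.
  by rewrite ge0_fin_numE// (le_lt_trans (G1 _ t0 t01))// ltry.
rewrite /TGV_energy -/(Gd u w) -/(Ed u w) -(fineK gfin).
set g := fine _.
have E1 : (radon_norm sym_space Omega (Ed u w) <= ((a - alpha * g) / beta)%:E)%E.
  apply/radon_norm_le => psi tpsi psi1.
  have := G1 _ tpsi psi1; rewrite -(fineK gfin) -/g !lee_fin ler_pdivlMr// ler_pdivlMr//.
  by rewrite !(mulrC _ alpha) (mulrC _ beta); lra.
rewrite -[a in leRHS](subrKC (alpha * g)) EFinD -EFinM; apply: leeD => //.
rewrite -[a - _](divfK (lt0r_neq0 beta0)) mulrC EFinM.
by apply: lee_wpmul2l => //; rewrite lee_fin ltW.
Qed.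

(** Convergence in L^1 gives convergence of the pairing along [\oo], and U is finer than [\oo]. *)
Lemma dist_cvg_L1 (u : Rd -> R) (v : nat -> Rd -> R) (U : set_system nat) psi :
  ProperFilter U -> \oo `<=` U ->
  L1 Omega u -> (forall k, L1 Omega (v k)) ->
  (forall k, (L1_dist Omega u (v k) < (k.+1%:R^-1)%:E)%E) -> tfun setT psi ->
  (\int[mu]_(x in Omega) (v k x * psi x)) @[k --> U] --> \int[mu]_(x in Omega) (u x * psi x).
Proof.
move=> PU oU iu iv uv tpsi; apply: (cvg_trans (G := (fun k => \int[mu]_(x in Omega) (v k x * psi x)) @ \oo)).
  by move=> A oA; apply: oU.
have [M M0 psiM] := tfun_bounded tpsi; have mO := open_measurable_rV oO.
have mpsi := continuous_measurable_rV (tfun_continuous tpsi).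
apply/cvgrPdist_le => e e0.
have := @cvg_harmonic R; move/cvgrPdist_le => /(_ (e / M) (divr_gt0 e0 M0)).
apply: filterS => k; rewrite sub0r normrN ger0_norm ?invr_ge0// => kM.
rewrite -RintegralB//; [|exact: L1_mul|exact: L1_mul].
have -> : \int[mu]_(x in Omega) (u x * psi x - v k x * psi x) =
    \int[mu]_(x in Omega) ((u x - v k x) * psi x).
  by apply: eq_Rintegral => x _; rewrite mulrBl.
have iuv : L1 Omega (fun x => u x - v k x).
  by rewrite /L1; have := integrableB mO iu (iv k).
apply: le_trans (normr_RintegralM_le oO iuv mpsi psiM) _.
rewrite -ler_pdivlMr//; apply: le_trans kM; rewrite -lee_fin /Rintegral fineK.
  exact: ltW (uv k).
exact: (integrable_fin_num mO (integrable_norm iuv)).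
Qed.

Lemma cvg_Rsum I (s : seq I) (U : set_system nat) (F : I -> nat -> R) (l : I -> R) :
  ProperFilter U -> (forall i, F i k @[k --> U] --> l i) ->
  (\sum_(i <- s) F i k) @[k --> U] --> \sum_(i <- s) l i.
Proof. by move=> PU Fl; apply: cvg_big => //; exact: add_continuous. Qed.

Lemma dist_ofE p q (w phi : Rd -> 'M[R]_(p, q)) : L1_field Omega w ->
  (forall i j, tfun setT (fun x => phi x i j)) ->
  dist_of Omega w phi = \sum_i \sum_j \int[mu]_(x in Omega) (w x i j * phi x i j).
Proof.
move=> iw tT; have mO := open_measurable_rV oO; rewrite /dist_of /inner Rintegral_sum//.
  by apply: eq_bigr => i _; rewrite Rintegral_sum// => j; exact: (L1_mul oO (iw i j) (tT i j)).
by move=> i; apply: integrable_sumr => // j; exact: (L1_mul oO (iw i j) (tT i j)).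
Qed.

Lemma dist_of_cvg p q (w : nat -> Rd -> 'M[R]_(p, q)) (z phi : Rd -> 'M[R]_(p, q)) (U : set_system nat) :
  ProperFilter U -> (forall k, L1_field Omega (w k)) -> L1_field Omega z ->
  (forall i j, tfun setT (fun x => phi x i j)) ->
  (forall i j, (\int[mu]_(x in Omega) (w k x i j * phi x i j)) @[k --> U] -->
    \int[mu]_(x in Omega) (z x i j * phi x i j)) ->
  dist_of Omega (w k) phi @[k --> U] --> dist_of Omega z phi.
Proof.
move=> PU iw iz tphi H; rewrite dist_ofE//; under eq_fun => k do rewrite dist_ofE//.
by apply: cvg_Rsum => i; apply: cvg_Rsum => j; exact: H.
Qed.

End energy_duality.

(** * Lower semi-continuity *)

Section lower_semicontinuity.
Context {R : realType} {n : nat}.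
Local Notation Rd := 'rV[R]_n.+1.
Local Notation mu := (@lebesgue_rV R n.+1).
Variables (Omega : set Rd) (alpha beta : R) (c : 'M[R]_n.+1).
Hypotheses (oO : open Omega) (bO : bounded_set Omega) (lip : lipschitz_boundary Omega).
Hypotheses (alpha0 : 0 < alpha) (beta0 : 0 < beta).

Local Notation TGV := (TGV_osci Omega alpha beta c).
Local Notation energy := (TGV_energy Omega alpha beta c).

Lemma TGV_minimizing u (a e : R) : L1 Omega u -> 0 < e -> (TGV u <= a%:E)%E ->
  exists2 w, BD Omega w & (energy u w <= (a + e)%:E)%E.
Proof.
move=> iu e0 ua; have u0 := TGV_ge0 c oO alpha0 beta0 iu.
have ufin : TGV u \is a fin_num.
  by move: (TGV u) u0 ua => x x0 xa; rewrite ge0_fin_numE// (le_lt_trans xa)// ltry.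
have uBV : BV Omega u.
  by apply: (@TGV_finBV _ _ _ alpha beta c); move: (TGV u) ufin; case.
have E := TGV_BV alpha beta c uBV; rewrite E in ufin.
have [_ [w wBD <-] Hw] := lb_ereal_inf_adherent e0 ufin.
exists w => //; apply: le_trans (ltW Hw) _; rewrite EFinD; apply: leeD => //.
by rewrite -E.
Qed.

(** Membership of u in BV is part of the conclusion: it is read off from the energy of the limit
    pair, since the limit field is in L^1. *)
Lemma TGV_le_limit u (v : nat -> Rd -> R) (w : nat -> Rd -> Rd) (a : R) :
  L1 Omega u -> (forall k, L1 Omega (v k)) -> (forall k, BD Omega (w k)) ->
  (forall k, (L1_dist Omega u (v k) < (k.+1%:R^-1)%:E)%E) ->
  (forall k, (energy (v k) (w k) <= (a + k.+1%:R^-1)%:E)%E) ->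
  (TGV u <= a%:E)%E.
Proof.
move=> iu iv wBD uv vw; have mO := open_measurable_rV oO.
have iw k : L1_field Omega (w k) by have [] := wBD k.
have a10 : 0 <= a + 1.
  have := le_trans (TGV_energy_ge0 c oO alpha0 beta0 (iv 0%N) (iw 0%N)) (vw 0%N).
  by rewrite lee_fin invr1.
(* A sum of three nonnegative bounds, hence above each; 1 / (k + 1) <= 1 gives the a + 1, and the
   distance to u gives the last summand. *)
pose C := (a + 1) / alpha + (a + 1) / beta + (\int[mu]_(x in Omega) `|u x| + 1).
have c1 : 0 <= (a + 1) / alpha by rewrite divr_ge0// ltW.
have c2 : 0 <= (a + 1) / beta by rewrite divr_ge0// ltW.
have c3 : 0 <= \int[mu]_(x in Omega) `|u x| by exact: Rintegral_ge0.
have C0 : 0 <= C by rewrite /C; lra.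
have cw k : controlled Omega c C (w k) (v k).
  have k1 : k.+1%:R^-1 <= 1 :> R by rewrite invf_le1// ler1n.
  have [h1 h2] : (radon_norm vec_space Omega (weak_grad Omega (v k) - dist_of Omega (w k))%R <= ((a + 1) / alpha)%:E)%E /\
     (radon_norm sym_space Omega (sym_grad Omega (w k) + dist_of Omega (fun x => v k x *: c))%R <= ((a + 1) / beta)%:E)%E.
    apply: energy_le_parts => //; apply: le_trans (vw k) _.
    by rewrite lee_fin lerD2l.
  split => //.
  - by apply: le_trans h1 _; rewrite lee_fin /C; lra.
  - by apply: le_trans h2 _; rewrite lee_fin /C; lra.
  - have iuv : L1 Omega (fun x => u x - v k x) by have := integrableB mO iu (iv k).
    have d1 : \int[mu]_(x in Omega) `|u x - v k x| <= 1.
      rewrite -lee_fin /Rintegral fineK; last exact: (integrable_fin_num mO (integrable_norm iuv)).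
      by apply: le_trans (ltW (uv k)) _; rewrite lee_fin.
    apply: (@le_trans _ _ (\int[mu]_(x in Omega) `|u x| + \int[mu]_(x in Omega) `|u x - v k x|)).
      rewrite -RintegralD//; [|exact: (integrable_norm iu)|exact: (integrable_norm iuv)].
      apply: le_Rintegral => //; first exact: (integrable_norm (iv k)).
        exact: (integrableD mO (integrable_norm iu) (integrable_norm iuv)).
      move=> x _; have {1}-> : v k x = u x - (u x - v k x) by ring.
      exact: ler_normB.
    by apply: le_trans (lerD (lexx _) d1) _; rewrite /C; lra.
(* An ultrafilter finer than [\oo], so that ordinary limits of sequences are also limits along U. *)
have [U [UU oU]] := ultraFilterLemma (eventually_filter).
have Ofin := lebesgue_bounded_fin bO mO.
have /choice[z Hz] i : exists z : Rd -> R, L1 Omega z /\ forall (psi : Rd -> R) (M : R),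
    measurable_fun Omega psi -> (forall x, Omega x -> `|psi x| <= M) ->
    (\int[mu]_(x in Omega) (w k x 0 i * psi x)) @[k --> U] --> \int[mu]_(x in Omega) (z x * psi x).
  have [||z iz zc] := @weak_compact _ _ _ mu Omega (fun k x => w k x 0 i) U mO Ofin _ _ UU.
  - by move=> k; exact: iw.
  - move=> e e0; have [D D0 HD] := equiintegrable c i oO bO C0 lip e0.
    by exists D => // k A mA AO; exact: HD (cw k) mA AO.
  - by exists z.
pose wl x : Rd := \row_i z i x.
have iwl : L1_field Omega wl.
  by move=> i j; rewrite /L1; under eq_fun do rewrite /= mxE; have [] := Hz j.
have cvgw (phi : Rd -> Rd) : (forall i j, tfun setT (fun x => phi x i j)) ->
    dist_of Omega (w k) phi @[k --> U] --> dist_of Omega wl phi.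
  move=> tphi; apply: (dist_of_cvg oO) => // i j; rewrite [i]ord1.
  under eq_Rintegral do rewrite mxE.
  have [_ zc] := Hz j; have [M M0 phiM] := tfun_bounded (tphi 0 j).
  apply: (zc _ M) => //; apply: measurable_funTS.
  exact: continuous_measurable_rV (tfun_continuous (tphi 0 j)).
have cvgv (psi : Rd -> R) : tfun setT psi ->
    (\int[mu]_(x in Omega) (v k x * psi x)) @[k --> U] --> \int[mu]_(x in Omega) (u x * psi x).
  exact: (dist_cvg_L1 oO _ oU).
have Elim : (energy u wl <= a%:E)%E.
  apply: energy_le => // phi psi tphi phi1 tpsi psi1.
  have h : (alpha * (weak_grad Omega (v k) phi - dist_of Omega (w k) phi) +
      beta * (sym_grad Omega (w k) psi + dist_of Omega (fun x => v k x *: c) psi)) @[k --> U] -->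
      alpha * (weak_grad Omega u phi - dist_of Omega wl phi) +
      beta * (sym_grad Omega wl psi + dist_of Omega (fun x => u x *: c) psi).
    apply: cvgD; apply: cvgMr.
      apply: cvgB; last by apply: cvgw; exact: test_field_tfunT tphi.
      by apply: cvgv; apply: (tfunS (@subsetT _ Omega)); apply: tfunN; exact: tfun_vec_div.
    apply: cvgD; first exact: (cvgw (fun x => - mat_div psi x) (tfun_opp_mat_div tpsi)).
    apply: (dist_of_cvg oO).
    - by move=> k; exact: L1_fieldZc.
    - exact: L1_fieldZc.
    - exact: test_field_tfunT tpsi.
    - move=> i j; under eq_fun => k do (under eq_Rintegral do rewrite mxE -mulrA).
      under eq_Rintegral do rewrite mxE -mulrA.
      apply: cvgv; apply: tfunZ; exact: test_field_tfunT tpsi i j.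
  have hk : a + k.+1%:R^-1 @[k --> U] --> a.
    rewrite -[X in _ --> X]addr0; apply: cvgD; first exact: cvg_cst.
    by move=> A nA; apply: oU; exact: (@cvg_harmonic R).
  apply: (ler_cvg_to h hk).
  apply: nearW => k; rewrite -lee_fin; apply: le_trans (vw k).
  exact: energy_ge.
have [G1 E1] := energy_le_parts oO alpha0 beta0 iu iwl Elim.
have uBV : BV Omega u.
  split => //; have [K HK] := dist_of_bound oO vec_space iwl.
  apply: (@le_lt_trans _ _ (a / alpha + K)%:E); last by rewrite ltry.
  apply/radon_norm_le => phi tphi phi1; rewrite lee_fin.
  have -> : weak_grad Omega u phi = (weak_grad Omega u - dist_of Omega wl)%R phi + dist_of Omega wl phi.
    by rewrite /= !fctE /= subrK.
  apply: lerD; last exact: le_trans (ler_norm _) (HK phi tphi phi1).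
  by rewrite -lee_fin; apply: le_trans G1; exact: radon_norm_ge.
have wBDl : BD Omega wl.
  split => //; have [K HK] := dist_of_bound oO sym_space (L1_fieldZc oO c iu).
  apply: (@le_lt_trans _ _ (a / beta + K)%:E); last by rewrite ltry.
  apply/radon_norm_le => phi tphi phi1; rewrite lee_fin.
  have -> : sym_grad Omega wl phi = (sym_grad Omega wl + dist_of Omega (fun x => u x *: c))%R phi - dist_of Omega (fun x => u x *: c) phi.
    by rewrite /= !fctE /= addrK.
  apply: lerD; last first.
    by have := HK phi tphi phi1; rewrite ler_norml lerNl => /andP[].
  by rewrite -lee_fin; apply: le_trans E1; exact: radon_norm_ge.
exact: le_trans (TGV_le _ _ _ uBV wBDl) Elim.
Qed.

Lemma TGV_lsc : L1_lsc Omega TGV.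
Proof.
move=> u a iu au; apply: contrapT => H.
have /choice[v Hv] k : exists v, [/\ L1 Omega v, (L1_dist Omega u v < (k.+1%:R^-1)%:E)%E &
    (TGV v <= a%:E)%E].
  apply: contrapT => nv; apply: H; exists k.+1%:R^-1; first by rewrite invr_gt0.
  move=> v iv dv; rewrite ltNge; apply/negP => va; apply: nv; by exists v.
have /choice[w Hw] k : exists w, BD Omega w /\ (energy (v k) w <= (a + k.+1%:R^-1)%:E)%E.
  have [iv _ va] := Hv k; have k0 : 0 < k.+1%:R^-1 :> R by rewrite invr_gt0.
  by have [w wBD Hw] := TGV_minimizing iv k0 va; exists w.
move: au; rewrite ltNge => /negP; apply; apply: (TGV_le_limit (v := v) (w := w)) => // k.
- by have [] := Hv k.
- by have [] := Hw k.
- by have [] := Hv k.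
- by have [] := Hw k.
Qed.

End lower_semicontinuity.

(** * The equation f'' = - k^2 f on a segment *)

Section oscillator.
Context {R : realType}.

(* Both [k f cos - f' sin] and [k f sin + f' cos] are first integrals of f'' = - k^2 f. *)
Lemma oscillator (f f1 f2 : R -> R) (k : R) :
  (forall t : R, is_derive t (1 : R) f (f1 t)) -> (forall t : R, is_derive t (1 : R) f1 (f2 t)) ->
  (forall t, `|t| <= 1 -> f2 t = - k ^+ 2 * f t) ->
  k * f 1 = k * f 0 * cos k + f1 0 * sin k /\ (k = 0 -> f 1 = f 0 + f1 0).
Proof.
move=> df df1 f2E.
have dk t : is_derive t (1 : R) (fun s : R => k * s) k.
  have := is_deriveZ k (is_derive_id t (1 : R)).
  by rewrite /GRing.scale /= mulr1.
have dkf (t : R) : is_derive t (1 : R) (fun s : R => k * f s) (k * f1 t) by exact: (is_deriveZ k (df t)).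
have sc (p q : R) : p *: q = p * q by [].
have dcos (t : R) : is_derive t (1 : R) (fun s : R => cos (k * s)) (- sin (k * t) * k).
  have := @is_derive1_comp _ cos (fun s => k * s) t _ _ (is_derive_cos _) (dk t); exact.
have dsin (t : R) : is_derive t (1 : R) (fun s : R => sin (k * s)) (cos (k * t) * k).
  have := @is_derive1_comp _ sin (fun s => k * s) t _ _ (is_derive_sin _) (dk t); exact.
have d0 (g g' : R -> R) : (forall t : R, is_derive t (1 : R) g (g' t)) -> (forall t, `|t| <= 1 -> g' t = 0) -> g 1 = g 0.
  move=> dg g0; have [t [t1 E]] := MVT_dist 0 1 dg.
  rewrite g0 ?mul0r in E; first by apply/eqP; rewrite -subr_eq0 E.
  by move: t1; rewrite !subr0 normr1.
have E1 : k * f 1 * cos k - f1 1 * sin k = k * f 0.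
  have := d0 (fun t => k * f t * cos (k * t) - f1 t * sin (k * t))
    (fun t => - (f2 t + k ^+ 2 * f t) * sin (k * t)).
  rewrite !mulr1 !mulr0 cos0 sin0 mulr1 mulr0 subr0; apply.
    move=> t; apply: (@is_derive_eq _ _ _ _ _ _ _ _ (is_deriveB (is_deriveM (dkf t) (dcos t)) (is_deriveM (df1 t) (dsin t)))).
    by rewrite !sc; ring.
  by move=> t t1; rewrite f2E//; ring.
have E2 : k * f 1 * sin k + f1 1 * cos k = f1 0.
  have := d0 (fun t => k * f t * sin (k * t) + f1 t * cos (k * t))
    (fun t => (f2 t + k ^+ 2 * f t) * cos (k * t)).
  rewrite !mulr1 !mulr0 cos0 sin0 mulr1 mulr0 add0r; apply.
    move=> t; apply: (@is_derive_eq _ _ _ _ _ _ _ _ (is_deriveD (is_deriveM (dkf t) (dsin t)) (is_deriveM (df1 t) (dcos t)))).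
    by rewrite !sc; ring.
  by move=> t t1; rewrite f2E//; ring.
split.
  (* The two first integrals are solved for k f(1) by a rotation of angle k. *)
  rewrite -E1 -E2 -[LHS]mulr1 -(cos2Dsin2 k); ring.
move=> k0; have f10 : forall t, `|t| <= 1 -> f2 t = 0.
  by move=> t t1; rewrite f2E// k0; ring.
(* For k = 0 the conserved quantities are f' and f - t f'. *)
have H : f 1 - 1 * f1 1 = f 0 - 0 * f1 0.
  apply: (d0 (fun t => f t - t * f1 t) (fun t => - t * f2 t)).
    move=> t; apply: (@is_derive_eq _ _ _ _ _ _ _ _ (is_deriveB (df t) (is_deriveM (is_derive_id t (1 : R)) (df1 t)))).
    by rewrite !sc; ring.
  by move=> t t1; rewrite f10// mulr0.
rewrite -(d0 f1 f2 df1 f10); move: H; rewrite mul1r mul0r subr0 => <-; by rewrite subrK.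
Qed.

End oscillator.

(** * Smooth solutions of Hess f = - omega omega^T f *)

Section hessian.
Context {R : realType} {d : nat}.
Local Notation Rd := 'rV[R]_d.
Variable omega : Rd.

Definition hess_on (A : set Rd) (f : Rd -> R) : Prop := forall i j y, A y ->
  partial j (partial i f) y = - (omega 0 i * omega 0 j) * f y.

Lemma inner_row (x y : Rd) : inner x y = \sum_i x 0 i * y 0 i.
Proof. by rewrite /inner big_ord1. Qed.

(** Along the segment f solves the oscillator equation with frequency omega . h. The identity is
    multiplied by k, and k = 0 stated apart, so that no division by k occurs. *)
Lemma hess_line (A : set Rd) f x h : smooth f -> hess_on A f ->
  (forall t : R, `|t| <= 1 -> A (x + t *: h)) ->
  let k := inner omega h in let D := \sum_i h 0 i * partial i f x in
  k * f (x + h) = k * f x * cos k + D * sin k /\ (k = 0 -> f (x + h) = f x + D).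
Proof.
move=> sf Hf Ah k D.
pose f1 (t : R) := \sum_i h 0 i * partial i f (x + t *: h).
pose f2 (t : R) := \sum_i h 0 i * \sum_j h 0 j * partial j (partial i f) (x + t *: h).
have df (t : R) : is_derive t (1 : R) (fun s : R => f (x + s *: h)) (f1 t).
  by apply: is_derive_along; exact: (sf 1%N).
have df1 (t : R) : is_derive t (1 : R) f1 (f2 t).
  have H i : is_derive t (1 : R) (fun s : R => h 0 i * partial i f (x + s *: h))
      (h 0 i * \sum_j h 0 j * partial j (partial i f) (x + t *: h)).
    by apply: is_deriveZ; apply: is_derive_along; exact: (smooth_partial i sf 1%N).
  by have := is_derive_sum H; rewrite fct_sumE.
have f2E (t : R) : `|t| <= 1 -> f2 t = - k ^+ 2 * f (x + t *: h).
  move=> t1; rewrite /f2 /k inner_row expr2 mulr_suml -sumrN mulr_suml.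
  apply: eq_bigr => i _.
  rewrite (eq_bigr (fun j => - omega 0 i * f (x + t *: h) * (omega 0 j * h 0 j))).
    by rewrite -mulr_sumr; ring.
  by move=> j _; rewrite Hf; [ring|exact: Ah].
have [] := oscillator df df1 f2E.
have -> : f1 0 = D by apply: eq_bigr => i _; rewrite scale0r addr0.
by rewrite !scale1r !scale0r !addr0.
Qed.

(** The first-derivative terms at h and - h cancel. *)
Lemma hess_even (A : set Rd) f x h : smooth f -> hess_on A f ->
  (forall t : R, `|t| <= 1 -> A (x + t *: h)) ->
  f (x + h) + f (x - h) = 2 * f x * cos (inner omega h).
Proof.
move=> sf Hf Ah.
have Ah' (t : R) : `|t| <= 1 -> A (x + t *: - h).
  by move=> t1; rewrite scalerN -scaleNr; apply: Ah; rewrite normrN.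
have [E1 E1'] := hess_line sf Hf Ah; have [E2 E2'] := hess_line sf Hf Ah'.
have DN : \sum_i (- h) 0 i * partial i f x = - \sum_i h 0 i * partial i f x.
  by rewrite -sumrN; apply: eq_bigr => i _; rewrite mxE mulNr.
move: E1 E1' E2 E2'; rewrite DN innerNr cosN sinN; set k := inner omega h; set D := \sum_i _.
move=> E1 E1' E2 E2'; have [k0|k0] := eqVneq k 0.
  by rewrite E1'// E2' ?k0 ?oppr0// cos0; ring.
have E3 : k * f (x - h) = k * f x * cos k - D * sin k.
  by apply: oppr_inj; rewrite -mulNr E2; ring.
by apply: (mulfI k0); rewrite mulrDr E1 E3; ring.
Qed.

Lemma hess_unique f x y : smooth f -> hess_on setT f -> f x = 0 ->
  (forall i, partial i f x = 0) -> f y = 0.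
Proof.
move=> sf Hf fx dfx.
have [] := @hess_line setT f x (y - x) sf Hf (fun _ _ => I).
rewrite subrKC big1 => [|i _]; last by rewrite dfx mulr0.
rewrite fx mulr0 !mul0r addr0 => E1 E2.
have [k0|k0] := eqVneq (inner omega (y - x)) 0; first by rewrite E2// addr0.
by apply: (mulfI k0); rewrite E1 mulr0.
Qed.

(* Differentiating the equation once more and permuting the third derivatives
   forces the gradient to be parallel to omega. *)
Lemma hess_grad (x0 : Rd) (r : R) f i k : 0 < r -> smooth f -> hess_on (cbox x0 r) f ->
  omega != 0 -> omega 0 k * partial i f x0 = omega 0 i * partial k f x0.
Proof.
move=> r0 sf Hf w0.
have [j wj] : exists j, omega 0 j != 0.
  apply: contrapT => nj; move/negP: w0; apply; apply/eqP/rowP => j; rewrite mxE.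
  by apply: contrapT => /eqP wj; apply: nj; exists j.
have T a b c : partial c (partial b (partial a f)) x0 = - (omega 0 a * omega 0 b) * partial c f x0.
  transitivity (partial c (fun y => - (omega 0 a * omega 0 b) * f y) x0); last by rewrite partialZ.
  apply: near_eq_derive;  by apply/nbhs_cboxP; exists r => // y yr; exact: Hf.
have C2 (g : Rd -> R) a b : smooth g -> partial a (partial b g) = partial b (partial a g).
  by move=> sg; apply/funext => y; rewrite partialC//; exact: (sg 2%N).
have : partial k (partial j (partial i f)) x0 = partial i (partial j (partial k f)) x0.
  by rewrite (C2 _ j i sf) (C2 _ k i (smooth_partial j sf)) (C2 _ k j sf).
rewrite !T !mulNr => /oppr_inj E; apply: (mulfI wj).
by rewrite !mulrA ![omega 0 j * _]mulrC E.
Qed.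

(** The two kernels of the theorem in one set, so that local representation and gluing are carried
    out once; members are functions on all of R^d. *)
Definition oscillations : set (Rd -> R) :=
  if omega == 0 then [set g | exists (a : Rd) (b : R), g = fun x => inner a x + b]
  else [set g | exists C1 C2 : R,
    g = fun x => C1 * cos (inner omega x) + C2 * sin (inner omega x)].

(** For omega nonzero, [hess_grad] makes the gradient at x0 parallel to omega, so the values of f
    along segments from x0 depend on the phase omega . y alone. For omega = 0, f is affine along
    every such segment. *)
Lemma hess_rep (x0 : Rd) (r : R) f : 0 < r -> smooth f -> hess_on (cbox x0 r) f ->
  exists2 g, oscillations g & forall y, cbox x0 r y -> f y = g y.
Proof.
move=> r0 sf Hf.
have Ah y : cbox x0 r y -> forall t : R, `|t| <= 1 -> cbox x0 r (x0 + t *: (y - x0)).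
  move=> yr t t1 i; have := yr i; rewrite !mxE addrAC subrr add0r => yri.
  by rewrite normrM; apply: le_trans yri; rewrite ler_piMl.
rewrite /oscillations; case: eqVneq => [w0|w0].
  pose a : Rd := \row_i partial i f x0.
  exists (fun x => inner a x + (f x0 - inner a x0)); first by exists a, (f x0 - inner a x0).
  move=> y yr; have [_] := hess_line sf Hf (Ah y yr).
  rewrite subrKC => ->; last by rewrite w0 inner_row big1// => i _; rewrite mxE mul0r.
  rewrite addrCA -innerNr -innerDr; congr (_ + _).
  by rewrite inner_row; apply: eq_bigr => i _; rewrite [a _ _]mxE mulrC.
pose S := \sum_k omega 0 k * partial k f x0.
pose N := inner omega omega.
have N0 : N != 0.
  apply/eqP => N0; move/negP: w0; apply; apply/eqP/rowP => i; rewrite mxE.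
  have : omega 0 i * omega 0 i <= 0.
    rewrite -N0 /N inner_row (bigD1 i)//= lerDl sumr_ge0// => j _.
    by rewrite -expr2 sqr_ge0.
  by rewrite -expr2 => h; apply/eqP; rewrite -sqrf_eq0 eq_le h sqr_ge0.
have aE i : N * partial i f x0 = omega 0 i * S.
  rewrite /N inner_row mulr_suml mulr_sumr; apply: eq_bigr => k _.
  by rewrite -mulrA (hess_grad i k r0 sf Hf w0) mulrCA.
have DE (h : Rd) : N * \sum_i h 0 i * partial i f x0 = inner omega h * S.
  rewrite mulr_sumr inner_row mulr_suml; apply: eq_bigr => i _.
  by rewrite mulrCA aE; ring.
(* l is the derivative of f at x0 with respect to the phase; the addition formulas turn f(x0) cos(k
   - k0) + l sin(k - k0) into the claimed form. *)
pose l := S / N; pose k0 := inner omega x0.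
exists (fun x => (f x0 * cos k0 - l * sin k0) * cos (inner omega x) +
   (f x0 * sin k0 + l * cos k0) * sin (inner omega x)); first by do 2 eexists.
move=> y yr; have [] := hess_line sf Hf (Ah y yr).
rewrite subrKC innerDr innerNr -/k0; set k := inner omega y.
have -> : \sum_i (y - x0) 0 i * partial i f x0 = (k - k0) * l.
  apply: (mulfI N0); rewrite DE innerDr innerNr -/k -/k0 /l; field.
  exact: N0.
move=> E1 E2; transitivity (f x0 * cos (k - k0) + l * sin (k - k0)).
  have [kk|kk] := eqVneq (k - k0) 0; first by rewrite E2// kk cos0 sin0; ring.
  by apply: (mulfI kk); rewrite E1; ring.
by rewrite cosB sinB; ring.
Qed.

Definition osc (a b : R) (x : Rd) := a * cos (inner omega x) + b * sin (inner omega x).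

Lemma smooth_inner : smooth (fun x : Rd => inner omega x).
Proof.
rewrite (_ : (fun x => _) = (fun x : Rd => \sum_i omega 0 i * x 0 i)); last first.
  by apply/funext => x; rewrite inner_row.
by apply: smooth_sum => i; apply: smoothZ; exact: smooth_coord.
Qed.

(** Differentiation acts on the coefficients (a, b) only; smoothness and the equation follow from
    this. *)
Lemma is_derive_osc i (a b : R) (x : Rd) :
  is_derive x (delta_mx 0 i : Rd) (osc a b) (osc (b * omega 0 i) (- a * omega 0 i) x).
Proof.
have := (is_derive_lineP (osc a b) x (delta_mx 0 i : Rd) 0 (osc (b * omega 0 i) (- a * omega 0 i) x)).2.
rewrite scale0r addr0; apply.
pose c0 := inner omega x; pose m := omega 0 i.
have E (s : R) : inner omega (x + s *: delta_mx 0 i) = c0 + s * m.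
  rewrite innerDr innerZr; congr (_ + _ * _); rewrite inner_row (bigD1 i)//= mxE !eqxx mulr1.
  by rewrite big1 ?addr0// => j ji; rewrite mxE (negbTE ji) andbF mulr0.
rewrite /osc; under eq_fun => s do rewrite E.
have da : is_derive (0 : R) (1 : R) (fun s : R => c0 + s * m) m := is_derive_affine c0 m 0.
have dc := @is_derive1_comp _ cos (fun s : R => c0 + s * m) 0 _ _ (is_derive_cos _) da.
have ds := @is_derive1_comp _ sin (fun s : R => c0 + s * m) 0 _ _ (is_derive_sin _) da.
apply: (@is_derive_eq _ _ _ _ _ _ _ _ (is_deriveD (is_deriveZ a dc) (is_deriveZ b ds))).
have sc (p q : R) : p *: q = p * q by [].
by rewrite !sc mul0r addr0 -/c0 -/m; ring.
Qed.

Lemma partial_osc i (a b : R) : partial i (osc a b) = osc (b * omega 0 i) (- a * omega 0 i).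
Proof. by apply/funext => x; have [] := is_derive_osc i a b x. Qed.

Lemma smooth_osc (a b : R) : smooth (osc a b).
Proof.
have ci : continuous (fun x : Rd => inner omega x) by exact: smooth_continuous smooth_inner.
have co (p q : R) : continuous (osc p q).
  have c1 : continuous (fun x : Rd => cos (inner omega x)).
    by move=> x; apply: continuous_comp; [exact: ci|exact: continuous_cos].
  have c2 : continuous (fun x : Rd => sin (inner omega x)).
    by move=> x; apply: continuous_comp; [exact: ci|exact: continuous_sin].
  move=> x; exact: (cvgD (cvgMr (c1 x)) (cvgMr (c2 x))).
move=> k; elim: k a b => [|k IH] a b; first by split.
split=> [|i]; first exact: co.
by split=> [x|]; [have [] := is_derive_osc i a b x|rewrite partial_osc].
Qed.

Lemma partial_inner (a : Rd) (b : R) i : partial i (fun x : Rd => inner a x + b) = cst (a 0 i).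
Proof.
apply/funext => x.
have := (is_derive_lineP (fun x : Rd => inner a x + b) x (delta_mx 0 i : Rd) 0 (a 0 i)).2.
rewrite scale0r addr0 => H.
suff /H[] : is_derive (0 : R) (1 : R) (fun s : R => inner a (x + s *: delta_mx 0 i) + b) (a 0 i) by [].
have E (s : R) : inner a (x + s *: delta_mx 0 i) + b = (inner a x + b) + s * a 0 i.
  rewrite innerDr innerZr addrAC; congr (_ + _ * _); rewrite inner_row (bigD1 i)//= mxE !eqxx mulr1.
  by rewrite big1 ?addr0// => j ji; rewrite mxE (negbTE ji) andbF mulr0.
under eq_fun => s do rewrite E.
exact: is_derive_affine.
Qed.

End hessian.

(** * Stability and unique continuation of oscillations *)

Section oscillations.
Context {R : realType} {d : nat}.
Local Notation Rd := 'rV[R]_d.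
Variable omega : Rd.

Lemma oscillations_smooth g : oscillations omega g -> smooth g /\ hess_on omega setT g.
Proof.
rewrite /oscillations; case: eqVneq => [w0|w0] [a [b ->]]; split.
- apply: smoothD; [exact: smooth_inner|exact: smooth_cst].
- move=> i j y _; rewrite partial_inner partial_cst; rewrite w0.
  by rewrite !mxE mul0r oppr0 mul0r.
- exact: smooth_osc.
- move=> i j y _; rewrite -/(osc omega a b) !partial_osc /osc; ring.
Qed.

Lemma oscillationsZ (k : R) g : oscillations omega g -> oscillations omega (fun x => k * g x).
Proof.
rewrite /oscillations; case: eqVneq => [w0|w0] [a [b ->]].
  exists (k *: a), (k * b); apply/funext => x.
  by rewrite [inner (k *: a) x]innerC innerZr [inner x a]innerC mulrDr.
by exists (k * a), (k * b); apply/funext => x; ring.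
Qed.

Lemma oscillations_opp g : oscillations omega g -> oscillations omega (fun x => g (- x)).
Proof.
rewrite /oscillations; case: eqVneq => [w0|w0] [a [b ->]].
  exists (- a), b; apply/funext => x.
  by rewrite innerNr [inner (- a) x]innerC innerNr innerC.
by exists a, (- b); apply/funext => x; rewrite innerNr cosN sinN; ring.
Qed.

(** The difference solves the same linear equation on R^d and vanishes to first order at x. *)
Lemma oscillations_unique g h (x : Rd) : oscillations omega g -> oscillations omega h ->
  (\forall y \near x, g y = h y) -> g = h.
Proof.
move=> /oscillations_smooth[sg Hg] /oscillations_smooth[sh Hh] gh.
pose f x := g x + -1 * h x.
have sf : smooth f by apply: smoothD => //; exact: smoothZ.
have pf i : partial i f = (fun x => partial i g x + -1 * partial i h x).
  rewrite partialD; [|by move=> y; exact: smooth_derivable|by move=> y; exact: smooth_derivable (smoothZ _ sh)].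
  by rewrite partialZ.
have Hf : hess_on omega setT f.
  move=> i j y _; rewrite pf partialD; last 2 first.
  - by move=> z; exact: smooth_derivable (smooth_partial i sg).
  - by move=> z; exact: smooth_derivable (smoothZ _ (smooth_partial i sh)).
  by rewrite partialZ ?Hg ?Hh//; [rewrite /f; ring|exact: smooth_partial].
have near0 : \forall y \near x, f y = 0.
  by apply: filterS gh => y E; rewrite /f E mulN1r subrr.
have fx : f x = 0 by exact: nbhs_singleton near0.
have dfx i : partial i f x = 0.
  transitivity (partial i (cst 0 : Rd -> R) x); first exact: near_eq_derive near0.
  by rewrite partial_cst.
apply/funext => y; have := hess_unique y sf Hf fx dfx.
by rewrite /f mulN1r => /eqP; rewrite subr_eq0 => /eqP.
Qed.

End oscillations.

(** * Fubini with a bounded kernel, and the fundamental lemma of the calculus of variations *)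

Lemma fubini_bounded d1 d2 (T1 : measurableType d1) (T2 : measurableType d2) (R : realType)
    (m1 : {sigma_finite_measure set T1 -> \bar R}) (m2 : {sigma_finite_measure set T2 -> \bar R})
    (a : T1 -> R) (b : T2 -> R) (K : T1 * T2 -> R) (M : R) :
  m1.-integrable setT (EFin \o a) -> m2.-integrable setT (EFin \o b) ->
  measurable_fun setT K -> (forall z, `|K z| <= M) ->
  \int[m1]_y (a y * \int[m2]_z (b z * K (y, z))) =
  \int[m2]_z (b z * \int[m1]_y (a y * K (y, z))).
Proof.
move=> ia ib mK KM.
have iF : (m1 \x m2)%E.-integrable setT (EFin \o (fun z => K z * (a z.1 * b z.2))).
  by apply: (integrable_bddM measurableT mK _ (integrable_prod ia ib)) => z _; exact: KM.
have ib' y : m2.-integrable setT (EFin \o (fun z => b z * K (y, z))).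
  under eq_fun do rewrite mulrC.
  apply: (integrable_bddM measurableT (M := M) _ _ ib) => //.
  by apply: (measurableT_comp mK); exact: pair1_measurable.
have ia' z : m1.-integrable setT (EFin \o (fun y => a y * K (y, z))).
  under eq_fun do rewrite mulrC.
  apply: (integrable_bddM measurableT (M := M) _ _ ia) => //.
  by apply: (measurableT_comp mK); exact: pair2_measurable.
have E1 := integral12_prod_meas1 iF; have E2 := integral21_prod_meas1 iF.
rewrite /Rintegral.
rewrite (_ : (\int[m1]_y _)%E = (\int[m1 \x m2]_z (K z * (a z.1 * b z.2))%:E)%E); last first.
  rewrite -E1; apply: eq_integral => y _; rewrite /fubini_F /= EFinM fineK; last first.
    exact: (integrable_fin_num measurableT (ib' y)).
  rewrite -(integralZl measurableT (ib' y)); apply: eq_integral => z _.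
  by rewrite -EFinM; congr EFin; ring.
rewrite -E2; congr fine; apply: eq_integral => z _; rewrite /fubini_G /= EFinM fineK; last first.
  exact: (integrable_fin_num measurableT (ia' z)).
rewrite -(integralZl measurableT (ia' z)); apply: eq_integral => y _.
by rewrite -EFinM; congr EFin; ring.
Qed.

Section weak_zero.
Context {R : realType} {d : nat}.
Local Notation Rd := 'rV[R]_d.
Local Notation mu := (@lebesgue_rV R d).

(** [set_bound] with e = D = 0 makes the integral over every measurable subset vanish. *)
Lemma ae_eq0_of_tfun (Omega : set Rd) f : open Omega -> (mu Omega < +oo)%E -> L1 Omega f ->
  (forall psi, tfun Omega psi -> \int[mu]_(x in Omega) (f x * psi x) = 0) ->
  {ae mu, forall x, Omega x -> f x = 0}.
Proof.
move=> oO Ofin iF H; have mO := open_measurable_rV oO.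
have : ae_eq mu Omega (EFin \o f) (cst 0%E).
  apply: integral_ae_eq => // E EO mE.
  have := set_bound oO oO (@subset_refl _ Omega) Ofin (lexx 0) iF _ mE EO (e := 0).
  rewrite add0r mul0r => h; have {}h : \int[mu]_(x in E) f x = 0.
    apply/eqP; rewrite -normr_le0; apply: h => psi tpsi _.
    by rewrite H// normr0 mul0r addr0.
  rewrite integral0; move: h; rewrite /Rintegral => h.
  rewrite -(fineK (_ : (\int[mu]_(x in E) (f x)%:E)%E \is a fin_num)) ?h//.
  by apply: (integrable_fin_num mE); apply: integrableS iF.
by apply: filterS => x /= h Ox; have [] := h Ox.
Qed.

Lemma continuous_L1 (A : set Rd) (g : Rd -> R) : bounded_set A -> measurable A ->
  continuous g -> L1 A g.
Proof.
move=> bA mA cg; have [r Ar] := bounded_subset_cbox bA.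
have /compact_bounded[M [_ HM]] : compact (g @` cbox 0 r).
  by apply: continuous_compact; [exact: continuous_subspaceT|exact: cbox_compact].
rewrite /L1; apply: measurable_bounded_integrable => //.
- exact: lebesgue_bounded_fin.
- by apply: measurable_funTS; exact: continuous_measurable_rV.
- exists M; split; first exact: num_real.
  by move=> y My x Ax; apply: HM => //; exists x => //; exact: Ar.
Qed.

End weak_zero.

Section convolution_adjoint.
Context {R : realType} {d : nat}.
Local Notation Rd := 'rV[R]_d.
Local Notation mu := (@lebesgue_rV R d).

Lemma measurable_sub : measurable_fun setT (fun z : Rd * Rd => z.1 - z.2).
Proof.
apply: measurable_fun_rV => i; under eq_fun do rewrite !mxE.
apply: measurable_funB; apply: (measurableT_comp (f := fun x : Rd => x 0 i : measurableTypeR R)).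
- exact: measurable_coor.
- exact: measurable_fst.
- exact: measurable_coor.
- exact: measurable_snd.
Qed.

(** Both sides are double integrals over y and a second variable, related by the substitution z = y
    - h; this trades averaging of psi for averaging of theta. *)
Lemma convolution_adjoint (a theta psi : Rd -> R) : mu.-integrable setT (EFin \o a) ->
  tfun setT theta -> tfun setT psi ->
  \int[mu]_h (theta h * \int[mu]_y (a y * psi (y - h))) =
  \int[mu]_z (psi z * \int[mu]_y (a y * theta (y - z))).
Proof.
move=> ia ttheta tpsi.
have [M _ psiM] := tfun_bounded tpsi; have [M' _ thM] := tfun_bounded ttheta.
have mth := continuous_measurable_rV (tfun_continuous ttheta).
have mpsi := continuous_measurable_rV (tfun_continuous tpsi).
transitivity (\int[mu]_y (a y * \int[mu]_h (theta h * psi (y - h)))).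
  exact: esym (fubini_bounded ia (tfun_integrable ttheta) (measurableT_comp mpsi measurable_sub)
    (fun z => psiM (z.1 - z.2))).
transitivity (\int[mu]_y (a y * \int[mu]_z (psi z * theta (y - z)))).
  apply: eq_Rintegral => y _; congr (_ * _).
  have mf : measurable_fun setT (fun h => theta h * psi (y - h)).
    apply: (measurable_funM mth); apply: (measurableT_comp mpsi).
    by have := @measurable_affine_rV R d y (-1); under eq_fun do rewrite scaleN1r.
  rewrite -(Rintegral_isometry y (normrN1 R) mf).
  by apply: eq_Rintegral => z _; rewrite scaleN1r mulrC opprB [y + _]addrC subrK.
exact: (fubini_bounded ia (tfun_integrable tpsi) (measurableT_comp mth measurable_sub)
    (fun z => thM (z.1 - z.2))).
Qed.

End convolution_adjoint.

(** * Weak solutions are locally oscillations *)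

Section local_representation.
Context {R : realType} {d : nat}.
Local Notation Rd := 'rV[R]_d.
Local Notation mu := (@lebesgue_rV R d).
Variables (omega : Rd) (Omega : set Rd) (u : Rd -> R).
Hypotheses (oO : open Omega) (iu : L1 Omega u).

(** Weak form of Hess u = - omega omega^T u. *)
Definition weak_hess : Prop := forall i j eta, tfun Omega eta ->
  \int[mu]_(x in Omega)
    (u x * (partial j (partial i eta) x + omega 0 i * omega 0 j * eta x)) = 0.

Hypothesis wh : weak_hess.

Let mO : measurable Omega := open_measurable_rV oO.
Let ut (x : Rd) : R := \1_Omega x * u x.

Lemma integrable_extend : mu.-integrable setT (EFin \o ut).
Proof.
rewrite (_ : EFin \o ut = (EFin \o u) \_ Omega); first exact: (iffLR (integrable_mkcond _ mO)).
apply/funext => x; rewrite patchE /ut /= indicE.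
by case: (x \in Omega); rewrite ?mul1r// mul0r.
Qed.

Let Phi psi := average mu ut id psi.

Lemma PhiE psi v : Phi psi v = \int[mu]_(x in Omega) (u x * psi (x + v)).
Proof.
rewrite (RintegralIl _ (@subsetT _ Omega)); apply: eq_Rintegral => x _.
by rewrite /ut /= mulrA [v + x]addrC.
Qed.

(** Both derivatives in v fall on the translate psi(. + v), which is a test function of Omega for v
    in A; the weak equation of u thus becomes a pointwise one for a smooth function. *)
Lemma hess_average psi (A : set Rd) : tfun setT psi ->
  (forall v, A v -> tfun Omega (fun x => psi (x + v))) -> hess_on omega A (Phi psi).
Proof.
move=> tpsi tA i j v Av; rewrite /Phi partial_average//; last exact: integrable_extend.
rewrite partial_average//; [|exact: integrable_extend|exact: tfun_partial].
rewrite -/(Phi _) -/(Phi _) !PhiE; have teta := tA v Av.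
have := wh i j teta; rewrite !partial_shift.
have i1 : mu.-integrable Omega (EFin \o (fun x => u x * partial j (partial i psi) (x + v))).
  have := L1_mul oO iu (tfunS (@subsetT _ Omega) (tfun_partial j (tfun_partial i teta))).
  by rewrite !partial_shift.
have i2 : mu.-integrable Omega (EFin \o (fun x => u x * psi (x + v))).
  exact: (L1_mul oO iu (tfunS (@subsetT _ Omega) teta)).
rewrite (_ : \int[mu]_(x in Omega) _ = \int[mu]_(x in Omega) (u x * partial j (partial i psi) (x + v)) +
   omega 0 i * omega 0 j * \int[mu]_(x in Omega) (u x * psi (x + v))).
  by move/eqP; rewrite addr_eq0 => /eqP ->; rewrite mulNr.
rewrite -RintegralZl// -RintegralD//; last exact: (integrableZl mO _ i2).
by apply: eq_Rintegral => x _; ring.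
Qed.

Section mollified.
Variables (r : R) (psi theta : Rd -> R).
Hypothesis tpsi : tfun setT psi.
Hypothesis psiO : forall v, cbox 0 r v -> tfun Omega (fun x => psi (x + v)).

Hypothesis ttheta : tfun setT theta.
Hypothesis theta_even : forall x, theta (- x) = theta x.
Hypothesis th0 : forall x, ~ cbox 0 r x -> theta x = 0.

(* Evenness of theta symmetrizes Phi psi, for which hess_even applies. *)
Lemma mollify : \int[mu]_(x in Omega) (u x * psi x) * \int[mu]_h (theta h * cos (inner omega h)) =
  \int[mu]_z (psi z * Phi theta (- z)).
Proof.
have aux (p q X : R) : X + X = 2 * p * q -> p * q = X by move=> h; lra.
have iut := integrable_extend.
have sPhi := smooth_average iut (@measurable_id _ _ setT) tpsi.
have HPhi := hess_average tpsi psiO.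
have mth := continuous_measurable_rV (tfun_continuous ttheta).
have mpsi := continuous_measurable_rV (tfun_continuous tpsi).
have mPhi := continuous_measurable_rV (smooth_continuous sPhi).
have Ph0 : \int[mu]_(x in Omega) (u x * psi x) = Phi psi 0.
  by rewrite PhiE; apply: eq_Rintegral => x _; rewrite addr0.
have i1 : mu.-integrable setT (EFin \o (fun h => theta h * Phi psi h)).
  under eq_fun do rewrite mulrC.
  by have := tfun_integrable (tfunM sPhi ttheta).
have i2 : mu.-integrable setT (EFin \o (fun h => theta h * Phi psi (- h))).
  under eq_fun do rewrite mulrC.
  have sN : smooth (fun h => Phi psi (0 + -1 *: h)) by exact: smooth_affine.
  have := tfun_integrable (tfunM sN ttheta).
  by under eq_fun do rewrite scaleN1r add0r.
have i3 : mu.-integrable setT (EFin \o (fun h => theta h * cos (inner omega h))).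
  under eq_fun do rewrite mulrC.
  have sc : smooth (fun x : Rd => cos (inner omega x)).
    have := smooth_osc omega 1 0; rewrite /osc.
    by under eq_fun do rewrite mul1r mul0r addr0.
  by have := tfun_integrable (tfunM sc ttheta).
have E1 : \int[mu]_h (theta h * Phi psi (- h)) = \int[mu]_h (theta h * Phi psi h).
  rewrite -(@Rintegral_oppose _ _ (fun h => theta h * Phi psi h)); last exact: measurable_funM.
  by apply: eq_Rintegral => h _; rewrite theta_even.
have E2 : \int[mu]_h (theta h * Phi psi h) + \int[mu]_h (theta h * Phi psi (- h)) =
    2 * Phi psi 0 * \int[mu]_h (theta h * cos (inner omega h)).
  rewrite -(RintegralD measurableT i1 i2) -(RintegralZl _ measurableT i3); apply: eq_Rintegral => h _.
  have [hr|hr] := pselect (cbox 0 r h); last by rewrite (th0 hr) !mul0r mulr0 addr0.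
  have Ah (t : R) : `|t| <= 1 -> cbox 0 r (0 + t *: h).
    move=> t1 i; have := hr i; rewrite !mxE add0r !subr0 normrM => hri.
    by apply: le_trans hri; rewrite ler_piMl.
  have E : Phi psi h + Phi psi (- h) = 2 * Phi psi 0 * cos (inner omega h).
    by have := hess_even sPhi HPhi Ah; rewrite add0r sub0r.
  by rewrite -mulrDr E mulrCA.
have E3 : Phi psi 0 * \int[mu]_h (theta h * cos (inner omega h)) = \int[mu]_h (theta h * Phi psi (- h)).
  by rewrite E1 in E2 *; exact: aux.
rewrite Ph0 E3.
transitivity (\int[mu]_h (theta h * \int[mu]_y (ut y * psi (y - h)))).
  apply: eq_Rintegral => h _; congr (_ * _); apply: eq_Rintegral => y _.
  by rewrite [- h + _]addrC.
rewrite (convolution_adjoint iut ttheta tpsi).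
apply: eq_Rintegral => z _; congr (_ * _); apply: eq_Rintegral => y _.
by rewrite [- z + _]addrC.
Qed.

End mollified.

(** Used twice: with c = x0 for psi near x0 and small v, and with c = 0 for the mollifier and v near
    - x0. In both cases the translated support lies within 2 r of x0. *)
Lemma tfun_translate psi (x0 c v : Rd) (r : R) : smooth psi -> cbox x0 (r + r) `<=` Omega ->
  (forall x, ~ cbox c r x -> psi x = 0) -> cbox (c - x0) r v ->
  tfun Omega (fun x => psi (x + v)).
Proof.
move=> spsi xO psi0 vr; split; first exact: smooth_shift.
exists (cbox (c - v) r).
  split; first exact: cbox_compact.
  apply: subset_trans xO => y yr i; have := yr i; have := vr i; rewrite !mxE => h1 h2.
  have -> : y 0 i - x0 0 i = (y 0 i - (c 0 i - v 0 i)) - (v 0 i - (c 0 i - x0 0 i)) by ring.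
  by apply: le_trans (ler_normB _ _) _; exact: lerD.
move=> x nx; apply: psi0 => xc; apply: nx => i; have := xc i; rewrite !mxE.
by rewrite opprB addrA addrAC.
Qed.

(** [mollify] for all psi supported near x0 says that P u is the mollification of u there, which
    solves the equation classically and so is an oscillation by [hess_rep]. *)
Lemma local_oscillation x0 : Omega x0 -> exists2 r : R, 0 < r &
  exists2 g, oscillations omega g & {ae mu, forall x, obox x0 r x -> u x = g x}.
Proof.
move=> Ox0.
have [e e0 eO] : exists2 e : R, 0 < e & cbox x0 e `<=` Omega.
  by apply/nbhs_cboxP; exact: open_nbhs_nbhs.
pose S := \sum_i `|omega 0 i|; have S0 : 0 <= S by exact: sumr_ge0.
(* The first bound keeps 2 r <= e; the second gives |omega . h| < 1 <= pi / 2 on the support of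
   theta, so that the cosine is positive there. *)
pose r := Num.min (e / 2) ((S + 1)^-1 / 2).
have S1 : 0 < S + 1 by rewrite ltr_wpDl.
have r0 : 0 < r by rewrite lt_min !divr_gt0// invr_gt0.
have rO : cbox x0 (r + r) `<=` Omega.
  apply: subset_trans eO => y yr i; apply: le_trans (yr i) _.
  rewrite [leRHS](splitr e); apply: lerD; by rewrite ge_min lexx.
have rS : r * S < 1.
  apply: (@le_lt_trans _ _ ((S + 1)^-1 / 2 * S)); first by rewrite ler_wpM2r// ge_min lexx orbT.
  by rewrite -mulrA ltr_pdivrMl// mulr1; lra.
pose theta : Rd -> R := obump 0 r 1.
have ttheta : tfun setT theta := tfun_obump 0 r ler01.
have th0 h : ~ cbox 0 r h -> theta h = 0.
  by move=> hr; apply: obump_eq0 => // /subset_obox_cbox.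
have cosP h : cbox 0 r h -> 0 < cos (inner omega h).
  move=> hr; apply: cos_gt0_pihalf; rewrite -ltr_norml.
  apply: lt_le_trans (pihalf_ge1 R); apply: le_lt_trans rS.
  rewrite inner_row mulr_sumr; apply: le_trans (ler_norm_sum _ _ _) _.
  apply: ler_sum => i _; rewrite normrM mulrC ler_wpM2r//.
  by have := hr i; rewrite mxE subr0.
pose P := \int[mu]_h (theta h * cos (inner omega h)).
have sc : smooth (fun x : Rd => cos (inner omega x)).
  have := smooth_osc omega 1 0; rewrite /osc.
  by under eq_fun do rewrite mul1r mul0r addr0.
have P0 : 0 < P.
  apply: (Rintegral_gt0 (c := 0)).
  - under eq_fun do rewrite mulrC.
    by have := tfun_integrable (tfunM sc ttheta).
  - apply: smooth_continuous; apply: smoothM => //; exact: ttheta.1.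
  - move=> h; have [hr|hr] := pselect (cbox 0 r h); last by rewrite th0// mul0r.
    by rewrite mulr_ge0// ?obump_ge0// ltW// cosP.
  - rewrite mulr_gt0//; first by apply: obump_gt0 => // i; rewrite mxE subr0 normr0.
    by apply: cosP => i; rewrite !mxE subr0 normr0 ltW.
(* The mollification of u at z is [Phi theta] at - z, hence the box around - x0. *)
have HW : hess_on omega (cbox (- x0) r) (Phi theta).
  apply: hess_average => // v vr; apply: (@tfun_translate theta x0 0 v r) => //.
    exact: ttheta.1.
  by rewrite sub0r.
have [g og gW] := hess_rep r0 (smooth_average integrable_extend (@measurable_id _ _ setT) ttheta) HW.
exists r => //; exists (fun x => P^-1 * g (- x)).
  by apply: oscillationsZ; exact: oscillations_opp.
have og' := oscillationsZ P^-1 (oscillations_opp og).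
have [sg' _] := oscillations_smooth og'.
set g' := (fun x => P^-1 * g (- x)) in og' sg' *.
have oB : open (obox x0 r) by exact: obox_open.
have mB := open_measurable_rV oB.
have BO : obox x0 r `<=` Omega.
  apply: subset_trans rO => x xr i; apply: ltW; apply: lt_trans (xr i) _.
  by rewrite ltrDl.
have bB : bounded_set (obox x0 r).
  have [M [Mr HM]] := compact_rV_bounded (@cbox_compact _ _ x0 r).
  by exists M; split => // y My x /subset_obox_cbox; exact: HM.
have ig' : L1 (obox x0 r) g' by apply: continuous_L1 => //; exact: smooth_continuous.
have iuB : L1 (obox x0 r) u by exact: integrableS iu.
have := @ae_eq0_of_tfun _ _ (obox x0 r) (fun x => u x - g' x) oB (lebesgue_bounded_fin bB mB).
move=> /(_ (integrableB mB iuB ig')) H.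
suff : {ae mu, forall x, obox x0 r x -> u x - g' x = 0}.
  by apply: filterS => x h xr; apply/eqP; rewrite -subr_eq0 h.
apply: H => psi tpsi; have tpsiT := tfunS (@subsetT _ (obox x0 r)) tpsi.
have psi0 x : ~ obox x0 r x -> psi x = 0 by exact: tfun_out tpsi.
have psiO v : cbox 0 r v -> tfun Omega (fun x => psi (x + v)).
  move=> vr; apply: (@tfun_translate psi x0 x0 v r) => //; first exact: tpsi.1.
    by move=> x nx; apply: psi0 => /subset_obox_cbox.
  by rewrite subrr.
have := mollify tpsiT psiO ttheta (@obump_even R d r 1) th0; rewrite -/P.
have -> : \int[mu]_z (psi z * average mu ut id theta (- z)) = P * \int[mu]_(x in obox x0 r) (g' x * psi x).
  rewrite -RintegralZl//; last exact: L1_mul.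
  rewrite (Rintegral_out mB); last by move=> x nx; rewrite psi0// !mulr0.
  apply: eq_Rintegral => z _; have [zr|zr] := pselect (obox x0 r z); last by rewrite psi0// !mulr0 mul0r.
  rewrite gW; last by move=> i; have := zr i; rewrite !mxE -opprB opprK normrN addrC => /ltW.
  by rewrite /g' mulrA mulrA mulfV ?gt_eqF// mul1r mulrC.
rewrite mulrC => /(mulfI (lt0r_neq0 P0)) E.
rewrite (_ : \int[mu]_(x in obox x0 r) _ = \int[mu]_(x in obox x0 r) (u x * psi x) -
   \int[mu]_(x in obox x0 r) (g' x * psi x)); last first.
  rewrite -RintegralB//; [|exact: L1_mul|exact: L1_mul].
  by apply: eq_Rintegral => x _; rewrite mulrBl.
rewrite -E (Rintegral_out mO); last first.
  by move=> x nx; rewrite psi0 ?mulr0// => /BO.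
by rewrite (Rintegral_out mB) ?subrr// => x nx; rewrite psi0 ?mulr0.
Qed.

End local_representation.

(** * Gluing local representations on a connected set *)

Section gluing.
Context {R : realType} {d : nat}.
Local Notation Rd := 'rV[R]_d.
Local Notation mu := (@lebesgue_rV R d).

(** The set where g and h differ inside A is open, and a nonempty open set contains a box of
    positive measure. *)
Lemma ae_eq_continuous (A : set Rd) (g h : Rd -> R) : open A -> continuous g -> continuous h ->
  {ae mu, forall x, A x -> g x = h x} -> forall x, A x -> g x = h x.
Proof.
move=> oA cg ch [N [mN N0 HN]] x Ax; apply: contrapT => gh.
have [e e0 eN] : exists2 e : R, 0 < e & cbox x e `<=` N.
  have oB : open (A `&` [set y | g y - h y != 0]).
    apply: openI => //; apply: (@open_comp _ _ (fun y => g y - h y) [set z : R | z != 0]).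
      by move=> y _; apply: (cvgB (cg y) (ch y)).
    exact: open_neq.
  have : nbhs x (A `&` [set y | g y - h y != 0]).
    by apply: open_nbhs_nbhs; split => //; split => //=; rewrite subr_eq0; exact/eqP.
  move=> /nbhs_cboxP[e e0 eB]; exists e => // y /eB[Ay /= yn]; apply: HN => /= H.
  by move: yn; rewrite subr_eq0 => /eqP; apply; exact: H.
have := lebesgue_cbox_gt0 x e0; rewrite ltNge => /negP; apply.
rewrite -N0; apply: le_lebesgue_rV => //.
by apply: closed_measurable_rV; exact: cbox_closed.
Qed.

(** Compactness leaves finitely many exceptional null sets. *)
Lemma ae_cbox (c : Rd) (r : R) (P : Rd -> Prop) :
  (forall x, cbox c r x -> exists2 rho : R, 0 < rho & {ae mu, forall y, obox x rho y -> P y}) ->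
  {ae mu, forall y, cbox c r y -> P y}.
Proof.
move=> H; have /choice[rho Hrho] x : exists rho : R, cbox c r x ->
    0 < rho /\ {ae mu, forall y, obox x rho y -> P y}.
  have [xr|xr] := pselect (cbox c r x); last by exists 1.
  by have [rho rho0 h] := H x xr; exists rho.
have := @cbox_compact _ _ c r; rewrite compact_cover.
move=> /(_ Rd (cbox c r) (fun x => obox x (rho x))).
case=> [x _|x xr|s sO cov]; first exact: obox_open.
  exists x => //; have [rho0 _] := Hrho x xr.
  exact: (nbhs_singleton (nbhs_obox x rho0)).
have gU : {ae mu, forall y, (\bigcup_(x in [set` s]) obox x (rho x)) y -> P y}.
  rewrite bigcup_fset.
  have : {in enum_fset s, forall x, {ae mu, forall y, obox x (rho x) y -> P y}}.
    by move=> x xs; have [] := Hrho x (set_mem (sO x xs)).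
  elim: (enum_fset s) => [_|x l IH Hl].
    by rewrite big_nil; apply: aeW.
  rewrite big_cons; have h1 := Hl x (mem_head _ _).
  have h2 : {ae mu, forall y, (\big[setU/set0]_(i <- l) obox i (rho i)) y -> P y}.
    by apply: IH => y yl; apply: Hl; rewrite inE yl orbT.
  by apply: filterS2 h1 h2 => y p1 p2 [/p1|/p2].
by apply: filterS gU => y Py /cov; exact: Py.
Qed.

Variables (Omega : set Rd) (V : set (Rd -> R)) (u : Rd -> R).
Hypothesis dO : domain Omega.
Hypothesis Vc : forall g, V g -> continuous g.
Hypothesis Vu : forall g h (x : Rd), V g -> V h -> (\forall y \near x, g y = h y) -> g = h.
Hypothesis local : forall x, Omega x -> exists2 r : R, 0 < r &
  exists2 g, V g & {ae mu, forall y, obox x r y -> u y = g y}.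

Let good (g : Rd -> R) (x : Rd) := exists2 r : R, 0 < r & {ae mu, forall y, obox x r y -> u y = g y}.

Let good_near g x : good g x -> nbhs x (good g).
Proof.
move=> [r r0 H]; apply: filterS (nbhs_obox x r0) => y yr.
have /nbhs_cboxP[e e0 eB] : nbhs y (obox x r) by apply: open_nbhs_nbhs; split => //; exact: obox_open.
exists e => //; apply: filterS H => z Hz ze; apply: Hz; apply: eB; exact: subset_obox_cbox.
Qed.

Let good_unique g h x : V g -> V h -> good g x -> good h x -> g = h.
Proof.
move=> Vg Vh [r r0 Hg] [s s0 Hh]; apply: (Vu (x := x)) => //.
have rs0 : 0 < Num.min r s by rewrite lt_min r0.
apply: filterS (nbhs_obox x rs0); apply: ae_eq_continuous.
- exact: obox_open.
- exact: Vc.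
- exact: Vc.
- apply: filterS2 Hg Hh => y h1 h2 ys; rewrite -h1; first rewrite -h2 //.
  + by move=> i; apply: lt_le_trans (ys i) _; rewrite ge_min lexx orbT.
  + by move=> i; apply: lt_le_trans (ys i) _; rewrite ge_min lexx.
Qed.

(** The points of Omega near which u agrees with a fixed g form an open set. It is closed in Omega:
    near a point where u is represented by h, a single point good for g forces g = h. *)
Lemma glue : exists2 g, V g & ae_eq_on Omega u g.
Proof.
have [[x0 Ox0] oO cO] := dO; have [r0 r00 [g Vg Hg]] := local Ox0.
exists g => //; pose S := Omega `&` [set x | good g x].
have SO : S = Omega.
  apply: cO; first by exists x0; split => //; exists r0.
  - exists S; last by rewrite setIA setIid.
    apply: openI => //; rewrite openE => x /good_near; exact.
  - exists (~` (Omega `&` [set x | ~ good g x])).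
      apply: open_closedC; rewrite openE => x [Ox nx].
      have [r rr0 [h Vh Hh]] := local Ox.
      have /good_near : good h x by exists r.
      have : nbhs x Omega by exact: open_nbhs_nbhs.
      apply: filterS2 => y Oy hy; split => // gy; apply: nx.
      by rewrite (good_unique Vg Vh gy hy); exists r.
    apply/seteqP; split => [x [Ox gx]|x [Ox nx]]; split => //; first by case.
    by apply: contrapT => ngx; apply: nx.
(* Agreement near each point becomes agreement almost everywhere through countably many compact
   boxes. *)
have [c [r [r1 rO OE]]] := open_bigcup_obox oO (ex_intro _ x0 Ox0).
have H k : {ae mu, forall y, cbox (c k) (r k) y -> u y = g y}.
  by apply: ae_cbox => x /rO; rewrite -SO => -[_ [rho rho0 Hx]]; exists rho.
have := ae_foralln H; apply: filterS => y Hy; rewrite OE => -[k _ yk].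
by apply: (Hy k); exact: subset_obox_cbox.
Qed.

End gluing.

(** * The zero set of the functional *)

Section kernel_of_TGV.
Context {R : realType} {n : nat}.
Local Notation Rd := 'rV[R]_n.+1.
Local Notation mu := (@lebesgue_rV R n.+1).
Variables (Omega : set Rd) (alpha beta : R) (omega : Rd).
Hypotheses (oO : open Omega) (bO : bounded_set Omega).
Hypotheses (alpha0 : 0 < alpha) (beta0 : 0 < beta).

Let c := tensor_sq omega.
Local Notation TGV := (TGV_osci Omega alpha beta c).
Let mO : measurable Omega := open_measurable_rV oO.

Lemma test_field_bounded p q (X : set 'M[R]_(p, q)) (phi : Rd -> 'M[R]_(p, q)) : test_field X Omega phi ->
  exists2 s : R, 0 <= s & forall x, fnorm (phi x) <= s.
Proof.
move=> tphi.
have /choice[M HM] (ij : 'I_p * 'I_q) : exists M : R, 0 < M /\ forall x, `|phi x ij.1 ij.2| <= M.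
  by have [M M0 HM] := tfun_bounded (test_field_tfun ij.1 ij.2 tphi); exists M.
exists ((p * q)%:R * \sum_ij M ij).
  by rewrite mulr_ge0// sumr_ge0// => ij _; have [/ltW] := HM ij.
move=> x; apply: fnorm_le => i j; have [_ h] := HM (i, j); apply: le_trans (h x) _.
rewrite (bigD1 (i, j))//= lerDl sumr_ge0// => ij _; by have [/ltW] := HM ij.
Qed.

Lemma test_field_mat_div (phi : Rd -> 'M[R]_n.+1) : test_field sym_space Omega phi ->
  test_field vec_space Omega (mat_div phi).
Proof.
by move=> tphi; apply: tfun_test_field => // i j; rewrite [i]ord1; exact: tfun_mat_div.
Qed.

(** When E w + c u is tested with phi and grad u - w with div phi, the two pairings with w cancel.
    What remains is an expression in u alone, bounded by a multiple of the energy of w, which can be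
    made arbitrarily small. *)
Lemma TGV0_weak (u : Rd -> R) phi : L1 Omega u -> TGV u = 0%E -> test_field sym_space Omega phi ->
  \int[mu]_(x in Omega) (u x * (vec_div (mat_div phi) x + inner c (phi x))) = 0.
Proof.
move=> iu u0 tphi; have tpsi := test_field_mat_div tphi.
have [s s0 Hs] := test_field_bounded tphi; have [s' s'0 Hs'] := test_field_bounded tpsi.
set I0 := \int[mu]_(x in Omega) _.
have tdiv := tfunS (@subsetT _ Omega) (tfun_vec_div tpsi).
have tphiT := test_field_tfunT tphi; have tpsiT := test_field_tfunT tpsi.
have H (e : R) : 0 < e -> `|I0| <= e / beta * s + e / alpha * s'.
  move=> e0; have [|w [iw _] Hw] := TGV_minimizing (c := c) oO alpha0 beta0 iu e0 (a := 0).
    by rewrite u0.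
  rewrite add0r in Hw; have [G1 E1] := energy_le_parts oO alpha0 beta0 iu iw Hw.
  have BE := radon_norm_bound E1 (@sym_spaceZ R n.+1)
     (fun k => homogeneous_sym_part c oO iu iw k tphi) tphi s0 Hs.
  have BG := radon_norm_bound G1 (fun _ _ _ => I)
     (fun k => homogeneous_grad_part oO iu iw k tpsi) tpsi s'0 Hs'.
  have i1 := L1_inner oO iw tpsiT.
  have i2 := L1_inner oO (L1_fieldZc oO c iu) tphiT.
  have i3 := L1_mul oO iu tdiv.
  have -> : I0 = (sym_grad Omega w + dist_of Omega (fun x => u x *: c))%R phi -
      (weak_grad Omega u - dist_of Omega w)%R (mat_div phi).
    rewrite /= !fctE /= /sym_grad /weak_grad /dist_of.
    rewrite (_ : \int[mu]_(x in Omega) inner (w x) (- mat_div phi x) =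
       - \int[mu]_(x in Omega) inner (w x) (mat_div phi x)); last first.
      rewrite -mulN1r -RintegralZl//; apply: eq_Rintegral => x _.
      by rewrite innerNr mulN1r.
    rewrite (_ : \int[mu]_(x in Omega) (u x * - vec_div (mat_div phi) x) =
       - \int[mu]_(x in Omega) (u x * vec_div (mat_div phi) x)); last first.
      rewrite -mulN1r -RintegralZl//; apply: eq_Rintegral => x _.
      by rewrite mulrN mulN1r.
    rewrite (_ : I0 = \int[mu]_(x in Omega) (u x * vec_div (mat_div phi) x) +
       \int[mu]_(x in Omega) inner (u x *: c) (phi x)); first by ring.
    rewrite -RintegralD//; apply: eq_Rintegral => x _.
    by rewrite [inner (u x *: c) _]innerC innerZr [inner (phi x) c]innerC mulrDr.
  by apply: le_trans (ler_normB _ _) _; exact: lerD.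
apply/eqP; rewrite -normr_le0; apply/ler_addgt0Pr => e e0; rewrite add0r.
pose K := beta^-1 * s + alpha^-1 * s' + 1.
have K0 : 0 < K by rewrite ltr_wpDl// addr_ge0// mulr_ge0// invr_ge0 ltW.
apply: le_trans (H (e / K) (divr_gt0 e0 K0)) _.
rewrite (_ : _ + _ = e / K * (K - 1)); last by rewrite /K; ring.
by rewrite mulrAC ler_pdivrMr// ler_wpM2l ?(ltW e0)// gerBl.
Qed.

Lemma sum_delta_mx (i j : 'I_n.+1) (X : 'I_n.+1 -> 'I_n.+1 -> R) :
  \sum_a \sum_b (delta_mx i j : 'M[R]_n.+1) a b * X a b = X i j.
Proof.
rewrite (bigD1 i)//= [X in _ + X]big1 ?addr0 => [|a ai].
  rewrite (bigD1 j)//= big1 ?addr0 => [|b bj]; first by rewrite mxE !eqxx mul1r.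
  by rewrite mxE (negbTE bj) andbF mul0r.
by rewrite big1// => b _; rewrite mxE (negbTE ai) mul0r.
Qed.

(** For the test field eta (e_i e_j^T + e_j e_i^T) the double divergence is 2 d_i d_j eta and the
    contraction with c is 2 omega_i omega_j eta, also for i = j. *)
Lemma TGV0_weak_hess (u : Rd -> R) : L1 Omega u -> TGV u = 0%E -> weak_hess omega Omega u.
Proof.
move=> iu u0 i j eta teta.
pose S : 'M[R]_n.+1 := delta_mx i j + delta_mx j i.
pose phi x : 'M[R]_n.+1 := eta x *: S.
have phiE a b : (fun x => phi x a b) = (fun x => S a b * eta x).
  by apply/funext => x; rewrite /phi mxE mulrC.
have tphi : test_field sym_space Omega phi.
  apply: tfun_test_field => [x|a b]; last by rewrite phiE; exact: tfunZ.
  apply: sym_spaceZ; rewrite /sym_space /= /S linearD /= !trmx_delta addrC //.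
have seta := teta.1.
have divE x : vec_div (mat_div phi) x = 2 * partial j (partial i eta) x.
  have mE a : (fun y => mat_div phi y 0 a) = (fun y => \sum_b S a b * partial b eta y).
    apply/funext => y; rewrite mxE; apply: eq_bigr => b _.
    by rewrite phiE partialZ.
  have pE a : partial a (fun y => mat_div phi y 0 a) x = \sum_b S a b * partial a (partial b eta) x.
    rewrite mE.
    have sb b : smooth (fun y => S a b * partial b eta y) by apply: smoothZ; exact: smooth_partial.
    have -> : (fun y => \sum_b S a b * partial b eta y) = \sum_b (fun y => S a b * partial b eta y).
      by apply/funext => y; rewrite fct_sumE.
    rewrite {1}/partial derive_sum; last by move=> b; exact: smooth_derivable (sb b).
    by apply: eq_bigr => b _; rewrite -/(partial a _ x) partialZ//; exact: smooth_partial.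
  rewrite /vec_div; under eq_bigr do rewrite pE.
  under eq_bigr => a _ do (under eq_bigr => b _ do rewrite mxE mulrDl).
  under eq_bigr => a _ do rewrite big_split.
  rewrite big_split /= !sum_delta_mx (partialC i j x (seta 2%N)); ring.
have inE' x : inner c (phi x) = 2 * (omega 0 i * omega 0 j * eta x).
  rewrite /inner; under eq_bigr => a _ do (under eq_bigr => b _ do rewrite /phi 3!mxE mulrA mulrC mulrDl).
  under eq_bigr => a _ do rewrite big_split.
  by rewrite big_split /= !sum_delta_mx; ring.
have := TGV0_weak iu u0 tphi.
rewrite (_ : \int[mu]_(x in Omega) _ = 2 * \int[mu]_(x in Omega)
   (u x * (partial j (partial i eta) x + omega 0 i * omega 0 j * eta x))).
  by move=> /eqP; rewrite mulf_eq0 pnatr_eq0 /= => /eqP.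
rewrite -RintegralZl//.
  by apply: eq_Rintegral => x _; rewrite divE inE'; ring.
apply: (L1_mul oO iu); apply: (tfunS (@subsetT _ Omega)); apply: tfunD.
  by do 2 apply: tfun_partial.
exact: tfunZ.
Qed.

Lemma integration_by_parts_tfun (f psi : Rd -> R) i : smooth f -> tfun Omega psi ->
  \int[mu]_(x in Omega) (f x * partial i psi x) = - \int[mu]_(x in Omega) (partial i f x * psi x).
Proof.
move=> sf tpsi; have tfp := tfunM sf tpsi.
have Lf (g : Rd -> R) : smooth g -> L1 Omega g.
  by move=> sg; apply: continuous_L1 => //; exact: smooth_continuous.
have i1 := L1_mul oO (Lf f sf) (tfunS (@subsetT _ Omega) (tfun_partial i tpsi)).
have i2 := L1_mul oO (Lf _ (smooth_partial i sf)) (tfunS (@subsetT _ Omega) tpsi).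
apply/eqP; rewrite -subr_eq0 opprK -RintegralD//; apply/eqP.
have [_ [K [cK _] K0]] := tfp.
rewrite -[RHS](Rintegral_partial i (tfp.1 1%N) cK K0).
rewrite -(Rintegral_out mO); last by move=> x nx; exact: tfun_out (tfun_partial i tfp) nx.
apply: eq_Rintegral => x _; rewrite partialM; first by rewrite [partial i f x * _]mulrC.
- by move=> y; exact: smooth_derivable.
- by move=> y; exact: smooth_derivable tpsi.1.
Qed.

(** The competitor w = grad g makes both parts of the energy vanish; u enters only through
    integrals, where g may replace it. *)
Lemma TGV_oscillation (u g : Rd -> R) : L1 Omega u -> smooth g -> hess_on omega setT g ->
  ae_eq_on Omega u g -> TGV u = 0%E.
Proof.
move=> iu sg Hg ug.
have Lf (f : Rd -> R) : smooth f -> L1 Omega f.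
  by move=> sf; apply: continuous_L1 => //; exact: smooth_continuous.
pose W x : Rd := \row_i partial i g x.
have iW : L1_field Omega W.
  move=> i j; rewrite /L1; under eq_fun do rewrite /= mxE.
  exact: (Lf _ (smooth_partial j sg)).
have uE psi : tfun setT psi -> \int[mu]_(x in Omega) (u x * psi x) = \int[mu]_(x in Omega) (g x * psi x).
  move=> tpsi; rewrite /Rintegral; congr fine; apply: ae_eq_integral => //.
  - exact: measurable_int (L1_mul oO iu tpsi).
  - exact: measurable_int (L1_mul oO (Lf g sg) tpsi).
  - by apply: filterS ug => x h Ox /=; rewrite h.
have gradE phi : test_field vec_space Omega phi -> weak_grad Omega u phi = dist_of Omega W phi.
  move=> tphi; rewrite /weak_grad uE; last first.
    by apply: (tfunS (@subsetT _ Omega)); apply: tfunN; exact: tfun_vec_div.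
  rewrite (dist_ofE oO iW (test_field_tfunT tphi)) big_ord1.
  have tj j := test_field_tfun 0 j tphi.
  have ij j : L1 Omega (fun x => g x * partial j (fun y => phi y 0 j) x).
    exact: (L1_mul oO (Lf g sg) (tfunS (@subsetT _ Omega) (tfun_partial j (tj j)))).
  transitivity (- \sum_j \int[mu]_(x in Omega) (g x * partial j (fun y => phi y 0 j) x)).
    rewrite -Rintegral_sum// -mulN1r -RintegralZl//; last exact: integrable_sumr.
    by apply: eq_Rintegral => x _; rewrite mulN1r mulrN mulr_sumr.
  rewrite -sumrN; apply: eq_bigr => j _; rewrite (integration_by_parts_tfun j sg (tj j)) opprK.
  by apply: eq_Rintegral => x _; rewrite mxE.
have symE phi : test_field sym_space Omega phi ->
    sym_grad Omega W phi = - dist_of Omega (fun x => u x *: c) phi.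
  move=> tphi; have tj a b := test_field_tfun a b tphi.
  rewrite (dist_ofE oO (L1_fieldZc oO c iu) (test_field_tfunT tphi)).
  rewrite /sym_grad (dist_ofE oO iW (tfun_opp_mat_div tphi)) big_ord1 -sumrN.
  apply: eq_bigr => a _; rewrite -sumrN.
  have sa := smooth_partial a sg.
  have ib b : L1 Omega (fun x => partial a g x * partial b (fun y => phi y a b) x).
    exact: (L1_mul oO (Lf _ sa) (tfunS (@subsetT _ Omega) (tfun_partial b (tj a b)))).
  transitivity (- \sum_b \int[mu]_(x in Omega) (partial a g x * partial b (fun y => phi y a b) x)).
    rewrite -Rintegral_sum// -mulN1r -RintegralZl//; last exact: integrable_sumr.
    by apply: eq_Rintegral => x _; rewrite 3!mxE mulN1r mulrN mulr_sumr.
  rewrite -sumrN; apply: eq_bigr => b _; rewrite (integration_by_parts_tfun b sa (tj a b)); congr (- _).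
  have tab := tfunS (@subsetT _ Omega) (tfunZ (c a b) (tj a b)).
  transitivity (\int[mu]_(x in Omega) (g x * (c a b * phi x a b))).
    rewrite -mulN1r -RintegralZl//; last first.
      exact: (L1_mul oO (Lf _ (smooth_partial b sa)) (tfunS (@subsetT _ Omega) (tj a b))).
    by apply: eq_Rintegral => x _; rewrite Hg// /c mxE; ring.
  by rewrite -(uE _ tab); apply: eq_Rintegral => x _; rewrite [(u x *: c) a b]mxE mulrA.
have uBV : BV Omega u.
  split => //; have [K HK] := dist_of_bound oO vec_space iW.
  apply: (@le_lt_trans _ _ K%:E); last by rewrite ltry.
  apply/radon_norm_le => phi tphi phi1; rewrite lee_fin gradE//.
  exact: le_trans (ler_norm _) (HK phi tphi phi1).
have WBD : BD Omega W.
  split => //; have [K HK] := dist_of_bound oO sym_space (L1_fieldZc oO c iu).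
  apply: (@le_lt_trans _ _ K%:E); last by rewrite ltry.
  apply/radon_norm_le => phi tphi phi1; rewrite lee_fin symE//.
  by apply: le_trans (ler_norm _) _; rewrite normrN; exact: HK.
apply/eqP; rewrite eq_le TGV_ge0// andbT (le_trans (TGV_le _ _ _ uBV WBD))//.
apply: energy_le => // phi psi tphi _ tpsi _.
by rewrite !fctE gradE// symE// subrr addNr !mulr0 addr0.
Qed.

Lemma TGV_eq0 (u : Rd -> R) : domain Omega -> L1 Omega u ->
  TGV u = 0%E <-> exists2 g, oscillations omega g & ae_eq_on Omega u g.
Proof.
move=> dO iu; split=> [u0|[g og ug]]; last first.
  by have [sg Hg] := oscillations_smooth og; exact: TGV_oscillation ug.
apply: glue => //.
- by move=> g /oscillations_smooth[sg _]; exact: smooth_continuous.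
- by move=> g h x; exact: oscillations_unique.
- by move=> x Ox; exact: (local_oscillation oO iu (TGV0_weak_hess iu u0)).
Qed.

End kernel_of_TGV.

Theorem proposition2 (R : realType) (n : nat) (Omega : set 'rV[R]_n.+1)
    (Omega_domain : domain Omega)
    (Omega_bounded : bounded_set Omega)
    (Omega_lipschitz : lipschitz_boundary Omega)
    (alpha beta : R) (alpha_gt0 : 0 < alpha) (beta_gt0 : 0 < beta)
    (omega : 'rV[R]_n.+1) :
  let TGV := TGV_osci Omega alpha beta (tensor_sq omega) in
  [/\ forall u, L1 Omega u -> (0 <= TGV u)%E,
      L1_proper Omega TGV,
      L1_lsc Omega TGV,
      forall (lambda : R) u, L1 Omega u ->
        TGV (fun x => lambda * u x) = (`|lambda|%:E * TGV u)%E &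
      forall u v, L1 Omega u -> L1 Omega v ->
        (TGV (fun x => u x + v x)%R <= TGV u + TGV v)%E]
  /\ (omega != 0 -> forall u, L1 Omega u ->
        (TGV u = 0%E <->
         exists C1 C2 : R, ae_eq_on Omega u
           (fun x => C1 * cos (inner omega x) + C2 * sin (inner omega x))))
  /\ (omega = 0 -> forall u, L1 Omega u ->
        (TGV u = 0%E <->
         exists (a : 'rV[R]_n.+1) (b : R),
           ae_eq_on Omega u (fun x => inner a x + b))).
Proof.
have [_ oO _] := Omega_domain; move=> TGV; split; last split.
- split.
  + by move=> u; exact: TGV_ge0.
  + exact: TGV_proper.
  + exact: TGV_lsc.
  + by move=> k u; exact: TGVZ.
  + by move=> u v; exact: TGVD_le.
- move=> w0 u iu; apply: (iff_trans (TGV_eq0 omega oO Omega_bounded alpha_gt0 beta_gt0 Omega_domain iu)).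
  rewrite /oscillations (negbTE w0); split=> [[g [C1 [C2 ->]] ug]|[C1 [C2 ug]]].
    by exists C1, C2.
  by eexists; [exists C1, C2; reflexivity|].
- move=> w0 u iu; apply: (iff_trans (TGV_eq0 omega oO Omega_bounded alpha_gt0 beta_gt0 Omega_domain iu)).
  rewrite /oscillations w0 eqxx; split=> [[g [a [b ->]] ug]|[a [b ug]]].
    by exists a, b.
  by eexists; [exists a, b; reflexivity|].
Qed.
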